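(* Let $(T_m)$ be a consistent sequence of uniform spanning trees, $\bar\alpha=\frac43+\frac1{15}\sqrt{205}$ and $V_*=\bigcup_{n\ge0}VG_n$. Then almost surely the limit \[d_*(u,v)=\lim_{m\to\infty}\bar\alpha^{-m}d_{T_m}(u,v)\] exists for all $u,v\in V_*$ (where $d_{T_m}(u,v)$ is defined once $u,v\in VG_m$), and $d_*$ is a metric on $V_*$ (in particular $d_*(u,v)>0$ for $u\ne v$) such that $(V_*,d_* )$ is $0$-hyperbolic and totally bounded. Moreover the map $\omega\mapsto d_*$ is measurable with respect to the $\sigma$-algebra on the set of metrics on $V_*$ generated by the evaluations $d\mapsto d(u,v)$, $u,v\in V_*$, and almost surely the Cauchy completion of $(V_*,d_* )$ is a compact $\mathbb R$-tree.
   Context: Let $u_1=(0,0)$, $u_2=(1,0)$, $u_3=(\tfrac12,\tfrac{\sqrt3}2)$ in $\mathbb R^2$ and $\psi_i(x)=\tfrac12(x-u_i)+u_i$ for $i\in\{1,2,3\}$. The Sierpiński graphs $G_n$ (embedded in the plane) are defined recursively: $G_0$ has vertex set $VG_0=\{u_1,u_2,u_3\}$ and edge set $\{\{u_1,u_2\},\{u_2,u_3\},\{u_3,u_1\}\}$; $G_{n+1}$ has vertex set $\psi_1(VG_n)\cup\psi_2(VG_n)\cup\psi_3(VG_n)$ and edge set $\psi_1(EG_n)\cup\psi_2(EG_n)\cup\psi_3(EG_n)$ (edges mapped vertexwise); $VG_0\subset VG_1\subset\cdots$. For a word $w=w_1\cdots w_k\in\{1,2,3\}^k$ put $\psi_w=\psi_{w_1}\circ\cdots\circ\psi_{w_k}$;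 then $G_n=\bigcup_{w\in\{1,2,3\}^k}\psi_w(G_{n-k})$. For a spanning subgraph $H\subseteq G_n$ and $w\in\{1,2,3\}^k$, $\pi_w(H)=\psi_w^{-1}(H\cap\psi_w(G_{n-k}))$. $\mathcal T_n$ denotes the set of spanning trees of $G_n$; $\mathcal S_n^i$ the set of spanning forests of $G_n$ with two components, one containing $u_i$ and the other containing $\{u_1,u_2,u_3\}\setminus\{u_i\}$; $\mathcal R_n$ the set of spanning forests with three components each containing exactly one of $u_1,u_2,u_3$; $\mathcal Q_n=\mathcal T_n\cup\mathcal S_n^1\cup\mathcal S_n^2\cup\mathcal S_n^3\cup\mathcal R_n$. For $g\in\mathcal Q_1$, $\mathrm{Tr}\,g$ is the spanning subgraph of $G_0$ equal to: the two edges at $u_i$ if $g$ is a spanning tree of $G_1$ in which for both $j\neq i$ the path from $u_i$ to $u_j$ lies in $\psi_i(G_0)\cup\psi_j(G_0)$ (every spanning tree of $G_1$ satisfies this for exactly one $i$); the single edge not containing $u_i$ if $g\in\mathcal S_1^i$; the edgeless graph if $g\in\mathcal R_1$. For $f\in\mathcal Q_{n+1}$, $\mathrm{Tr}\,f=\bigcup_{w\in\{1,2,3\}^n}\psi_w(\mathrm{Tr}\,\pi_w(f))$; Tr maps spanning trees of $G_{n+1}$ to spanning trees of $G_n$. A consistent sequence of uniform spanning trees is a sequence $(T_n)_{n\ge0}$ of random spanning trees defined on a common probability space such that $T_n$ is uniformly distributed on $\mathcal T_n$ and $\mathrm{Tr}\,T_{n+1}=T_n$ for all $n$. $d_t$ denotes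 the graph distance in a tree $t$. A metric space $(Y,d)$ is $0$-hyperbolic if $d(u,v)+d(x,y)\le\max\{d(u,x)+d(v,y),\,d(u,y)+d(v,x)\}$ for all $u,v,x,y\in Y$. It is an $\mathbb R$-tree if any two points are joined by a unique arc and this arc is the image of an isometric embedding of a real interval. *)

(* Defs.v *)
From HB Require Import structures.
From mathcomp Require Import all_boot all_order all_algebra.
From mathcomp Require Import all_classical all_reals all_analysis.
From Stdlib Require Lists.List.
Set Implicit Arguments. Unset Strict Implicit. Unset Printing Implicit Defensive.
Import Order.TTheory GRing.Theory Num.Theory.
Local Open Scope classical_set_scope.
Local Open Scope ring_scope.

(* Points of the plane.  We use affine coordinates (s,t) with respect to the *)
(* basis (u2 - u1, u3 - u1): the point (s,t) stands for s*u2 + t*u3.  This   *)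
(* linear map is injective and commutes with the affine maps psi_i, so the   *)
(* Sierpinski graphs below are exactly the images of the paper's graphs.     *)
(* Index i : 'I_3 with values 0,1,2 stands for the paper's 1,2,3.            *)
Definition Point := (rat * rat)%type.

Definition uu (i : 'I_3) : Point :=
  match val i with
  | 0%N => (0, 0)
  | 1%N => (1, 0)
  | _ => (0, 1)
  end.

(* psi_i(x) = (x - u_i)/2 + u_i = (x + u_i)/2 *)
Definition psi (i : 'I_3) (p : Point) : Point :=
  ((p.1 + (uu i).1) / 2, (p.2 + (uu i).2) / 2).

Definition psiw (w : seq 'I_3) (p : Point) : Point := foldr psi p w.

Definition i0 : 'I_3 := @Ordinal 3 0 isT.
Definition i1 : 'I_3 := @Ordinal 3 1 isT.
Definition i2 : 'I_3 := @Ordinal 3 2 isT.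

Fixpoint VG (n : nat) : seq Point :=
  match n with
  | 0%N => [:: uu i0; uu i1; uu i2]
  | m.+1 => [seq psi i p | i <- enum 'I_3, p <- VG m]
  end.

Fixpoint EG (n : nat) : seq (Point * Point) :=
  match n with
  | 0%N => [:: (uu i0, uu i1); (uu i1, uu i2); (uu i2, uu i0)]
  | m.+1 => [seq (psi i e.1, psi i e.2) | i <- enum 'I_3, e <- EG m]
  end.

Definition adjG (n : nat) (x y : Point) : bool :=
  ((x, y) \in EG n) || ((y, x) \in EG n).

(* A spanning subgraph of G_n is represented by its (symmetric) adjacency    *)
(* relation H : rel Point, whose edges must be edges of G_n; its vertex set  *)
(* is VG n.                                                                   *)
Definition isSub (n : nat) (H : rel Point) : Prop :=
  (forall x y, H x y = H y x) /\ (forall x y, H x y -> adjG n x y).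

Definition conn (H : rel Point) (x y : Point) : Prop :=
  exists p : seq Point, path H x p /\ last x p = y.

Definition acyclic (H : rel Point) : Prop :=
  forall c : seq Point, uniq c -> (3 <= size c)%N -> ~~ cycle H c.

Definition isST (n : nat) (H : rel Point) : Prop :=
  isSub n H /\ acyclic H /\
  (forall x y, x \in VG n -> y \in VG n -> conn H x y).

(* S_n^i : two components, one containing u_i, the other the two other u_j *)
Definition isS (n : nat) (i : 'I_3) (H : rel Point) : Prop :=
  isSub n H /\ acyclic H /\
  (forall x, x \in VG n -> exists j, conn H x (uu j)) /\
  (forall j, j != i -> ~ conn H (uu i) (uu j)) /\
  (forall j k, j != i -> k != i -> conn H (uu j) (uu k)).

(* R_n : three components, each containing exactly one u_j *)
Definition isR (n : nat) (H : rel Point) : Prop :=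
  isSub n H /\ acyclic H /\
  (forall x, x \in VG n -> exists j, conn H x (uu j)) /\
  (forall j k, j != k -> ~ conn H (uu j) (uu k)).

Definition isQ (n : nat) (H : rel Point) : Prop :=
  isST n H \/ (exists i, isS n i H) \/ isR n H.

Definition psiEdge (i : 'I_3) (x y : Point) : Prop :=
  exists a b, adjG 0 a b /\ x = psi i a /\ y = psi i b.

(* for a spanning tree g of G_1: for both j <> i the (unique simple) path    *)
(* from u_i to u_j in g lies in psi_i(G_0) \cup psi_j(G_0)                    *)
Definition centerAt (g : rel Point) (i : 'I_3) : Prop :=
  forall j, j != i ->
    exists p : seq Point,
      [/\ path g (uu i) p, last (uu i) p = uu j, uniq (uu i :: p) &
        forall k, (k < size p)%N ->
          psiEdge i (nth (uu i) (uu i :: p) k) (nth (uu i) p k) \/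
          psiEdge j (nth (uu i) (uu i :: p) k) (nth (uu i) p k)].

Definition Tr1 (g : rel Point) : rel Point := fun x y =>
  `[< adjG 0 x y /\
      ((isST 1 g /\ exists i, centerAt g i /\ (x = uu i \/ y = uu i)) \/
       (exists i, isS 1 i g /\ x <> uu i /\ y <> uu i)) >].

Definition piw (m : nat) (w : seq 'I_3) (H : rel Point) : rel Point :=
  fun a b => adjG m a b && H (psiw w a) (psiw w b).

Definition Tr (n : nat) (f : rel Point) : rel Point := fun x y =>
  `[< exists w : seq 'I_3, size w = n /\
        exists a b, [/\ x = psiw w a, y = psiw w b & Tr1 (piw 1 w f) a b] >].

(* graph distance in H (length of a shortest path; 0 if none exists) *)
Definition walkLen (H : rel Point) (x y : Point) (k : nat) : bool :=
  `[< exists p : seq Point, [/\ path H x p, last x p = y & size p = k] >].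

Definition dist (H : rel Point) (x y : Point) : nat :=
  match pselect (exists k, walkLen H x y k) with
  | left e => ex_minn e
  | right _ => 0%N
  end.

Definition Vstar (p : Point) : Prop := exists n, p \in VG n.

Definition alphabar {R : realType} : R := 4 / 3 + Num.sqrt 205 / 15.

Section Metric.
Context {R : realType}.

Definition is_metric_on (X : Type) (S : set X) (d : X -> X -> R) : Prop :=
  forall x y z, S x -> S y -> S z ->
    [/\ d x y = 0 <-> x = y, d x y = d y x & d x z <= d x y + d y z].

Definition is_metric (X : Type) (d : X -> X -> R) : Prop :=
  is_metric_on setT d.

Definition zero_hyperbolic_on (X : Type) (S : set X) (d : X -> X -> R) : Prop :=
  forall u v x y, S u -> S v -> S x -> S y ->
    d u v + d x y <= Num.max (d u x + d v y) (d u y + d v x).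

Definition totally_bounded_on (X : Type) (S : set X) (d : X -> X -> R) : Prop :=
  forall e : R, 0 < e -> exists s : seq X,
    (forall p, Stdlib.Lists.List.In p s -> S p) /\
    (forall v, S v -> exists p, Stdlib.Lists.List.In p s /\ d v p < e).

Definition mopen (X : Type) (d : X -> X -> R) (U : set X) : Prop :=
  forall x, U x -> exists e : R, 0 < e /\ forall y, d x y < e -> U y.

Definition mcompact (X : Type) (d : X -> X -> R) : Prop :=
  forall (I : Type) (U : I -> set X), (forall i, mopen d (U i)) ->
    (forall x, exists i, U i x) ->
    exists s : seq I, forall x, exists i, Stdlib.Lists.List.In i s /\ U i x.

Definition mcauchy (X : Type) (d : X -> X -> R) (x : nat -> X) : Prop :=
  forall e : R, 0 < e -> exists N, forall m n, (N <= m)%N -> (N <= n)%N ->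
    d (x m) (x n) < e.

Definition mconverges (X : Type) (d : X -> X -> R) (x : nat -> X) (l : X) :=
  forall e : R, 0 < e -> exists N, forall n, (N <= n)%N -> d (x n) l < e.

Definition mcomplete (X : Type) (d : X -> X -> R) : Prop :=
  forall x : nat -> X, mcauchy d x -> exists l, mconverges d x l.

Definition is_completion (Y : Type) (S : set Y) (d : Y -> Y -> R)
    (X : Type) (dX : X -> X -> R) (iota : Y -> X) : Prop :=
  [/\ is_metric dX, mcomplete dX,
      (forall u v, S u -> S v -> dX (iota u) (iota v) = d u v) &
      (forall x e, 0 < e -> exists v, S v /\ dX x (iota v) < e)].

Definition mcont01 (X : Type) (dX : X -> X -> R) (g : R -> X) : Prop :=
  forall t, 0 <= t <= 1 -> forall e : R, 0 < e -> exists del : R, 0 < del /\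
    forall s, 0 <= s <= 1 -> `|s - t| < del -> dX (g s) (g t) < e.

Definition is_arc (X : Type) (dX : X -> X -> R) (x y : X) (A : set X) : Prop :=
  (x = y /\ A = [set x]) \/
  (x <> y /\ exists g : R -> X,
     [/\ mcont01 dX g,
         (forall s t, 0 <= s <= 1 -> 0 <= t <= 1 -> g s = g t -> s = t),
         g 0 = x, g 1 = y & A = g @` [set t | 0 <= t <= 1]]).

Definition is_Rtree (X : Type) (dX : X -> X -> R) : Prop :=
  forall x y, exists A, [/\ is_arc dX x y A,
    (forall B, is_arc dX x y B -> B = A) &
    exists (a b : R) (phi : R -> X), [/\ a <= b,
      (forall s t, a <= s <= b -> a <= t <= b -> dX (phi s) (phi t) = `|s - t|) &
      A = phi @` [set t | a <= t <= b]]].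

End Metric.

Definition evalSigma {R : realType} : set (set (Point -> Point -> R)) :=
  smallest (sigma_algebra setT)
    [set A | exists u v (B : set R), [/\ Vstar u, Vstar v, measurable B &
                A = [set d | B (d u v)]]].

(* Main.v *)
Require Import Defs.
From HB Require Import structures.
From mathcomp Require Import all_boot all_order all_algebra.
From mathcomp Require Import all_classical all_reals all_analysis.
From mathcomp Require Import measurable_realfun ring lra zify.
Set Implicit Arguments. Unset Strict Implicit. Unset Printing Implicit Defensive.
Import Order.TTheory GRing.Theory Num.Theory.
Import numFieldNormedType.Exports.
Local Open Scope classical_set_scope.
Local Open Scope ring_scope.

(* A path in T_m traverses a sequence of cells of level m, and passing to T_(m+1) refines
   each traversed cell into two or three cells, according to the subgraph of G_1 that
   T_(m+1) induces there.  Only the type of the traversed cell matters for the mean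
   numbers of offspring: one finds a multitype branching mechanism whose mean matrix has
   eigenvalues alpha, 8/3 - alpha and 0.  Given T_m, the subgraphs of T_(m+1) in different
   cells can be resampled one at a time within the fibres of Tr, so for a right
   eigenvector with eigenvalue l the weights W_m of a path satisfy E(W_(m+1) - l W_m) = 0
   with increments that are uncorrelated over the cells, whence
   E(W_(m+1) - l W_m)^2 <= C E W_m <= C' alpha^m.  By Chebyshev and Borel-Cantelli, for
   almost all trees and all large m, all 9 3^n possible crossings of cells of every level
   n <= m satisfy |W_(m+1) - l W_m| <= alpha^(m+1) (4/5)^m.  This gives convergence of
   alpha^(-m) W_m for all paths at once, and limits O((4/5)^n) for crossings of cells of
   level n, hence total boundedness.  The relative version of the argument, which uses that
   W_m grows at least like 2^m, makes the limits positive.  The four-point condition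
   passes to the limit from the trees T_m; finally a complete 0-hyperbolic metric space in
   which every distance can be subdivided is an R-tree, since the projection to a
   segment is locally constant off the segment. *)

(** * Cells of the Sierpinski graphs *)

(** A subgraph of G_1 is nine bits, so everything about [Tr] inside one cell is settled by
    evaluation over the 512 subgraphs. What remains is to see a tree of G_(n+1) from one cell:
    inside and outside meet in three corners only, hence whether a replacement keeps a spanning tree
    depends on which corners are joined on either side. Deleting one edge fits the same picture, so
    trees are treated as minimal connected spanning subgraphs. The empty trace is also the default
    for subgraphs outside Q_1; cells with empty trace are therefore never resampled, and paths do
    not cross them.

    Resampling is an involution on pairs of a tree and a replacement, so only finite sums over trees
    occur and uncorrelated increments appear as vanishing sums.

    Second moments are forced by alpha < 3: there are 3^n cells of level n, too many for a union
    bound with first moments, while alpha^2 > 3. The absolute bounds hold for all levels at once and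
    make the limits of small cells small. They say nothing about positivity, for which the error has
    to be compared with the weight itself; hence two kinds of bad events. *)

Lemma I3P (i : 'I_3) : [\/ i = i0, i = i1 | i = i2].
Proof.
case: i => [[|[|[|//]]] h]; [constructor 1|constructor 2|constructor 3];
  exact: val_inj.
Qed.

Lemma uu_inj : injective uu.
Proof. by move=> i j; case: (I3P i) => ->; case: (I3P j) => -> // []. Qed.

Lemma psi_inj i : injective (psi i).
Proof. move=> [x y] [x' y'] [/= h1 h2]; congr pair; lra. Qed.

Lemma psiw_inj w : injective (psiw w).
Proof. by elim: w => [//|i w IH] x y /psi_inj/IH. Qed.

Lemma psiw_cat w w' p : psiw (w ++ w') p = psiw w (psiw w' p).
Proof. by rewrite /psiw foldr_cat. Qed.

Lemma psiw_rcons w i p : psiw (rcons w i) p = psiw w (psi i p).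
Proof. by rewrite -cats1 psiw_cat. Qed.

Definition inT (p : Point) := [/\ 0 <= p.1, 0 <= p.2 & p.1 + p.2 <= 1].

Lemma inT_uu i : inT (uu i).
Proof. by case: (I3P i) => ->. Qed.

Lemma inT_psi i p : inT p -> inT (psi i p).
Proof.
case: p => x y; case=> /= h1 h2 h3; case: (I3P i) => ->; rewrite /psi /uu; split=> /=; lra.
Qed.

Lemma inT_psiw w p : inT p -> inT (psiw w p).
Proof. by elim: w => [//|i w IH] /IH/(inT_psi i). Qed.

Lemma psi_overlap i j p q : i != j -> inT p -> inT q -> psi i p = psi j q ->
  p = uu j /\ q = uu i.
Proof.
case: p q => [x y] [x' y'] ij [/= h1 h2 h3] [/= h4 h5 h6].
case: (I3P i) ij => ->; case: (I3P j) => -> // _;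
  by rewrite /psi /= => -[/= e1 e2]; split; congr pair; lra.
Qed.

Lemma psi_uu i : psi i (uu i) = uu i.
Proof. by case: (I3P i) => ->; congr pair. Qed.

Lemma psi_corner i j p : inT p -> psi i p = uu j -> i = j /\ p = uu j.
Proof.
move=> hp; rewrite -{1}(psi_uu j) => e.
have [ij|ij] := eqVneq i j; first by subst; move/psi_inj: e.
have [_ /uu_inj h] := psi_overlap ij hp (inT_uu j) e.
by rewrite h eqxx in ij.
Qed.

Lemma psiw_corner w j p : inT p -> psiw w p = uu j -> p = uu j.
Proof. by move=> hp; elim: w => [//|i w IH] /= /(psi_corner (inT_psiw w hp)) []. Qed.

(** Two different triangles of level one overlap in a single point, a corner of both preimages, and
    only corners are mapped to corners. *)
Lemma psiw_meet w w' p q : size w = size w' -> inT p -> inT q ->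
  psiw w p = psiw w' q -> w = w' \/ (exists j, p = uu j) /\ (exists j, q = uu j).
Proof.
move=> + hp hq; elim: w w' => [|i w IH] [|j w'] //=; first by left.
move=> [hs].
have [<- /psi_inj/(IH _ hs) [->|]|ij] := eqVneq i j; [by left|by right|].
move=> /(psi_overlap ij (inT_psiw w hp) (inT_psiw w' hq)) [].
by move=> /(psiw_corner hp) -> /(psiw_corner hq) ->; right; split; eexists.
Qed.

(** Different cells of one level share at most one vertex, so an edge determines its cell. This lets
    a subgraph be described by independent states of its cells. *)
Lemma psiw_edge w w' a b a' b' : size w = size w' -> a != b ->
  psiw w (uu a) = psiw w' (uu a') -> psiw w (uu b) = psiw w' (uu b') -> w = w'.
Proof.
move=> + ab; elim: w w' => [|i w IH] [|j w'] //= [hs].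
have [<- /psi_inj h1 /psi_inj h2|ij] := eqVneq i j; first by rewrite (IH w').
have hT u c := inT_psiw u (inT_uu c).
move=> /(psi_overlap ij (hT _ _) (hT _ _)) [/(psiw_corner (inT_uu _))/uu_inj ea _].
move=> /(psi_overlap ij (hT _ _) (hT _ _)) [/(psiw_corner (inT_uu _))/uu_inj eb _].
by rewrite ea eb eqxx in ab.
Qed.

Lemma VGP n p : p \in VG n <-> exists w a, size w = n /\ p = psiw w (uu a).
Proof.
elim: n p => [|n IH] p.
  rewrite /= !inE; split.
    by case/or3P => /eqP ->; exists [::]; eexists; split.
  by case=> w [a [/size0nil -> ->]] /=; case: (I3P a) => ->; rewrite eqxx ?orbT.
split.
  case/allpairsP => -[i q] /= [_ /IH [w [a [hw ->]]] ->].
  by exists (i :: w), a; rewrite /= hw.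
case=> -[|i w] [a [//= [hw] ->]]; apply/allpairsP; exists (i, psiw w (uu a)).
by split; rewrite ?mem_enum //=; apply/IH; exists w, a.
Qed.

Lemma EG_sound n x y : (x, y) \in EG n -> exists w a b,
  [/\ size w = n, a != b, x = psiw w (uu a) & y = psiw w (uu b)].
Proof.
elim: n x y => [|n IH] x y.
  by rewrite /= !inE => /or3P[] /eqP[-> ->];
    [exists [::], i0, i1|exists [::], i1, i2|exists [::], i2, i0].
case/allpairsP => -[i [p q]] /= [_ /IH [w [a [b [hw ab -> ->]]]] [-> ->]].
by exists (i :: w), a, b; rewrite /= hw.
Qed.

Lemma adjGP n x y : adjG n x y <-> exists w a b,
  [/\ size w = n, a != b, x = psiw w (uu a) & y = psiw w (uu b)].
Proof.
split.
  case/orP => /EG_sound // [w [a [b [? ? ? ?]]]].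
  by exists w, b, a; split => //; rewrite eq_sym.
case=> w [a [b [<- ab -> ->]]] {x y n}; elim: w => [|i w IH] /=.
  by move: ab; case: (I3P a) => ->; case: (I3P b) => ->.
apply/orP; case/orP: IH => h; [left|right]; apply/allpairsP;
  [exists (i, (psiw w (uu a), psiw w (uu b)))|exists (i, (psiw w (uu b), psiw w (uu a)))];
  by split; rewrite ?mem_enum.
Qed.

Lemma adjG_neq n x y : adjG n x y -> x != y.
Proof.
case/adjGP => w [a [b [_ ab -> ->]]].
by apply: contra_neq ab => /psiw_inj/uu_inj.
Qed.

Lemma adjG_VG n x y : adjG n x y -> x \in VG n /\ y \in VG n.
Proof.
case/adjGP => w [a [b [hw ab -> ->]]].
by split; apply/VGP; exists w; [exists a|exists b].
Qed.

Lemma VG_S n p : p \in VG n -> p \in VG n.+1.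
Proof.
case/VGP => w [a [hw ->]]; apply/VGP; exists (rcons w a), a.
by rewrite size_rcons hw psiw_rcons psi_uu.
Qed.

Lemma VG_le n m p : (n <= m)%N -> p \in VG n -> p \in VG m.
Proof. by move=> /subnK <-; elim: (m - n)%N => [//|k IH] /IH/VG_S. Qed.

(** * Paths and distances in forests *)

Section Graph.
Variable H : rel Point.
Hypothesis Hsym : forall x y, H x y = H y x.

Lemma conn_refl x : conn H x x.
Proof. by exists [::]. Qed.

Lemma conn_trans x y z : conn H x y -> conn H y z -> conn H x z.
Proof.
case=> p [hp hl] [q [hq hl']]; exists (p ++ q).
by rewrite cat_path last_cat hp hl.
Qed.

Lemma conn_edge x y : H x y -> conn H x y.
Proof. by move=> h; exists [:: y]; rewrite /= h. Qed.

Lemma conn_sym x y : conn H x y -> conn H y x.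
Proof.
case=> p [hp <-]; exists (rev (belast x p)).
rewrite rev_path (eq_path (e' := H)) => [|a b]; last by rewrite Hsym.
by split=> //; case: p hp => //= y' p _; rewrite rev_cons last_rcons.
Qed.

Lemma conn_upath x y : conn H x y ->
  exists p, [/\ path H x p, last x p = y & uniq (x :: p)].
Proof. by case=> p [/shortenP [p' h1 h2 h3] hl]; exists p'. Qed.

End Graph.

Lemma conn_sub (H H' : rel Point) : (forall x y, H x y -> conn H' x y) ->
  forall x y, conn H x y -> conn H' x y.
Proof.
move=> hs x y [p [hp <-]] {y}; elim: p x hp => [|y p IH] x /=.
  by move=> _; exact: conn_refl.
by case/andP => /hs h /IH; exact: conn_trans.
Qed.

Definition del (H : rel Point) (x y : Point) : rel Point := fun a b =>
  H a b && ~~ ((a == x) && (b == y) || (a == y) && (b == x)).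

Lemma del_sym (H : rel Point) x y : (forall a b, H a b = H b a) ->
  forall a b, del H x y a b = del H x y b a.
Proof.
move=> hs a b; rewrite /del hs orbC; congr (_ && ~~ (_ || _)); exact: andbC.
Qed.

Lemma path_del (H : rel Point) x y a p : path H a p -> x \notin a :: p ->
  path (del H x y) a p.
Proof.
move=> hp hx; apply: (sub_in_path (P := [pred z | z != x]) _ _ hp).
  move=> b c; rewrite !inE /= => /negPf hb /negPf hc h.
  by rewrite /del h hb hc /= andbF.
by apply/allP => z hz; apply: contraNneq hx => <-.
Qed.

Section Forest.
Variable H : rel Point.
Hypothesis Hsym : forall x y, H x y = H y x.
Hypothesis Hirr : forall x, H x x = false.

(** A simple detour around a deleted edge closes up to a cycle, and conversely. Bridges turn
    acyclicity into connectivity, which can be computed and glued. *)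
Lemma acyclic_bridge :
  acyclic H <-> forall x y, H x y -> ~ conn (del H x y) x y.
Proof.
split=> [hac x y hxy /conn_upath [p [hp hl hu]]|hb].
  (* A shorter detour would be a loop or the deleted edge itself. *)
  have : (3 <= size (x :: p))%N.
    case: p hp hl hu => [_ /= hl|z [|//]]; first by rewrite hl Hirr in hxy.
    by rewrite /= /del => /andP[/andP[_ h] _] hz; rewrite hz !eqxx in h.
  move=> /(hac _ hu)/negP; apply; rewrite /= rcons_path hl Hsym hxy andbT.
  by apply: sub_path hp => a b /andP[].
case=> [|x [|y [|z p]]] // hu _; apply/negP => hc; set q := z :: p.
have /andP[hxy] : H x y && path H y (rcons q x) by [].
rewrite rcons_path => /andP[hq hl].
have hx : x \notin y :: q by case/andP: hu.
apply: (hb _ _ hxy); apply: conn_sym; first exact: del_sym.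
exists (rcons q x); rewrite last_rcons rcons_path path_del //=; split=> //.
rewrite /del hl /=; case/andP: hu => _ /= /andP[hy _].
have -> : (last z p == y) = false.
  by apply: contraNF hy => /eqP <-; exact: mem_last.
have -> : (last z p == x) = false.
  by apply: contraNF hx => /eqP <-; rewrite inE mem_last orbT.
by [].
Qed.

Hypothesis Hac : acyclic H.

(** At the first divergence the two tails avoid [x], so together they bypass the edge from [x] to
    [a], which is a bridge. *)
Lemma upath_unique x p p' : path H x p -> path H x p' -> uniq (x :: p) ->
  uniq (x :: p') -> last x p = last x p' -> p = p'.
Proof.
elim: p x p' => [|a q IH] x [|b q'] //.
- by move=> _ _ _ /andP[hn _] /= hl; case/negP: hn; rewrite {1}hl mem_last.
- by move=> _ _ /andP[hn _] _ /= hl; case/negP: hn; rewrite -{1}hl mem_last.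
move=> /= /andP[hxa hq] /andP[hxb hq'] /andP[xn hu] /andP[xn' hu'] hl.
have [ab|ab] := eqVneq a b.
  by subst b; congr cons; apply: (IH a).
case: (acyclic_bridge.1 Hac _ _ hxa).
have h1 : conn (del H x a) a (last a q) by exists q; split=> //; apply: path_del.
apply: conn_trans (conn_sym (del_sym _ _ Hsym) h1).
exists (b :: q'); split=> //=; rewrite path_del // andbT /del hxb /=.
have -> : (b == a) = false by rewrite eq_sym; apply/negbTE.
have -> : (b == x) = false by apply: contraNF xn' => /eqP <-; rewrite inE eqxx.
by rewrite !andbF.
Qed.

Fixpoint nobacktrack (s : seq Point) : bool :=
  if s is x :: s' then
    (if s' is _ :: z :: _ then x != z else true) && nobacktrack s'
  else true.

(** The tail is simple by induction, so a first return to [x] would close a cycle, of at least three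
    vertices for lack of backtracking. A local condition thus certifies that a walk assembled from
    crossings is the tree path. *)
Lemma nobacktrack_uniq x p : path H x p -> nobacktrack (x :: p) -> uniq (x :: p).
Proof.
elim: p x => [//|y p IH] x; rewrite [path _ _ _]/= => /andP[hxy hp] hn.
have hu : uniq (y :: p) by apply: IH => //; case/andP: hn.
rewrite cons_uniq hu andbT; apply/negP; rewrite inE => /orP[/eqP e|xp].
  by rewrite e Hirr in hxy.
case/path.splitP: xp hp hn hu => p1 p2 {IH}.
rewrite cat_path => /andP[hp _] hn; rewrite -cat_cons cat_uniq => /andP[hu _].
case: p1 hp hn hu => [_|z p1 hp hn hu]; first by rewrite /= eqxx.
have hu' : uniq [:: x, y, z & p1].
  by have := rcons_uniq [:: y, z & p1] x; rewrite hu [uniq (x :: _)]/= => <-.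
by have /negP := Hac hu' isT; apply; rewrite /= hxy.
Qed.

Lemma dist_le x p : path H x p -> (dist H x (last x p) <= size p)%N.
Proof.
move=> hp; rewrite /dist; case: pselect => // e.
by case: ex_minnP => m _; apply; apply/asboolP; exists p.
Qed.

Lemma dist_upath x p : path H x p -> uniq (x :: p) ->
  dist H x (last x p) = size p.
Proof.
move=> hp hu; apply/eqP; rewrite eqn_leq dist_le //=; rewrite /dist.
case: pselect => [e|[]]; last by exists (size p); apply/asboolP; exists p.
case: ex_minnP => m /asboolP [q [hq hl <-]] _; move: hl.
case: (shortenP hq) => q' hq' hu' hs hl.
have -> : p = q' by apply: (upath_unique hp hq').
by apply: uniq_leq_size => //; case/andP: hu'.
Qed.

Lemma distP x y : conn H x y -> exists p, [/\ path H x p, last x p = y,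
  size p = dist H x y & uniq (x :: p)].
Proof.
case/conn_upath => p [hp <- hu]; exists p; split=> //.
by rewrite dist_upath.
Qed.

Lemma dist_sym x y : conn H x y -> dist H x y = dist H y x.
Proof.
have hle a b : conn H a b -> (dist H b a <= dist H a b)%N.
  case/distP => p [hp hl <- _].
  have := @dist_le b (rev (belast a p)).
  rewrite -[in path _ _ _]hl rev_path (eq_path (e' := H)) => [|? ?]; last by rewrite Hsym.
  move=> /(_ hp); rewrite size_rev size_belast; congr (dist _ _ _ <= _)%N.
  by case: p {hp} hl => //= y' p _; rewrite rev_cons last_rcons.
by move=> h; apply/eqP; rewrite eqn_leq !hle //; apply: conn_sym.
Qed.

Lemma dist_triangle x y z : conn H x y -> conn H y z ->
  (dist H x z <= dist H x y + dist H y z)%N.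
Proof.
move=> /distP [p [hp hl <- _]] /distP [q [hq hl' <- _]].
rewrite -hl' -hl -last_cat -size_cat; apply: dist_le.
by rewrite cat_path hp hl hq.
Qed.

Lemma dist_refl x : dist H x x = 0%N.
Proof. exact: (@dist_upath x [::]). Qed.

(* The projection of [x] to the path [u :: p] is the vertex [last u p1]. *)
Lemma path_projection u p x : path H u p -> uniq (u :: p) -> conn H x u ->
  exists p1 p2 e, [/\ p = p1 ++ p2, dist H x (last u p1) = e,
    dist H u x = (size p1 + e)%N & dist H (last u p) x = (size p2 + e)%N].
Proof.
move=> hp hu [q [hq hl]].
have [m [r [hm hr hrl hru hrd]]] : exists m r, [/\ m \in u :: p, path H m r,
    last m r = x, uniq (m :: r) & all (fun z => z \notin u :: p) r].
  have : last x q \in u :: p by rewrite hl inE eqxx.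
  elim: q x hq {hl} => [|y q IH] x /=.
    by move=> _ hx; exists x, [::].
  case/andP => hxy /IH {}IH /IH [m [r [h1 h2 h3 h4 h5]]].
  have [hx|hx] := boolP (x \in u :: p); first by exists x, [::].
  have hr : path H m (rcons r x) by rewrite rcons_path h2 h3 Hsym.
  have hlr : last m (rcons r x) = x by rewrite last_rcons.
  move: hlr; case: (shortenP hr) => r' g1 g2 g3 g4.
  exists m, r'; split => //; apply/allP => z /g3; rewrite mem_rcons inE.
  by case/orP => [/eqP -> //|]; apply: (allP h5).
have dmx : dist H m x = size r by rewrite -hrl dist_upath.
have cmx : conn H m x by exists r.
case/splitPl: hm hp hu hrd {q hq hl} => p1 p2 hlp; rewrite cat_path hlp.
case/andP => hp1 hp2 hu hrd; exists p1, p2, (size r); rewrite hlp -dist_sym //.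
have dis : ~~ has (mem (u :: p1 ++ p2)) r by rewrite -all_predC.
split=> //.
  rewrite -{1}hrl -{1}hlp -last_cat dist_upath ?size_cat //.
    by rewrite cat_path hp1 hlp hr.
  move: hu hru; rewrite -!cat_cons !cat_uniq => /andP[-> _] /= /andP[_ ->].
  rewrite andbT; apply: contraNN dis => /hasP [z zr zp]; apply/hasP.
  by exists z; rewrite //= -cat_cons mem_cat zp.
have -> : dist H (last u (p1 ++ p2)) x = dist H x (last m p2).
  rewrite last_cat hlp dist_sym //; apply: conn_trans cmx.
  by apply: conn_sym => //; exists p2.
have hxm : path H x (rev (belast m r)).
  have := rev_path H m r; rewrite hrl => ->; move: hr.
  by rewrite (eq_path (e' := H)) // => a b; rewrite Hsym.
have hlm : last x (rev (belast m r)) = m.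
  by case: (r) hrl => [<-|a r' _] //=; rewrite rev_cons last_rcons.
rewrite -{1}hlm -last_cat dist_upath ?size_cat ?size_rev ?size_belast 1?addnC //.
  by rewrite cat_path hxm hlm hp2.
have -> : x :: rev (belast m r) ++ p2 = rev (m :: r) ++ p2.
  by rewrite [m :: r]lastI hrl rev_rcons.
rewrite cat_uniq rev_uniq hru.
move: hu; rewrite -cat_cons cat_uniq => /and3P[_ hd ->]; rewrite andbT /=.
apply/hasPn => z zp2; rewrite /= mem_rev inE negb_or; apply/andP; split.
  apply: contra hd => /eqP zm; apply/hasP; exists z => //=.
  by rewrite zm -hlp mem_last.
apply: contra dis => zr; apply/hasP; exists z => //=.
by rewrite !inE mem_cat zp2 !orbT.
Qed.

(** If the projection [m] of [x] precedes the projection [m'] of [y] on the path from [u] to [v],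
    then $d(u,y)+d(v,x)$ covers the stretch from [m] to [m'] twice and dominates; the other order is
    symmetric. *)
Lemma dist_4point u v x y : conn H u v -> conn H u x -> conn H u y ->
  (dist H u v + dist H x y <=
    maxn (dist H u x + dist H v y) (dist H u y + dist H v x))%N.
Proof.
move=> cuv cux cuy; have [p [hp hl hs hu]] := distP cuv.
have [p1 [p2 [e [ep de du dv]]]] := path_projection hp hu (conn_sym Hsym cux).
have [q1 [q2 [e' [eq de' du' dv']]]] := path_projection hp hu (conn_sym Hsym cuy).
rewrite hl in dv dv'.
have hsz : (size p1 + size p2 = size q1 + size q2)%N by rewrite -!size_cat -ep -eq.
have hsp : dist H u v = (size p1 + size p2)%N by rewrite -size_cat -ep hs.
wlog le : x y p1 p2 q1 q2 e e' cux cuy ep de du dv eq de' du' dv' hsz hsp /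
    (size p1 <= size q1)%N.
  move=> W; have [le|le] := leqP (size p1) (size q1).
    exact: (W x y p1 p2 q1 q2 e e').
  have cxy : conn H x y by apply: conn_trans cuy; exact: conn_sym.
  rewrite maxnC (dist_sym cxy).
  by apply: (W y x q1 q2 p1 p2 e' e) => //; [rewrite -hsz|exact: ltnW].
have eq1 : q1 = p1 ++ drop (size p1) q1.
  have := congr1 (take (size p1)) (etrans (esym ep) eq).
  rewrite take_size_cat // takel_cat // => {1}->; by rewrite cat_take_drop.
set m := last u p1 in de; set m' := last u q1 in de'.
have hm : path H m (drop (size p1) q1) /\ last m (drop (size p1) q1) = m'.
  move: hp; rewrite eq cat_path {1}eq1 cat_path => /andP[/andP[_ ->] _].
  by rewrite -last_cat -eq1.
have cm : conn H m m' by exists (drop (size p1) q1).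
have dm : (dist H m m' <= size q1 - size p1)%N.
  by case: hm => hm1 <-; rewrite (leq_trans (dist_le hm1)) // size_drop.
have cum : conn H u m.
  exists p1; split=> //; move: hp; rewrite ep cat_path; by case/andP.
have cxm : conn H x m by apply: conn_trans cum; exact: conn_sym.
have cxm' := conn_trans cxm cm.
have cym' : conn H y m'.
  apply: conn_trans (conn_trans cum cm); exact: conn_sym.
have h1 := dist_triangle cxm cm.
have h2 := dist_triangle cxm' (conn_sym Hsym cym').
rewrite (dist_sym (conn_sym Hsym cym')) in h2.
rewrite hsp; lia.
Qed.

End Forest.

(** * The trace of a subgraph of G_1, computably *)

(* The state of a triangle: the k-th bit tells whether the edge opposite to the
   corner k is present.  A [cell1] is a subgraph of G_1, given by the states of its
   three triangles. *)
Definition cstate := (bool * bool * bool)%type.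

Definition ce (q : cstate) (k : 'I_3) : bool :=
  match val k with 0%N => q.1.1 | 1%N => q.1.2 | _ => q.2 end.

Definition third (a b : 'I_3) : 'I_3 :=
  match (val a + val b)%N with 1%N => i2 | 2%N => i1 | _ => i0 end.

Definition cedge (q : cstate) (a b : 'I_3) : bool := (a != b) && ce q (third a b).

Definition ccon (q : cstate) (a b : 'I_3) : bool :=
  [|| a == b, cedge q a b | cedge q a (third a b) && cedge q (third a b) b].

Definition cst0 : cstate := (false, false, false).

Definition cell1 := (cstate * cstate * cstate)%type.

Definition gi (g : cell1) (i : 'I_3) : cstate :=
  match val i with 0%N => g.1.1 | 1%N => g.1.2 | _ => g.2 end.

(* The number of the vertex psi_i(u_j) of G_1: the corners are 0, 1, 2, and the
   midpoint between the corners i and j is 6 - i - j, so that i is opposite to i + 3. *)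
Definition vt (i j : 'I_3) : nat := if i == j then val i else (6 - i - j)%N.

Definition L3 : seq 'I_3 := [:: i0; i1; i2].

Definition ends (k : 'I_3) : 'I_3 * 'I_3 :=
  match val k with 0%N => (i1, i2) | 1%N => (i2, i0) | _ => (i0, i1) end.

Definition optcons (b : bool) (e : nat * nat) r := if b then e :: r else r.

Definition gedges (g : cell1) : seq (nat * nat) :=
  let: (p, q, r) := g in
  optcons p.1.1 (5, 4) (optcons p.1.2 (4, 0) (optcons p.2 (0, 5)
  (optcons q.1.1 (1, 3) (optcons q.1.2 (3, 5) (optcons q.2 (5, 1)
  (optcons r.1.1 (3, 2) (optcons r.1.2 (2, 4) (optcons r.2 (4, 3) [::]))))))))%N.

Definition lbl (c : seq nat) (x : nat) : nat := nth 0%N c x.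

Definition eqv (c : seq nat) (x y : nat) : bool := Nat.eqb (lbl c x) (lbl c y).

Definition join (c : seq nat) (e : nat * nat) : seq nat :=
  let l := lbl c e.1 in let l' := lbl c e.2 in
  [seq if Nat.eqb z l' then l else z | z <- c].

(* Union-find by relabelling: [gcomp g] lists the component labels of the six
   vertices of [G_1] in the subgraph [g]. *)
Definition gcomp (g : cell1) : seq nat := foldl join [:: 0; 1; 2; 3; 4; 5]%N (gedges g).

Definition cset (q : cstate) (k : 'I_3) : cstate :=
  match val k with
  | 0%N => (false, q.1.2, q.2) | 1%N => (q.1.1, false, q.2)
  | _ => (q.1.1, q.1.2, false) end.

Definition gset (g : cell1) (i : 'I_3) (q : cstate) : cell1 :=
  match val i with
  | 0%N => (q, g.1.2, g.2) | 1%N => (g.1.1, q, g.2)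
  | _ => (g.1.1, g.1.2, q) end.

Definition delG (g : cell1) (i k : 'I_3) : cell1 := gset g i (cset (gi g i) k).

Definition subG (g : cell1) (i j : 'I_3) : cell1 := gset g (third i j) cst0.

Definition acycG g : bool := all (fun i => all (fun k => if ce (gi g i) k then
  ~~ eqv (gcomp (delG g i k)) (vt i (ends k).1) (vt i (ends k).2) else true) L3) L3.

Definition attC (c : seq nat) : bool :=
  all (fun x => [|| eqv c x 0, eqv c x 1 | eqv c x 2]) [:: 3; 4; 5]%N.

Definition stC (c : seq nat) : bool := eqv c 0 1 && eqv c 1 2.

Definition centerG g (i j k : 'I_3) : bool :=
  eqv (gcomp (subG g i j)) (val i) (val j) && eqv (gcomp (subG g i k)) (val i) (val k).

Definition conC (c : seq nat) : cstate := (eqv c 1 2, eqv c 2 0, eqv c 0 1).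

(** Off the spanning trees, [conC] is the trace in both cases: for $\mathcal S_1^i$ only the pair
    opposite to [i] is joined, for $\mathcal R_1$ no pair. The value [cst0] doubles as the default
    outside $\mathcal Q_1$. *)
Definition trG g : cstate :=
  let c := gcomp g in
  if attC c && acycG g then
    if stC c then
      let z0 := centerG g i0 i1 i2 in let z1 := centerG g i1 i2 i0 in
      let z2 := centerG g i2 i0 i1 in (z1 || z2, z2 || z0, z0 || z1)
    else conC c
  else cst0.

Definition all_cst : seq cstate :=
  [seq (x.1, x.2, y) | x <- [seq (a, b) | a <- [:: true; false], b <- [:: true; false]],
     y <- [:: true; false]].

Definition all_cell1 : seq cell1 :=
  [seq (x.1, x.2, y) | x <- [seq (a, b) | a <- all_cst, b <- all_cst], y <- all_cst].

Lemma mem_all_cst q : q \in all_cst.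
Proof. by case: q => [[[] []] []]. Qed.

Lemma mem_all_cell1 g : g \in all_cell1.
Proof.
case: g => [[x y] z]; apply/allpairsP; exists ((x, y), z).
by split; rewrite ?mem_all_cst //; apply/allpairsP; exists (x, y); rewrite !mem_all_cst.
Qed.

Lemma uniq_all_cell1 : uniq all_cell1.
Proof.
have h : uniq all_cst by [].
rewrite /all_cell1; apply: allpairs_uniq; last 1 first.
- by move=> [[? ?] ?] [[? ?] ?] /= _ _ [-> -> ->].
- by apply: (@allpairs_uniq _ _ _ pair) => // -[? ?] [? ?].
- exact: h.
Qed.

(* Types of the branching process formed by the cells that a tree path traverses:
   along the edge ab in a triangle with two edges (0) or one edge (2), or along the
   two other edges (1). *)
Definition typ (q : cstate) (a b : 'I_3) : nat :=
  if cedge q a b then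
    if cedge q a (third a b) || cedge q (third a b) b then 0 else 2
  else 1.

Definition elen (q : cstate) (a b : 'I_3) : nat := if cedge q a b then 1 else 2.

Definition opt1 (g : cell1) a b := ccon (gi g a) a b && ccon (gi g b) a b.
Definition opt2 (g : cell1) a b := let c := third a b in
  [&& ccon (gi g a) a c, ccon (gi g c) a b & ccon (gi g b) c b].

(** The cells at [a] and [b] share the midpoint $\psi_a(u_b)=\psi_b(u_a)$, which is corner [b] of
    the first and corner [a] of the second. The alternative is the detour through the third cell. *)
Definition ref1 (g : cell1) (a b : 'I_3) : seq ('I_3 * 'I_3 * 'I_3) :=
  let c := third a b in
  if opt1 g a b then [:: (a, a, b); (b, a, b)]
  else [:: (a, a, c); (c, a, b); (b, c, b)].

Definition rtyps (g : cell1) (a b : 'I_3) : seq nat :=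
  [seq typ (gi g x.1.1) x.1.2 x.2 | x <- ref1 g a b].

(* The checks below take this table as an argument so that [trG] is evaluated
   only once per subgraph. *)
Definition tab : seq (cell1 * cstate) := [seq (g, trG g) | g <- all_cell1].

Definition fib (q : cstate) : seq cell1 := [seq g <- all_cell1 | trG g == q].

(* [p] and [po] record which corners of a cell are joined inside and outside it. *)
Definition conn3 (p po : cstate) : bool :=
  let u k := ce p k || ce po k in
  [|| u i0 && u i1, u i1 && u i2 | u i0 && u i2].

(** The deletion of each edge of [g] is tested with the criterion for connectedness of a glued graph
    ([connected_glue]), the outside entering only through [po]. *)
Definition minG g (po : cstate) : bool :=
  all (fun i => all (fun k => if ce (gi g i) k then
    let c := gcomp (delG g i k) in ~~ (attC c && conn3 (conC c) po) else true) L3) L3.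

Definition conQ (q : cstate) : cstate := (ccon q i1 i2, ccon q i2 i0, ccon q i0 i1).

(** The first clause rules out, as a trace, the one state that [check_means] leaves out; the second
    makes the refinement [ref1] of every crossing meaningful. *)
Definition check_refine (t : seq (cell1 * cstate)) : bool :=
  all (fun p => (p.2 != (true, true, true)) && all (fun a => all (fun b =>
    (a != b) ==> ccon p.2 a b ==> (opt1 p.1 a b || opt2 p.1 a b)) L3) L3) t.

(* For a crossing of type t in a triangle with state q: the size of the fibre of q
   under Tr, and the total numbers of offspring of types 0, 1, 2 over this fibre. *)
Definition row (t : nat) : nat * nat * nat * nat :=
  match t with
  | 0%N => (18, 18, 9, 9) | 1%N => (18, 24, 12, 18) | _ => (30, 24, 12, 30)
  end%N.

Definition fibt (t : seq (cell1 * cstate)) (q : cstate) : seq cell1 :=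
  [seq p.1 | p <- t & p.2 == q].

Lemma fibtE q : fibt tab q = fib q.
Proof.
rewrite /fibt /fib /tab; elim: all_cell1 => [//|g s IH].
by rewrite !map_cons /= (fun_if (map fst)) /= IH.
Qed.

Definition check_means (t : seq (cell1 * cstate)) : bool :=
  all (fun q => let F := fibt t q in (q != (true, true, true)) ==>
    all (fun a => all (fun b => (a != b) ==> ccon q a b ==>
      let r := flatten [seq rtyps g a b | g <- F] in
      ((size F, count_mem 0 r, count_mem 1 r, count_mem 2 r) == row (typ q a b))%N)
    L3) L3) all_cst.

(* Members of the same fibre of Tr join the same corners, and whether one of them
   completes a given outside graph to a minimal connected graph does not depend on
   the member; hence they are interchangeable inside a spanning tree. *)
Definition check_swap (t : seq (cell1 * cstate)) : bool :=
  all (fun q => let F := fibt t q in (q != cst0) ==>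
    all (fun g => let c := gcomp g in attC c && (conC c == conQ q)) F &&
    all (fun po => conn3 (conQ q) po ==> constant [seq minG g po | g <- F]) all_cst)
  all_cst.

Lemma check_refine_tab : check_refine tab. Proof. by vm_compute. Qed.
Lemma check_means_tab : check_means tab. Proof. by vm_compute. Qed.
Lemma check_swap_tab : check_swap tab. Proof. by vm_compute. Qed.

Definition pt (x : nat) : Point := nth (uu i0)
  [:: uu i0; uu i1; uu i2; psi i1 (uu i2); psi i0 (uu i2); psi i0 (uu i1)] x.

Lemma ptE i j : pt (vt i j) = psi i (uu j).
Proof.
case: (I3P i) => ->; case: (I3P j) => ->; rewrite /vt /= ?psi_uu //.
Qed.

Lemma vt_lt i j : (vt i j < 6)%N.
Proof. by case: (I3P i) => ->; case: (I3P j) => ->. Qed.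

Lemma pt_inj x y : (x < 6)%N -> (y < 6)%N -> pt x = pt y -> x = y.
Proof.
move=> hx hy /eqP; rewrite /pt nth_uniq // => /eqP h; exact: h.
Qed.

Lemma inT_pt x : inT (pt x).
Proof.
rewrite /pt; case: x => [|[|[|[|[|[|x]]]]]] /=; rewrite ?nth_nil;
  by do ?apply: inT_psi; exact: inT_uu.
Qed.

Lemma mem_optcons b e e' r : (e \in optcons b e' r) = b && (e == e') || (e \in r).
Proof. by case: b; rewrite /= ?inE. Qed.

Lemma gedgesP g x y : (x, y) \in gedges g <->
  exists i k, [/\ ce (gi g i) k, x = vt i (ends k).1 & y = vt i (ends k).2].
Proof.
case: g => [[p q] r]; rewrite /gedges !mem_optcons in_nil orbF; split.
  case/or4P => [|||/or4P[|||/or3P[]]] /andP[h /eqP[-> ->]];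
  [exists i0, i0|exists i0, i1|exists i0, i2|exists i1, i0|exists i1, i1
  |exists i1, i2|exists i2, i0|exists i2, i1|exists i2, i2]; by split.
case=> i [k []]; case: (I3P i) => ->; case: (I3P k) => ->;
  rewrite /ce /gi /= => h -> ->; by rewrite h ?orbT.
Qed.

Lemma gedges_lt g e : e \in gedges g -> (e.1 < 6)%N && (e.2 < 6)%N.
Proof. by case: e => x y /gedgesP [i [k [_ -> ->]]]; rewrite /= !vt_lt. Qed.

Lemma eqvE c x y : eqv c x y = (lbl c x == lbl c y).
Proof. by apply/idP/eqP => /PeanoNat.Nat.eqb_eq. Qed.

Lemma size_join c e : size (join c e) = size c.
Proof. by rewrite size_map. Qed.

Lemma lbl_join c e x : (x < size c)%N ->
  lbl (join c e) x = if lbl c x == lbl c e.2 then lbl c e.1 else lbl c x.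
Proof.
move=> hx; by rewrite /lbl /join (nth_map 0%N).
Qed.

Lemma comp_complete g x y : (x, y) \in gedges g -> eqv (gcomp g) x y.
Proof.
rewrite eqvE /gcomp; move: (@gedges_lt g); move: (gedges g) => es.
have : size [:: 0; 1; 2; 3; 4; 5]%N = 6 by [].
move: [:: _; _; _; _; _; _] => c.
elim: es c => [//|e es IH] c hc hlt; rewrite inE => /orP[/eqP he|]; last first.
  move=> h; apply: IH => //; rewrite ?size_join // => e' h'; apply: hlt.
  by rewrite inE h' orbT.
subst e; have := hlt (x, y); rewrite inE eqxx => /(_ isT) /= /andP[hx hy].
have : lbl (join c (x, y)) x = lbl (join c (x, y)) y.
  by rewrite !lbl_join ?hc //= eqxx; case: ifP.
move: (join c (x, y)) (size_join c (x, y)); rewrite hc => c' hc' h.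
move: {IH hlt} es c' hc' h; elim=> [|e' es IH] c' hc' h /=; first by apply/eqP.
by apply: IH; rewrite ?size_join // !lbl_join ?hc' // h.
Qed.

(** Labels are merged along edges only, so every equivalence relation containing the edges contains
    the computed classes. It is applied to connectivity in a copy of [g] inside an arbitrary
    cell. *)
Lemma comp_sound g (K : nat -> nat -> Prop) : (forall x, K x x) ->
  (forall x y, K x y -> K y x) -> (forall x y z, K x y -> K y z -> K x z) ->
  (forall x y, (x, y) \in gedges g -> K x y) ->
  forall x y, (x < 6)%N -> (y < 6)%N -> eqv (gcomp g) x y -> K x y.
Proof.
move=> Kr Ks Kt; rewrite /gcomp; move: (@gedges_lt g); move: (gedges g) => es.
have h6 : size [:: 0; 1; 2; 3; 4; 5]%N = 6 by [].
have hK : forall x y, (x < 6)%N -> (y < 6)%N ->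
    lbl [:: 0; 1; 2; 3; 4; 5]%N x = lbl [:: 0; 1; 2; 3; 4; 5]%N y -> K x y.
  by do 6 (case=> [|]; first by do 6 (case=> [|] //)).
move: [:: _; _; _; _; _; _] h6 hK => c.
elim: es c => [|e es IH] c hc hK hlt he x y hx hy /=.
  by rewrite eqvE => /eqP; exact: hK.
have /andP[l1 l2] : (e.1 < 6)%N && (e.2 < 6)%N by apply: hlt; rewrite inE eqxx.
have Ke : K e.1 e.2 by apply: he; rewrite -surjective_pairing inE eqxx.
apply: IH => //; rewrite ?size_join //; last first.
- by move=> a b h; apply: he; rewrite inE h orbT.
- by move=> a h; apply: hlt; rewrite inE h orbT.
move=> a b ha hb; rewrite !lbl_join ?hc //.
case: eqP => [ea|_]; case: eqP => [eb|_].
- by move=> _; apply: hK => //; rewrite ea eb.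
- move=> h; apply: (Kt _ e.1); last exact: hK.
  by apply: (Kt _ e.2); [exact: hK|exact: Ks].
- move=> h; apply: (Kt _ e.1); first exact: hK.
  by apply: (Kt _ e.2) => //; apply: hK.
- exact: hK.
Qed.

Lemma cedge_sym q a b : cedge q a b = cedge q b a.
Proof. by case: (I3P a) => ->; case: (I3P b) => ->. Qed.

Lemma cedgeP q a b : cedge q a b <->
  exists k, ce q k /\ ((a, b) = ends k \/ (b, a) = ends k).
Proof.
split.
  case/andP => ab h; exists (third a b); split=> //; move: ab {h}.
  by case: (I3P a) => ->; case: (I3P b) => -> // _; (by left) || (by right).
by case=> k [h []]; move: h; case: (I3P k) => -> h [-> ->]; rewrite /cedge /= h.
Qed.

(* The subgraph [g] of [G_1], copied into the cell [psiw v G_1]. *)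
Definition emb (v : seq 'I_3) (g : cell1) : rel Point := fun X Y =>
  has (fun e => (X == psiw v (pt e.1)) && (Y == psiw v (pt e.2)) ||
                (Y == psiw v (pt e.1)) && (X == psiw v (pt e.2))) (gedges g).

Lemma psiw_pt v i a : psiw v (pt (vt i a)) = psiw (rcons v i) (uu a).
Proof. by rewrite psiw_rcons ptE. Qed.

Lemma emb_sym v g X Y : emb v g X Y = emb v g Y X.
Proof. by apply: eq_has => e; rewrite orbC. Qed.

Lemma embP v g X Y : emb v g X Y <-> exists i a b,
  [/\ cedge (gi g i) a b, X = psiw (rcons v i) (uu a) & Y = psiw (rcons v i) (uu b)].
Proof.
split.
  case/hasP => -[x y] /gedgesP [i [k [h -> ->]]] /= /orP[]/andP[/eqP-> /eqP->].
    exists i, (ends k).1, (ends k).2; rewrite !psiw_pt; split=> //.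
    by apply/cedgeP; exists k; split=> //; left; rewrite -surjective_pairing.
  exists i, (ends k).2, (ends k).1; rewrite !psiw_pt; split=> //.
  by apply/cedgeP; exists k; split=> //; right; rewrite -surjective_pairing.
case=> i [a [b [/cedgeP [k [h hk]] -> ->]]]; apply/hasP.
exists (vt i (ends k).1, vt i (ends k).2); first by apply/gedgesP; exists i, k.
by case: hk => <- /=; rewrite !psiw_pt !eqxx ?orbT.
Qed.

Lemma rcons_words_edge v v' i i' a b a' b' : size v = size v' -> a != b ->
  psiw (rcons v i) (uu a) = psiw (rcons v' i') (uu a') ->
  psiw (rcons v i) (uu b) = psiw (rcons v' i') (uu b') ->
  [/\ v = v', i = i', a = a' & b = b'].
Proof.
move=> hs ab ea eb; have : rcons v i = rcons v' i'.
  by apply: psiw_edge ab ea eb; rewrite !size_rcons hs.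
move=> /rcons_inj [e1 e2]; subst v' i'; split=> //.
  by move/psiw_inj/uu_inj: ea.
by move/psiw_inj/uu_inj: eb.
Qed.

Lemma emb_cedge v g i a b :
  emb v g (psiw (rcons v i) (uu a)) (psiw (rcons v i) (uu b)) = cedge (gi g i) a b.
Proof.
apply/idP/idP => [/embP [i' [a' [b' [h ea eb]]]]|h]; last by apply/embP; exists i, a, b.
have ab' : a' != b' by case/andP: h.
by case: (rcons_words_edge (erefl _) ab' (esym ea) (esym eb)) => _ <- <- <-.
Qed.

Lemma emb_irr v g X : emb v g X X = false.
Proof.
apply/negP => /embP [i [a [b [/andP[ab _] -> /psiw_inj/uu_inj e]]]].
by rewrite e eqxx in ab.
Qed.

Lemma conn_embP v g x y : (x < 6)%N -> (y < 6)%N ->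
  conn (emb v g) (psiw v (pt x)) (psiw v (pt y)) <-> eqv (gcomp g) x y.
Proof.
move=> hx hy; split; last first.
  apply: (comp_sound (K := fun x y => conn (emb v g) (psiw v (pt x)) (psiw v (pt y)))) => //.
  - by move=> ?; exact: conn_refl.
  - by move=> a b; apply: conn_sym; exact: emb_sym.
  - by move=> a b c; exact: conn_trans.
  by move=> a b h; apply: conn_edge; apply/hasP; exists (a, b); rewrite //= !eqxx.
case=> p [hp]; elim: p x hx hp => [|Y p IH] x hx /=.
  by move=> _ /psiw_inj/(pt_inj hx hy) ->; rewrite eqvE.
case/andP => h hp hl.
have [z [hz eY exz]] : exists z, [/\ (z < 6)%N, Y = psiw v (pt z) & eqv (gcomp g) x z].
  case/hasP: h => -[a b] he /= /orP[]/andP[].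
    move=> /eqP/psiw_inj; move/gedges_lt: (he) => /andP[/= ha hb].
    by move=> /(pt_inj hx ha) -> /eqP ->; exists b; split=> //; apply: comp_complete.
  move=> /eqP -> /eqP/psiw_inj; move/gedges_lt: (he) => /andP[/= ha hb].
  move=> /(pt_inj hx hb) ->; exists a; split=> //.
  by have := comp_complete he; rewrite !eqvE eq_sym.
subst Y; have := IH z hz hp hl; move: exz; rewrite !eqvE => /eqP -> //.
Qed.

Definition st (f : rel Point) (v : seq 'I_3) : cstate :=
  (f (psiw v (uu i1)) (psiw v (uu i2)), f (psiw v (uu i2)) (psiw v (uu i0)),
   f (psiw v (uu i0)) (psiw v (uu i1))).

Definition gst (f : rel Point) (v : seq 'I_3) : cell1 :=
  (st f (rcons v i0), st f (rcons v i1), st f (rcons v i2)).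

Lemma gi_gst f v i : gi (gst f v) i = st f (rcons v i).
Proof. by case: (I3P i) => ->. Qed.

Lemma st_edge (f : rel Point) v a b : (forall x y, f x y = f y x) ->
  (forall x, f x x = false) ->
  f (psiw v (uu a)) (psiw v (uu b)) = cedge (st f v) a b.
Proof.
move=> hs hi; case: (I3P a) => ->; case: (I3P b) => ->;
  by rewrite /cedge ?hi //= /ce /= hs.
Qed.

Lemma isSub_sym n f : Defs.isSub n f -> forall x y, f x y = f y x.
Proof. by case. Qed.

Lemma isSub_irr n f : Defs.isSub n f -> forall x, f x x = false.
Proof.
by case=> _ hf x; apply/negP => /hf /adjG_neq; rewrite eqxx.
Qed.

Lemma adjG1P X Y : adjG 1 X Y <-> exists i a b,
  [/\ a != b, X = psi i (uu a) & Y = psi i (uu b)].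
Proof.
split=> [/adjGP [w [a [b [hw ab -> ->]]]]|[i [a [b [ab -> ->]]]]].
  by case: w hw => [|i [|j w]] //= _; exists i, a, b.
by apply/adjGP; exists [:: i], a, b.
Qed.

Lemma adjG0P X Y : adjG 0 X Y <-> exists a b, [/\ a != b, X = uu a & Y = uu b].
Proof.
split=> [/adjGP [w [a [b [/size0nil -> ab -> ->]]]]|[a [b [ab -> ->]]]].
  by exists a, b.
by apply/adjGP; exists [::], a, b.
Qed.

Lemma piw1_emb (f : rel Point) v : (forall x y, f x y = f y x) ->
  (forall x, f x x = false) -> piw 1 v f = emb [::] (gst f v).
Proof.
move=> hs hi; apply/funext => X; apply/funext => Y; rewrite /piw.
apply/andP/idP => [[/adjG1P [i [a [b [ab -> ->]]]]]|].
  rewrite -!psiw_rcons st_edge // => h; apply/embP; exists i, a, b.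
  by rewrite gi_gst.
case/embP => i [a [b [h -> ->]]].
have e c : psiw (rcons [::] i) (uu c) = psi i (uu c) by [].
rewrite !e -!psiw_rcons; rewrite gi_gst -st_edge // in h; split=> //; apply/adjG1P.
exists i, a, b; split=> //; apply: contraTneq h => ->; by rewrite hi.
Qed.

Lemma delG_cedge g i k i' a' b' :
  cedge (gi (delG g i k) i') a' b' = cedge (gi g i') a' b' &&
    ~~ ([&& i' == i, a' == (ends k).1 & b' == (ends k).2] ||
        [&& i' == i, a' == (ends k).2 & b' == (ends k).1]).
Proof.
case: g => [[[[? ?] ?] [[? ?] ?]] [[? ?] ?]].
case: (I3P i) => ->; case: (I3P i') => ->; case: (I3P k) => ->;
  case: (I3P a') => ->; case: (I3P b') => ->;
  by rewrite /cedge /= /ce /= ?andbF ?andbT.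
Qed.

Lemma emb_eq_ends v i i' a b a' b' : a != b ->
  (psiw (rcons v i') (uu a') == psiw (rcons v i) (uu a)) &&
  (psiw (rcons v i') (uu b') == psiw (rcons v i) (uu b)) =
  [&& i' == i, a' == a & b' == b].
Proof.
move=> ab; apply/andP/and3P => [[/eqP ea /eqP eb]|[/eqP -> /eqP -> /eqP ->]];
  last by rewrite !eqxx.
by have [_ -> -> ->] := rcons_words_edge (erefl _) ab (esym ea) (esym eb).
Qed.

Lemma ends_neq k : (ends k).1 != (ends k).2.
Proof. by case: (I3P k) => ->. Qed.

Lemma del_emb v g i k :
  del (emb v g) (psiw (rcons v i) (uu (ends k).1)) (psiw (rcons v i) (uu (ends k).2)) =
  emb v (delG g i k).
Proof.
apply/funext => X; apply/funext => Y; rewrite /del.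
have [h|h] := boolP (emb v g X Y).
  have [i' [a' [b' [hc -> ->]]]] := (embP _ _ _ _).1 h.
  have hk := ends_neq k; have hk' := hk; rewrite eq_sym in hk'.
  by rewrite !emb_cedge delG_cedge !emb_eq_ends // hc.
apply/esym/negbTE; apply: contra h => /embP [i' [a' [b' [h -> ->]]]].
by rewrite emb_cedge; move: h; rewrite delG_cedge => /andP[].
Qed.

Lemma acyc_emb v g : acyclic (emb v g) <-> acycG g.
Proof.
rewrite (acyclic_bridge (@emb_sym v g) (@emb_irr v g)).
have key i k : conn (emb v (delG g i k)) (psiw (rcons v i) (uu (ends k).1))
    (psiw (rcons v i) (uu (ends k).2)) <->
    eqv (gcomp (delG g i k)) (vt i (ends k).1) (vt i (ends k).2).
  by rewrite -!psiw_pt; apply: conn_embP; exact: vt_lt.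
split=> [h|h X Y].
  apply/allP => i _; apply/allP => k _; case: ifP => // hk.
  apply/negP => /key; rewrite -del_emb; apply: h; rewrite emb_cedge.
  by apply/cedgeP; exists k; split=> //; left; rewrite -surjective_pairing.
have h' i k : ce (gi g i) k ->
    ~ eqv (gcomp (delG g i k)) (vt i (ends k).1) (vt i (ends k).2).
  have hin (j : 'I_3) : j \in L3 by case: (I3P j) => ->.
  move=> hc; have /allP/(_ _ (hin k)) := allP h _ (hin i).
  by rewrite hc => /negP.
case/embP => i [a [b [/cedgeP [k [hk hab]] -> ->]]] hc; apply: (h' i k hk).
apply/key; rewrite -del_emb; case: hab => <- //=.
have -> : del (emb v g) (psiw (rcons v i) (uu b)) (psiw (rcons v i) (uu a)) =
  del (emb v g) (psiw (rcons v i) (uu a)) (psiw (rcons v i) (uu b)).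
  by apply/funext => X'; apply/funext => Y'; rewrite /del orbC.
by apply: conn_sym hc; apply: del_sym; exact: emb_sym.
Qed.

Lemma VG1P X : X \in VG 1 <-> exists x, (x < 6)%N /\ X = pt x.
Proof.
split=> [/VGP [w [a [hw ->]]]|[x [hx ->]]].
  case: w hw => [|i [|//]] //= _; exists (vt i a); rewrite vt_lt ptE; by [].
have hVG i a : pt (vt i a) \in VG 1 by apply/VGP; exists [:: i], a; rewrite ptE.
by case: x hx => [|[|[|[|[|[|]]]]]] // _;
  [exact: (hVG i0 i0)|exact: (hVG i1 i1)|exact: (hVG i2 i2)
  |exact: (hVG i1 i2)|exact: (hVG i0 i2)|exact: (hVG i0 i1)].
Qed.

Lemma pt_corner (j : 'I_3) : pt (val j) = uu j.
Proof. by case: (I3P j) => ->. Qed.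

Lemma corner_lt6 (j : 'I_3) : (val j < 6)%N.
Proof. by case: (I3P j) => ->. Qed.

Lemma conn_emb_pt g x y : (x < 6)%N -> (y < 6)%N ->
  conn (emb [::] g) (pt x) (pt y) <-> eqv (gcomp g) x y.
Proof. exact: (@conn_embP [::]). Qed.

Lemma conn_emb_corner g j k :
  conn (emb [::] g) (uu j) (uu k) <-> eqv (gcomp g) (val j) (val k).
Proof. by rewrite -!pt_corner; apply: conn_emb_pt; exact: corner_lt6. Qed.

Lemma eqv_refl c x : eqv c x x.
Proof. by rewrite eqvE. Qed.

Lemma eqv_sym c x y : eqv c x y = eqv c y x.
Proof. by rewrite !eqvE eq_sym. Qed.

Lemma eqv_trans c x y z : eqv c x y -> eqv c y z -> eqv c x z.
Proof. by rewrite !eqvE => /eqP -> /eqP ->. Qed.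

Lemma attC_P c : attC c <-> forall x, (x < 6)%N -> exists j : 'I_3, eqv c x (val j).
Proof.
split=> [/and4P[/or3P h3 /or3P h4 /or3P h5 _]|h].
  case=> [|[|[|[|[|[|]]]]]] // _; try by [exists i0; exact: eqv_refl|
    exists i1; exact: eqv_refl|exists i2; exact: eqv_refl].
  - by case: h3; [exists i0|exists i1|exists i2].
  - by case: h4; [exists i0|exists i1|exists i2].
  - by case: h5; [exists i0|exists i1|exists i2].
apply/allP => x hx; have : (x < 6)%N by move: hx; rewrite !inE => /or3P[]/eqP->.
by case/h => j; case: (I3P j) => -> ->; rewrite ?orbT.
Qed.

Lemma isSub_emb g : Defs.isSub 1 (emb [::] g).
Proof.
split; first exact: emb_sym.
move=> x y /embP [i [a [b [/andP[ab _] -> ->]]]]; apply/adjGP.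
by exists [:: i], a, b.
Qed.

Lemma att_emb g : attC (gcomp g) <->
  (forall x, x \in VG 1 -> exists j, conn (emb [::] g) x (uu j)).
Proof.
rewrite attC_P; split=> h x.
  case/VG1P => k [hk ->]; have [j hj] := h k hk; exists j.
  by rewrite -pt_corner; apply/conn_emb_pt => //; exact: corner_lt6.
move=> hx; have /h [j hj] : pt x \in VG 1 by apply/VG1P; exists x.
exists j; apply/conn_emb_pt => //; first exact: corner_lt6.
by rewrite pt_corner.
Qed.

Lemma isST1P g : isST 1 (emb [::] g) <->
  [&& attC (gcomp g), acycG g & stC (gcomp g)].
Proof.
split.
  case=> _ [/acyc_emb -> h]; have hu (j : 'I_3) : uu j \in VG 1.
    by apply/VG1P; exists (val j); rewrite pt_corner corner_lt6.
  apply/and3P; split=> //; first by apply/att_emb => x hx; exists i0; apply: h.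
  by apply/andP; split; [apply/(conn_emb_corner g i0 i1)|
    apply/(conn_emb_corner g i1 i2)]; apply: h.
case/and3P => /att_emb ha hc /andP[h01 h12].
split; first exact: isSub_emb.
split; first exact/acyc_emb.
have hz j : conn (emb [::] g) (uu j) (uu i0).
  apply/conn_emb_corner; case: (I3P j) => -> /=; first exact: eqv_refl.
    by rewrite eqv_sym.
  by rewrite eqv_sym; apply: eqv_trans h12.
have h0 x : x \in VG 1 -> conn (emb [::] g) x (uu i0).
  by case/ha => j hj; apply: conn_trans hj (hz j).
move=> x y /h0 hx /h0 hy; apply: conn_trans hx _.
by apply: conn_sym hy; exact: emb_sym.
Qed.

Lemma isS1P g k : isS 1 k (emb [::] g) <->
  [&& attC (gcomp g), acycG g, ~~ stC (gcomp g) & ce (conC (gcomp g)) k].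
Proof.
have cs j l : eqv (gcomp g) (val j) (val l) -> conn (emb [::] g) (uu j) (uu l).
  by move=> ?; apply/conn_emb_corner.
split.
  case=> _ [/acyc_emb -> [/att_emb -> [h1 h2]]] /=.
  have h1' j : j != k -> ~~ eqv (gcomp g) (val k) (val j).
    by move=> /h1 h; apply/negP => /cs.
  have h2' j l : j != k -> l != k -> eqv (gcomp g) (val j) (val l).
    by move=> hj hl; apply/conn_emb_corner; apply: h2.
  move: h1' h2' {h1 h2}; case: (I3P k) => -> h1 h2; rewrite /ce /= /stC negb_and.
  - by rewrite (h1 i1) // (h2 i1 i2).
  - by rewrite eqv_sym (h1 i0) // (h2 i2 i0).
  - by rewrite [eqv _ 1 2]eqv_sym (h1 i1) // (h2 i0 i1) ?orbT.
case/and4P => /att_emb ha hc hn hk; split; first exact: isSub_emb.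
split; first exact/acyc_emb.
split=> //; split=> [j hj /conn_emb_corner|j l hj hl].
  apply/negP; apply: contra hn; rewrite /stC.
  move: hj hk; case: (I3P k) => ->; case: (I3P j) => -> // _; rewrite /ce /=;
    rewrite !eqvE => /eqP h1 /eqP h2; apply/andP; split; apply/eqP; congruence.
apply: cs; move: hj hl hk; case: (I3P k) => ->; case: (I3P j) => -> //;
  case: (I3P l) => -> // _ _; rewrite /ce /= ?eqv_refl //; by rewrite eqv_sym.
Qed.

Lemma subG_cedge g i j l a b : i != j ->
  cedge (gi (subG g i j) l) a b = cedge (gi g l) a b && ((l == i) || (l == j)).
Proof.
case: g => [[[[? ?] ?] [[? ?] ?]] [[? ?] ?]].
case: (I3P i) => ->; case: (I3P j) => -> // _; case: (I3P l) => ->;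
  case: (I3P a) => ->; case: (I3P b) => ->;
  by rewrite /cedge /= /ce /= ?andbF ?andbT.
Qed.

Lemma psiEdgeP l i a b : a != b ->
  psiEdge l (psi i (uu a)) (psi i (uu b)) <-> l = i.
Proof.
move=> ab; split=> [[X [Y [/adjG0P [a' [b' [_ -> ->]]] [ea eb]]]]| ->].
  have e c k : psi k (uu c) = psiw [:: k] (uu c) by [].
  rewrite !e in ea eb.
  have [<- //] : [:: i] = [:: l] by apply: psiw_edge ab ea eb.
by exists (uu a), (uu b); split=> //; apply/adjG0P; exists a, b.
Qed.

Lemma subG_emb g i j X Y : i != j -> emb [::] (subG g i j) X Y <->
  emb [::] g X Y /\ (psiEdge i X Y \/ psiEdge j X Y).
Proof.
move=> ij; have e k c : psiw (rcons [::] k) (uu c) = psi k (uu c) by [].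
split.
  case/embP => l [a [b []]]; rewrite subG_cedge // => /andP[h hl] -> ->.
  have ab : a != b by case/andP: h.
  split; first by rewrite emb_cedge.
  rewrite !e; case/orP: hl => /eqP ->; [left|right]; exact/psiEdgeP.
case=> /embP [l [a [b [h -> ->]]]]; have ab : a != b by case/andP: h.
rewrite emb_cedge subG_cedge // h !e /= => -[] /(psiEdgeP _ _ ab) ->;
  by rewrite eqxx ?orbT.
Qed.

(** Confining the path to two cells amounts to connectivity after the third triangle has been
    emptied, which is what [subG] does; a connecting walk can then be shortened to a simple one. *)
Lemma centerAtP g i :
  centerAt (emb [::] g) i <-> centerG g i (ends i).1 (ends i).2.
Proof.
have key j : i != j -> eqv (gcomp (subG g i j)) (val i) (val j) <->
    (exists p : seq Point,
      [/\ path (emb [::] g) (uu i) p, last (uu i) p = uu j, uniq (uu i :: p) &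
        forall k, (k < size p)%N ->
          psiEdge i (nth (uu i) (uu i :: p) k) (nth (uu i) p k) \/
          psiEdge j (nth (uu i) (uu i :: p) k) (nth (uu i) p k)]).
  move=> ij; rewrite -conn_emb_corner; split.
    case/conn_upath => p [hp hl hu]; exists p; split=> //.
      by apply: sub_path hp => x y /(subG_emb _ _ _ ij) [].
    by move=> k hk; have /(pathP (uu i))/(_ k hk)/(subG_emb _ _ _ ij) [] := hp.
  case=> p [hp hl hu h]; exists p; split=> //; apply/(pathP (uu i)) => k hk.
  by apply/subG_emb => //; split; [move/(pathP (uu i)): hp; apply|exact: h].
have [h1 h2 h3] : [/\ i != (ends i).1, i != (ends i).2 &
    forall j, j != i -> j = (ends i).1 \/ j = (ends i).2].
  by case: (I3P i) => ->; split=> // j; case: (I3P j) => -> //; by [left|right].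
split=> [h|/andP[g1 g2] j ji].
  by apply/andP; split; apply/key => //; apply: h; rewrite eq_sym.
by apply/key; [rewrite eq_sym|case: (h3 j ji) => ->].
Qed.

(** This is the bridge from the trace defined by paths to the computed one, through which the
    evaluated tables apply to [Tr]. *)
Lemma Tr1_emb g a b : Tr1 (emb [::] g) (uu a) (uu b) = cedge (trG g) a b.
Proof.
apply/asboolP/idP.
  case=> /adjG0P [a' [b' [ab /uu_inj ? /uu_inj ?]]]; subst a' b'.
  rewrite /cedge ab /= /trG.
  case=> [[/isST1P /and3P[-> -> ->] [i [/centerAtP hi hab]]]|].
    have {hab}[?|?] : a = i \/ b = i by case: hab => /uu_inj; [left|right].
      subst i; move: ab hi; case: (I3P a) => ->; case: (I3P b) => -> // _;
        by rewrite /ce /= => ->; rewrite ?orbT.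
    subst i; move: ab hi; case: (I3P b) => ->; case: (I3P a) => -> // _;
      by rewrite /ce /= => ->; rewrite ?orbT.
  case=> k [/isS1P /and4P[-> -> /negPf ->] hk [ha hb]] /=.
  suff -> : third a b = k by [].
  have {}ha : a != k by apply/eqP => e; apply: ha; rewrite e.
  have {}hb : b != k by apply/eqP => e; apply: hb; rewrite e.
  move: ab ha hb {hk}; by case: (I3P a) => ->; case: (I3P b) => -> //;
    case: (I3P k) => ->.
case/andP => ab h; split; first by apply/adjG0P; exists a, b.
move: h; rewrite /trG; case: ifP => [/andP[h1 h2]|_]; last first.
  by rewrite /ce; case: (val _) => [|[]].
have hst : stC (gcomp g) -> isST 1 (emb [::] g).
  by move=> h; apply/isST1P; rewrite h1 h2.
case: ifP => [/hst hT|hn] hk; [left|right].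
  split=> //.
  have [/centerAtP h|/centerAtP h] : centerG g a (ends a).1 (ends a).2 \/
      centerG g b (ends b).1 (ends b).2; last first.
  - by exists b; split=> //; right.
  - by exists a; split=> //; left.
  move: hk ab; case: (I3P a) => ->; case: (I3P b) => -> // + _;
    rewrite /ce /= => /orP[] h; by [left|right].
exists (third a b); split; first by apply/isS1P; rewrite h1 h2 hn.
by move: ab {hk}; case: (I3P a) => ->; case: (I3P b) => -> // _; split => /uu_inj.
Qed.

Lemma TrP n f X Y : Defs.isSub n.+1 f -> Tr n f X Y <-> exists w a b,
  [/\ size w = n, X = psiw w (uu a), Y = psiw w (uu b) & cedge (trG (gst f w)) a b].
Proof.
move=> hf; have hp w : piw 1 w f = emb [::] (gst f w).
  by apply: piw1_emb; [exact: isSub_sym hf|exact: isSub_irr hf].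
split=> [/asboolP [w [hw [a [b [-> -> h]]]]]|[w [a [b [hw -> -> h]]]]].
  have /asboolP [/adjG0P [a' [b' [_ ea eb]]] _] := h; subst a b.
  by exists w, a', b'; split=> //; rewrite -Tr1_emb -hp.
apply/asboolP; exists w; split=> //; exists (uu a), (uu b); split=> //.
by rewrite hp Tr1_emb.
Qed.

Lemma isSub_Tr n f : Defs.isSub n.+1 f -> Defs.isSub n (Tr n f).
Proof.
move=> hf; split=> [x y|x y].
  by apply/idP/idP => /(TrP _ _ hf) [w [a [b [hw -> -> h]]]]; apply/TrP => //;
    exists w, b, a; rewrite cedge_sym.
move=> /(TrP _ _ hf) [w [a [b [hw -> -> /andP[ab _]]]]]; apply/adjGP.
by exists w, a, b.
Qed.

Lemma cstateP (q q' : cstate) : (forall a b, cedge q a b = cedge q' a b) -> q = q'.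
Proof.
case: q q' => [[? ?] ?] [[? ?] ?] h.
by move: (h i1 i2) (h i2 i0) (h i0 i1); rewrite /cedge /ce /= => -> -> ->.
Qed.

Lemma st_Tr n f v : Defs.isSub n.+1 f -> size v = n -> st (Tr n f) v = trG (gst f v).
Proof.
move=> hf hv; have hT := isSub_Tr hf; apply: cstateP => a b.
rewrite -(st_edge _ _ _ (isSub_sym hT) (isSub_irr hT)).
apply/idP/idP => [/(TrP _ _ hf) [w [a' [b' [hw ea eb h]]]]|h]; last first.
  by apply/TrP => //; exists v, a, b.
have ab : a' != b' by case/andP: h.
have ? : w = v by apply: psiw_edge ab (esym ea) (esym eb); rewrite hw hv.
by subst w; rewrite (uu_inj (psiw_inj ea)) (uu_inj (psiw_inj eb)).
Qed.

Lemma sub_ext n f f' : Defs.isSub n f -> Defs.isSub n f' ->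
  (forall v, size v = n -> st f v = st f' v) -> f = f'.
Proof.
move=> hf hf' h; apply/funext => X; apply/funext => Y.
have [|hn] := boolP (adjG n X Y).
  case/adjGP => w [a [b [hw ab -> ->]]].
  rewrite (st_edge _ _ _ (isSub_sym hf) (isSub_irr hf)).
  by rewrite (st_edge _ _ _ (isSub_sym hf') (isSub_irr hf')) h.
by case: hf hf' => _ hf [_ hf']; apply/idP/idP => [/hf|/hf'] h'; rewrite h' in hn.
Qed.

Definition spans n (H : rel Point) : Prop :=
  forall x y, x \in VG n -> y \in VG n -> conn H x y.

(** A redundant edge lies on a cycle and a bridge cannot be removed. Being a tree is thereby
    expressed by connectedness before and after deletion of one edge, the only property that has to
    be understood under gluing. *)
Lemma isST_min n H : Defs.isSub n H -> isST n H <->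
  spans n H /\ forall X Y, H X Y -> ~ spans n (del H X Y).
Proof.
move=> hS; have hs := isSub_sym hS; have hi := isSub_irr hS.
split=> [[_ [/(acyclic_bridge hs hi) hac hc]]|[hc hm]].
  split=> // X Y h; have /adjG_VG [hX hY] : adjG n X Y by apply: hS.2.
  by move=> h'; apply: (hac _ _ h); apply: h'.
split=> //; split=> //; apply/(acyclic_bridge hs hi) => X Y h h'.
apply: (hm X Y h) => x y hx hy; apply: conn_sub (hc x y hx hy) => a b hab.
have [e|e] := boolP ((a == X) && (b == Y) || (a == Y) && (b == X)); last first.
  by apply: conn_edge; rewrite /del hab e.
case/orP: e => /andP[/eqP -> /eqP ->] //.
by apply: conn_sym => //; exact: del_sym.
Qed.

(** * Gluing a subgraph of G_1 into one cell *)

Section Gluing.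
Variables (n : nat) (v : seq 'I_3).
Hypothesis hv : size v = n.

Definition off_cell (O : rel Point) : Prop := (forall X Y, O X Y = O Y X) /\
  forall X Y, O X Y -> exists w i a b, [/\ size w = n, w != v,
    a != b, X = psiw (rcons w i) (uu a) & Y = psiw (rcons w i) (uu b)].

Definition cglue (O : rel Point) (g : cell1) : rel Point :=
  fun X Y => O X Y || emb v g X Y.

Definition corner c := psiw v (uu c).

(** Excludes the three midpoints of the cell [v], the vertices that no edge outside this cell can
    touch. *)
Definition non_interior X : Prop :=
  forall x, (x < 6)%N -> X = psiw v (pt x) -> exists c, X = corner c.

Definition anchored O : Prop := forall X, X \in VG n.+1 -> non_interior X ->
  exists c, conn O X (corner c).

Definition conO O : cstate :=
  (`[< conn O (corner i1) (corner i2) >], `[< conn O (corner i2) (corner i0) >],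
   `[< conn O (corner i0) (corner i1) >]).

Lemma off_cell_edge O X Y : off_cell O -> O X Y -> non_interior X.
Proof.
case=> _ h /h [w [i [a [b [hw hn _ -> _]]]]] x _ e.
have := @psiw_meet w v _ _ _ (inT_psi i (inT_uu a)) (inT_pt x).
rewrite hw hv -psiw_rcons => /(_ erefl e) [wv|[_ [j ej]]].
  by rewrite wv eqxx in hn.
by exists j; rewrite e ej.
Qed.

Lemma emb_inside g X Y : emb v g X Y -> exists x, (x < 6)%N /\ X = psiw v (pt x).
Proof.
case/embP => i [a [b [_ -> _]]]; exists (vt i a).
by rewrite vt_lt psiw_pt.
Qed.

Lemma glue_sym O g : off_cell O -> forall X Y, cglue O g X Y = cglue O g Y X.
Proof. by case=> h _ X Y; rewrite /cglue h emb_sym. Qed.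

Lemma corner_pt c : corner c = psiw v (pt (val c)).
Proof. by rewrite pt_corner. Qed.

(** A walk can enter the cell only at a corner, so its part before the first entrance stays in
    [O]. *)
Lemma glue_anchored O g : off_cell O -> forall p X, non_interior X ->
  path (cglue O g) X p -> (exists c, last X p = corner c) ->
  exists c, conn O X (corner c).
Proof.
move=> hO; elim=> [|Y p IH] X hX /=.
  by move=> _ [c ->]; exists c; exact: conn_refl.
case/andP => h hp hl; case/orP: h => h; last first.
  have [x [hx /(hX x hx) [c ->]]] := emb_inside h; exists c; exact: conn_refl.
have hY : non_interior Y by apply: (off_cell_edge (Y := X) hO); rewrite hO.1.
have [c hc] := IH Y hY hp hl; exists c; apply: conn_trans hc; exact: conn_edge.
Qed.

(** Dually, a walk leaves the cell only at a corner. [dd_level_step] uses this again to reach level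
    n from a vertex of level n+1 inside a single cell. *)
Lemma glue_attached O g : off_cell O -> forall p x, (x < 6)%N ->
  path (cglue O g) (psiw v (pt x)) p -> (exists c, last (psiw v (pt x)) p = corner c) ->
  exists c, conn (emb v g) (psiw v (pt x)) (corner c).
Proof.
move=> hO; elim=> [|Y p IH] x hx /=.
  by move=> _ [c ->]; exists c; exact: conn_refl.
case/andP => h hp hl; case/orP: h => h.
  have [c ->] := off_cell_edge hO h hx erefl; exists c; exact: conn_refl.
have [y [hy e]] : exists y, (y < 6)%N /\ Y = psiw v (pt y).
  by apply: (@emb_inside g _ (psiw v (pt x))); rewrite emb_sym.
subst Y; have [c hc] := IH y hy hp hl; exists c; apply: conn_trans hc.
exact: conn_edge.
Qed.

Lemma conn_cornerE g c c' :
  conn (emb v g) (corner c) (corner c') <-> eqv (gcomp g) (val c) (val c').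
Proof. by rewrite !corner_pt; apply: conn_embP; exact: corner_lt6. Qed.

Lemma conn_last_edge (O : rel Point) X Y : (forall X Y, O X Y = O Y X) ->
  conn O X Y -> X = Y \/ exists Z, O Y Z.
Proof.
move=> hs /(conn_sym hs) [[|Z p] [/= hp hl]]; first by left.
by right; exists Z; case/andP: hp.
Qed.

Lemma not_conn3 p po : ~~ conn3 p po -> exists c, forall k,
  c = (ends k).1 \/ c = (ends k).2 -> ~~ ce p k /\ ~~ ce po k.
Proof.
move=> h; have [c hc] : exists c, forall k, c = (ends k).1 \/ c = (ends k).2 ->
    ~~ (ce p k || ce po k).
  move: h; rewrite /conn3; case h0: (ce p i0 || _); case h1: (ce p i1 || _);
    case h2: (ce p i2 || _) => // _; [exists i0|exists i1|exists i2|exists i2];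
    move=> k; case: (I3P k) => -> /=; rewrite ?h0 ?h1 ?h2 //; by case.
by exists c => k /hc; rewrite negb_or => /andP[].
Qed.

Lemma conO_ends O k :
  ce (conO O) k = `[< conn O (corner (ends k).1) (corner (ends k).2) >].
Proof. by case: (I3P k) => ->. Qed.

Lemma conC_ends c k : ce (conC c) k = eqv c (val (ends k).1) (val (ends k).2).
Proof. by case: (I3P k) => ->. Qed.

Lemma ends_exists (c c' : 'I_3) : c != c' ->
  exists k, (c, c') = ends k \/ (c', c) = ends k.
Proof.
by case: (I3P c) => ->; case: (I3P c') => -> // _;
  (by exists i0; (left + right)) || (by exists i1; (left + right)) ||
  (by exists i2; (left + right)).
Qed.

(** Inside and outside meet only in the corners, so connectedness splits into a condition on [O],
    one on [g], and one on the corners that sees the outside only through the three bits [conO O].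
    Exchanging [g] becomes a finite question. *)
Lemma connected_glue O g : off_cell O ->
  spans n.+1 (cglue O g) <->
  [/\ anchored O, attC (gcomp g) & conn3 (conC (gcomp g)) (conO O)].
Proof.
move=> hO; have hOs := hO.1.
have hc0 c : corner c \in VG n.+1 by apply: VG_S; apply/VGP; exists v, c.
have hin x : (x < 6)%N -> psiw v (pt x) \in VG n.+1.
  move=> hx; have /VG1P/VGP : exists y, (y < 6)%N /\ pt x = pt y by exists x.
  case=> w [a [hw ->]]; rewrite -psiw_cat; apply/VGP; exists (v ++ w), a.
  by rewrite size_cat hv hw addn1.
split=> [hc|[hA hB hC]].
  split.
  - move=> X hX hn; have [p [hp hl]] := hc _ _ hX (hc0 i0).
    by apply: (glue_anchored hO hn hp); exists i0.
  - apply/attC_P => x hx; have [p [hp hl]] := hc _ _ (hin x hx) (hc0 i0).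
    have [] := glue_attached hO hx hp; first by exists i0.
    move=> c; rewrite corner_pt => /conn_embP h; exists c; apply: h => //.
    exact: corner_lt6.
  (* Otherwise some corner [c] is joined to no other corner on either side. A walk from [c] can
     change sides only at a corner reached so far, that is at [c], and misses the other corners. *)
  apply: contraT => /not_conn3 [c h].
  have hiso c' : conn O (corner c) (corner c') \/
      conn (emb v g) (corner c) (corner c') -> c' = c.
    move=> h'; apply/eqP; apply: contraT; rewrite eq_sym => /ends_exists [k hk].
    have [] := h k; first by case: hk => <-; [left|right].
    rewrite conC_ends conO_ends => /negP h1 /asboolPn h2; case: h' => h'.
      by case: h2; case: hk => <- //=; exact: conn_sym.
    move/conn_cornerE: h' => h'; case: h1; case: hk => <- //=.
    by rewrite eqv_sym.
  have inv p X : conn O (corner c) X \/ conn (emb v g) (corner c) X ->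
      path (cglue O g) X p ->
      conn O (corner c) (last X p) \/ conn (emb v g) (corner c) (last X p).
    elim: p X => [//|Y p IH] X hX /= /andP[hXY]; apply: IH.
    case/orP: hXY => hXY; [left|right].
      case: hX => hX; first by apply: conn_trans hX _; exact: conn_edge.
      have hX' : non_interior X := off_cell_edge hO hXY.
      have [x [hx e]] : exists x, (x < 6)%N /\ X = psiw v (pt x).
        have := conn_last_edge (@emb_sym v g) hX.
        by case=> [<-|[Z /emb_inside //]]; exists (val c); rewrite corner_pt corner_lt6.
      have [c' ec'] := hX' x hx e; subst X.
      by rewrite ec' in hX hXY; rewrite (hiso c') in hXY; [exact: conn_edge|right].
    case: hX => hX; last by apply: conn_trans hX _; exact: conn_edge.
    have [x [hx e]] := emb_inside hXY.
    have [c' ec'] : exists c', X = corner c'.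
      have := conn_last_edge hOs hX; case=> [<-|[Z hZ]]; first by exists c.
      exact: (off_cell_edge hO hZ hx e).
    rewrite ec' in hX hXY; rewrite (hiso c') in hXY; [exact: conn_edge|by left].
  have hall c' : c' = c.
    apply: hiso; have [p [hp <-]] := hc _ _ (hc0 c) (hc0 c').
    apply: inv hp; left; exact: conn_refl.
  by have := hall i0; rewrite -(hall i1).
have gO X Y : conn O X Y -> conn (cglue O g) X Y.
  by apply: conn_sub => a b h; apply: conn_edge; rewrite /cglue h.
have gE X Y : conn (emb v g) X Y -> conn (cglue O g) X Y.
  by apply: conn_sub => a b h; apply: conn_edge; rewrite /cglue h orbT.
have gs X Y : conn (cglue O g) X Y -> conn (cglue O g) Y X.
  by apply: conn_sym; exact: glue_sym.
have hk k : ce (conC (gcomp g)) k || ce (conO O) k ->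
    conn (cglue O g) (corner (ends k).1) (corner (ends k).2).
  rewrite conC_ends conO_ends => /orP[h|/asboolP/gO//].
  by apply: gE; apply/conn_cornerE.
have hcc c : conn (cglue O g) (corner c) (corner i0).
  have [h10 h20] : conn (cglue O g) (corner i1) (corner i0) /\
      conn (cglue O g) (corner i2) (corner i0).
    case/or3P: hC => /andP[/hk h /hk h'] /=; rewrite /= in h h'.
    - by split=> //; apply: conn_trans h h'.
    - by split=> //; exact: gs.
    - by split; [exact: gs|apply: conn_trans (gs _ _ h) (gs _ _ h')].
  by case: (I3P c) => -> //; exact: conn_refl.
have h0 X : X \in VG n.+1 -> conn (cglue O g) X (corner i0).
  move=> hX; have [[x [hx e]]|hx] :=
      pselect (exists x, (x < 6)%N /\ X = psiw v (pt x)).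
    have [j hj] := (attC_P _).1 hB x hx; rewrite e.
    apply: conn_trans (hcc j); apply: gE; rewrite corner_pt.
    by apply/conn_embP => //; exact: corner_lt6.
  have [|c hc] := hA X hX; first by move=> x h e; case: hx; exists x.
  by apply: conn_trans (hcc c); exact: gO.
by move=> X Y /h0 hX /h0 hY; apply: conn_trans hX (gs _ _ hY).
Qed.

End Gluing.

Local Opaque tab trG gcomp.

(** * Replacing one cell of a spanning tree *)

Lemma mem_fibt g q : (g \in fibt tab q) = (trG g == q).
Proof.
apply/mapP/eqP => [[p]|hq].
  by rewrite mem_filter => /andP[/eqP <- /mapP [g' _ ->]] ->.
exists (g, trG g) => //; rewrite mem_filter /= hq eqxx -hq.
by apply: (map_f (fun g => (g, trG g))); exact: mem_all_cell1.
Qed.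

Lemma mem_L3 i : i \in L3.
Proof. by case: (I3P i) => ->. Qed.

Lemma trG_con g : trG g != cst0 -> attC (gcomp g) /\ conC (gcomp g) = conQ (trG g).
Proof.
move=> h; have := check_swap_tab; rewrite /check_swap => /allP/(_ _ (mem_all_cst (trG g))).
rewrite h => /andP[/allP /(_ g) + _]; rewrite mem_fibt eqxx => /(_ isT).
by case/andP => h1 /eqP h2; split; [exact: h1|exact: h2].
Qed.

Lemma trG_min g g' po : trG g != cst0 -> trG g' = trG g ->
  conn3 (conQ (trG g)) po -> minG g po = minG g' po.
Proof.
move=> h hg hpo; have := check_swap_tab; rewrite /check_swap => /allP/(_ _ (mem_all_cst (trG g))).
rewrite h => /andP[_ /allP/(_ po (mem_all_cst po))]; rewrite hpo /=.
have h1 : g \in fibt tab (trG g) by rewrite mem_fibt.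
have h2 : g' \in fibt tab (trG g) by rewrite mem_fibt hg.
move: h1 h2; elim: (fibt _ _) => // a F IH.
rewrite /= !inE => h1 h2 /allP hc.
have e b : b \in a :: F -> minG b po = minG a po.
  rewrite inE => /orP[/eqP -> //|hb]; apply/esym/eqP.
  by rewrite eq_sym; apply: hc; apply: map_f.
by rewrite !e // inE.
Qed.

Definition full1 : cell1 := let q := (true, true, true) in (q, q, q).

Lemma emb_full v g X Y : emb v g X Y -> emb v full1 X Y.
Proof.
case/embP => i [a [b [/andP[ab _] -> ->]]]; rewrite emb_cedge /cedge ab.
by case: (I3P i) => ->; case: (third a b) => [[|[|[|]]]].
Qed.

Definition outside (f : rel Point) v : rel Point :=
  fun X Y => f X Y && ~~ emb v full1 X Y.

Definition repl (f : rel Point) v g : rel Point := cglue v (outside f v) g.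

Section Replacement.
Variables (n : nat) (v : seq 'I_3).
Hypothesis hv : size v = n.
Variable f : rel Point.
Hypothesis hf : Defs.isSub n.+1 f.

Lemma full_cedge i a b : cedge (gi full1 i) a b = (a != b).
Proof.
by case: (I3P i) => ->; case: (I3P a) => ->; case: (I3P b) => ->.
Qed.

Lemma off_outside : off_cell n v (outside f v).
Proof.
split=> [X Y|X Y]; first by rewrite /outside hf.1 emb_sym.
case/andP => /hf.2 /adjGP [w' [a [b [hw ab -> ->]]]] h.
case: (lastP w') hw h => // w i; rewrite size_rcons => -[hw] h.
exists w, i, a, b; split=> //; apply: contra h => /eqP ->.
by rewrite emb_cedge full_cedge.
Qed.

Lemma glue_outside : repl f v (gst f v) = f.
Proof.
apply/funext => X; apply/funext => Y; rewrite /repl /cglue /outside.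
have hc i a b : cedge (gi (gst f v) i) a b =
    f (psiw (rcons v i) (uu a)) (psiw (rcons v i) (uu b)).
  by rewrite gi_gst -st_edge //; [exact: hf.1|exact: isSub_irr hf].
case h : (emb v full1 X Y); last first.
  rewrite andbT; case h' : (emb _ _ _ _); last by rewrite orbF.
  by rewrite (emb_full h') in h.
rewrite andbF /=; move/embP: h => [i [a [b [_ -> ->]]]].
by rewrite emb_cedge hc.
Qed.

Lemma isSub_repl g : Defs.isSub n.+1 (repl f v g).
Proof.
split; first exact: glue_sym off_outside.
move=> X Y /orP[/andP[/hf.2] //|/embP [i [a [b [/andP[ab _] -> ->]]]]].
by apply/adjGP; exists (rcons v i), a, b; rewrite size_rcons hv.
Qed.

Lemma st_repl g w i : size w = n ->
  st (repl f v g) (rcons w i) = if w == v then gi g i else st f (rcons w i).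
Proof.
move=> hw; have hr := isSub_repl g; apply: cstateP => a b.
rewrite -st_edge; [|exact: hr.1|exact: isSub_irr hr].
rewrite /repl /cglue /outside.
have [->|wv] := eqVneq w v.
  rewrite !emb_cedge full_cedge negbK.
  have [->|ab] := eqVneq a b; last by rewrite andbF.
  by rewrite (isSub_irr hf).
rewrite st_edge; [|exact: hf.1|exact: isSub_irr hf].
have hn g' : emb v g' (psiw (rcons w i) (uu a)) (psiw (rcons w i) (uu b)) = false.
  apply/negP => /embP [i' [a' [b' [/andP[ab' _] ea eb]]]].
  have [e _ _ _] := rcons_words_edge (etrans hv (esym hw)) ab' (esym ea) (esym eb).
  by rewrite e eqxx in wv.
by rewrite !hn orbF andbT.
Qed.

Lemma gst_repl g w : size w = n ->
  gst (repl f v g) w = if w == v then g else gst f w.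
Proof.
move=> hw; rewrite /gst !st_repl //; case: ifP => // _.
by case: g => [[? ?] ?].
Qed.

Lemma Tr_repl g : trG g = trG (gst f v) -> Tr n (repl f v g) = Tr n f.
Proof.
move=> hg; have hr := isSub_repl g.
apply: (@sub_ext n); [exact: isSub_Tr|exact: isSub_Tr|move=> w hw].
by rewrite !st_Tr // gst_repl //; case: ifP => // /eqP ->.
Qed.

End Replacement.

Lemma repl_repl n v f g : size v = n -> Defs.isSub n.+1 f ->
  repl (repl f v g) v (gst f v) = f.
Proof.
move=> hv hf; have hr := isSub_repl hv hf g.
apply: (@sub_ext n.+1) => // [|w hw]; first exact: (isSub_repl hv hr).
case: (lastP w) hw => // {}w i; rewrite size_rcons => -[hw].
rewrite (st_repl hv hr) //; have [->|wv] := eqVneq w v; first exact: gi_gst.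
by rewrite (st_repl hv hf) // (negbTE wv).
Qed.

Lemma del_glue_out v O g X Y n : off_cell n v O -> size v = n -> O X Y ->
  off_cell n v (del O X Y) /\ del (cglue v O g) X Y = cglue v (del O X Y) g.
Proof.
move=> hO hv h; split.
  split=> [A B|A B /andP[/hO.2 //]]; exact: del_sym hO.1 _ _.
have hn : emb v g X Y = false.
  apply/negP => /embP [i [a [b [/andP[ab _] ea eb]]]].
  case: (hO.2 _ _ h) => w [i' [a' [b' [hw wv ab' ea' eb']]]].
  rewrite ea' in ea; rewrite eb' in eb.
  have [e _ _ _] := rcons_words_edge (etrans hw (esym hv)) ab' ea eb.
  by rewrite e eqxx in wv.
apply/funext => A; apply/funext => B; rewrite /del /cglue.
case h' : (emb v g A B); last by rewrite !orbF.
rewrite !orbT /=; apply/negP => /orP[]/andP[/eqP e1 /eqP e2].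
  by rewrite -e1 -e2 h' in hn.
by rewrite -e1 -e2 emb_sym h' in hn.
Qed.

Lemma del_glue_in v O g i k n : off_cell n v O -> size v = n ->
  del (cglue v O g) (psiw (rcons v i) (uu (ends k).1)) (psiw (rcons v i) (uu (ends k).2))
  = cglue v O (delG g i k).
Proof.
move=> hO hv; apply/funext => A; apply/funext => B; rewrite /cglue -del_emb /del.
case h : (O A B) => //=; apply/negP.
have hn : emb v full1 A B = false.
  apply/negP => /embP [j [a [b [_ ea eb]]]].
  case: (hO.2 _ _ h) => w [i' [a' [b' [hw wv ab' ea' eb']]]].
  rewrite ea' in ea; rewrite eb' in eb.
  have [e _ _ _] := rcons_words_edge (etrans hw (esym hv)) ab' ea eb.
  by rewrite e eqxx in wv.
move=> /orP[]/andP[/eqP e1 /eqP e2]; move: hn;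
  by rewrite e1 e2 emb_cedge full_cedge ?ends_neq // eq_sym ends_neq.
Qed.

(** Members of a fibre join the same corners, so connectedness carries over, also after deletion of
    an outside edge. For an inside edge the deleted edges of [g] and of the old cell do not
    correspond; there the constancy of [minG] on the fibre decides. *)
Lemma isST_repl n v f g : size v = n -> isST n.+1 f ->
  trG g = trG (gst f v) -> trG g != cst0 -> isST n.+1 (repl f v g).
Proof.
move=> hv hT hg h0; have hf := hT.1; have hO := off_outside v hf.
have hr := isSub_repl hv hf g.
have /(isST_min hf) [hc hm] := hT; apply/(isST_min hr).
set g0 := gst f v in hg; set O := outside f v in hO.
have ef : f = cglue v O g0 by rewrite -[LHS](glue_outside v hf).
have h0' : trG g0 != cst0 by rewrite -hg.
have [hB hP] := trG_con h0; have [hB0 hP0] := trG_con h0'.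
have ePQ : conC (gcomp g0) = conC (gcomp g) by rewrite hP hP0 hg.
move: (hc); rewrite {1}ef => /(connected_glue hv _ hO) [hA _ hC].
split.
  by apply/(connected_glue hv _ hO); split=> //; rewrite -ePQ.
move=> X Y; rewrite /repl -/O => /orP[h|/embP [i [a [b [h -> ->]]]]] hcd.
  have [hO' e'] := del_glue_out g hO hv h.
  move: hcd; rewrite e' => /(connected_glue hv _ hO') [hA' _ hC'].
  apply: (hm X Y); first by rewrite ef /cglue h.
  have [_ e0] := del_glue_out g0 hO hv h.
  rewrite (congr1 (fun h => del h X Y) ef) e0.
  by apply/(connected_glue hv _ hO'); split=> //; rewrite ePQ.
have hmin : minG g0 (conO v O).
  apply/allP => j _; apply/allP => k _; case: ifP => // hk.
  apply/negP => /andP[h1 h2].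
  apply: (hm (psiw (rcons v j) (uu (ends k).1)) (psiw (rcons v j) (uu (ends k).2))).
    rewrite ef /cglue emb_cedge orbC; apply/orP; left; apply/cedgeP.
    by exists k; split=> //; left; rewrite -surjective_pairing.
  rewrite (congr1 (fun h => del h _ _) ef) (del_glue_in _ _ _ hO hv).
  by apply/(connected_glue hv _ hO).
have hmin' : minG g (conO v O).
  by rewrite -(@trG_min g0) //; rewrite -hP0.
case/cedgeP: h => k [hk hab].
have {}hcd : spans n.+1 (cglue v O (delG g i k)).
  rewrite -(del_glue_in _ _ _ hO hv); case: hab hcd => <- //=.
  set H := del _ _ _ => h; set H' := del _ _ _.
  suff <- : H = H' by [].
  by apply/funext => A; apply/funext => B; rewrite /H /H' /del orbC.
move/(connected_glue hv _ hO): hcd => [_ h1 h2].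
move/allP: hmin' => /(_ i (mem_L3 i))/allP/(_ k (mem_L3 k)).
by rewrite hk /= h1 h2.
Qed.

(** * Refinement of tree paths *)

Lemma trG_refine g a b : a != b -> ccon (trG g) a b -> opt1 g a b || opt2 g a b.
Proof.
move=> ab hc; have := check_refine_tab; rewrite /check_refine.
have hg : (g, trG g) \in tab by apply: (map_f (fun g => (g, trG g))); exact: mem_all_cell1.
move=> /allP/(_ _ hg)/andP[_ /allP/(_ a (mem_L3 a))/allP/(_ b (mem_L3 b))].
by rewrite ab hc.
Qed.

Lemma trG_full g : trG g != (true, true, true).
Proof.
have := check_refine_tab; rewrite /check_refine.
have hg : (g, trG g) \in tab by apply: (map_f (fun g => (g, trG g))); exact: mem_all_cell1.
by move=> /allP/(_ _ hg)/andP[].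
Qed.

(* [(w, a, b)] : the path under consideration traverses the cell [w] from its
   corner [a] to its corner [b]. *)
Definition crossing := (seq 'I_3 * 'I_3 * 'I_3)%type.
Definition word (x : crossing) : seq 'I_3 := x.1.1.
Definition src (x : crossing) : Point := psiw x.1.1 (uu x.1.2).
Definition tgt (x : crossing) : Point := psiw x.1.1 (uu x.2).

Definition valid n (f : rel Point) (x : crossing) : bool :=
  [&& size x.1.1 == n, x.1.2 != x.2 & ccon (st f x.1.1) x.1.2 x.2].

Fixpoint chain (p : Point) (L : seq crossing) (q : Point) : bool :=
  if L is x :: L' then (src x == p) && chain (tgt x) L' q else p == q.

(** The local condition that keeps the assembled walk from backtracking. *)
Definition switching (L : seq crossing) : bool :=
  sorted (fun x y => word x != word y) L.

Definition steps (f : rel Point) (x : crossing) : seq Point :=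
  if cedge (st f x.1.1) x.1.2 x.2 then [:: tgt x]
  else [:: psiw x.1.1 (uu (third x.1.2 x.2)); tgt x].

Definition walk f L : seq Point := flatten (map (steps f) L).

Definition xlen f (x : crossing) : nat := elen (st f x.1.1) x.1.2 x.2.

Lemma chain_cat p L L' q r : chain p L q -> chain q L' r -> chain p (L ++ L') r.
Proof.
elim: L p => [|x L IH] p /= => [/eqP -> //|/andP[-> h] h'].
exact: IH.
Qed.

Lemma size_walk f L : size (walk f L) = (\sum_(x <- L) xlen f x)%N.
Proof.
elim: L => [|x L IH]; first by rewrite big_nil.
by rewrite big_cons /walk /= size_cat -/(walk f L) IH /xlen /steps /elen; case: ifP.
Qed.

Lemma walk_path n f L p q : Defs.isSub n f -> all (valid n f) L -> chain p L q ->
  path f p (walk f L) /\ last p (walk f L) = q.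
Proof.
move=> hf; elim: L p => [|x L IH] p /=; first by move=> _ /eqP.
case/andP => /and3P[/eqP hw ab hc] hL /andP[/eqP <- hch].
have [h1 h2] := IH _ hL hch.
have e a b : f (psiw x.1.1 (uu a)) (psiw x.1.1 (uu b)) = cedge (st f x.1.1) a b.
  by apply: st_edge; [exact: isSub_sym hf|exact: isSub_irr hf].
rewrite /walk /= -/(walk f L) cat_path last_cat /steps.
move: hc; rewrite /ccon (negbTE ab) /=.
case: ifP => [hd _|_ /= /andP[ha hb]] /=; rewrite h1 h2 /src /tgt !e.
  by rewrite hd.
by rewrite ha hb.
Qed.

(** A step back would put one edge into two consecutive, hence different, cells, against
    [psiw_edge]. *)
Lemma nobacktrack_walk n f L p q : all (valid n f) L -> chain p L q ->
  switching L -> nobacktrack (p :: walk f L).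
Proof.
elim: L p => [//|x L IH] p hall hcha hs.
case/andP: hall => /and3P[/eqP hw ab hc] hL; case/andP: hcha => /eqP <- hch.
have {}IH := IH _ hL hch (path_sorted hs).
have hz c z s : c != x.2 -> walk f L = z :: s -> psiw x.1.1 (uu c) != z.
  case: L hL hch hs {IH} => [//|y L] /= /andP[/and3P[/eqP hw' ab' _] _].
  case/andP => /eqP hy _ /andP[xy _] cb; rewrite /walk /= {1}/steps => hzs.
  have [c' ez] : exists c', z = psiw y.1.1 (uu c').
    by move: hzs; case: ifP => _ [<- _]; eexists.
  apply: contra_neq xy => e; rewrite ez in e.
  by apply: psiw_edge cb e (esym hy); rewrite hw hw'.
have hpt : src x != tgt x by apply: contra_neq ab => /psiw_inj/uu_inj.
have hab c : c != x.2 -> nobacktrack (psiw x.1.1 (uu c) :: tgt x :: walk f L).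
  move=> hc'; case E : (walk f L) IH => [//|z s] IH.
  by rewrite [nobacktrack _]/= (hz c z s hc' E).
have -> : walk f (x :: L) = steps f x ++ walk f L by [].
rewrite /steps; case: ifP => _; first exact: (hab _ ab).
have ht : third x.1.2 x.2 != x.2.
  by move: ab; case: (I3P x.1.2) => ->; case: (I3P x.2) => ->.
by apply/andP; split; [exact: hpt|exact: (hab _ ht)].
Qed.

Lemma dist_chain n f L p q : isST n f -> all (valid n f) L -> chain p L q ->
  switching L -> dist f p q = (\sum_(x <- L) xlen f x)%N.
Proof.
move=> hT hL hc ha; have hf := hT.1; have [hp <-] := walk_path hf hL hc.
have hs := isSub_sym hf; have hi := isSub_irr hf.
rewrite dist_upath ?size_walk //; first exact: hT.2.1.
by apply: nobacktrack_uniq => //; [exact: hT.2.1|exact: (nobacktrack_walk hL hc ha)].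
Qed.

Lemma ccon_trans q a b c : ccon q a b -> ccon q b c -> ccon q a c.
Proof.
case: q => [[x y] z]; case: (I3P a) => ->; case: (I3P b) => ->; case: (I3P c) => ->;
  rewrite /ccon /cedge /ce /=; by move: x y z; do 3!case.
Qed.

(** Every edge of a walk is a crossing of its cell; consecutive crossings of the same cell are
    merged. *)
Lemma chain_exists n f u v : Defs.isSub n f -> conn f u v ->
  exists L, [/\ all (valid n f) L, switching L & chain u L v].
Proof.
move=> hf [p [hp <-]] {v}; elim: p u hp => [|y p IH] u /=.
  by move=> _; exists [::]; split; rewrite //= eqxx.
case/andP => /[dup] /hf.2 /adjGP [w [a [b [hw ab -> ey]]]] h /IH {IH}.
subst y; rewrite st_edge in h; [|exact: isSub_sym hf|exact: isSub_irr hf].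
have hcon : ccon (st f w) a b by rewrite /ccon h orbT.
case=> -[|x L] [hL hA hC].
  by exists [:: (w, a, b)]; rewrite /= /valid /= hw eqxx ab hcon eqxx.
have [wx|wx] := eqVneq w x.1.1; last first.
  exists ((w, a, b) :: x :: L); split=> //.
  - by rewrite /= /valid /= hw eqxx ab hcon.
  - by rewrite /switching /= wx.
  - by rewrite [chain _ _ _]/= eqxx.
move: hL hA hC => /= /andP[/and3P[hx1 hx2 hx3] hL] hA /andP[/eqP hsrc hC].
have hb : x.1.2 = b by apply: uu_inj; apply: (@psiw_inj w); rewrite -hsrc /src wx.
(* If the merged crossing returns to its starting corner, the two cancel. *)
have [ax|ax] := eqVneq a x.2.
  exists L; split=> //; first exact: path_sorted hA.
  by move: hC; rewrite /tgt -wx -ax.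
exists ((w, a, x.2) :: L); split.
- rewrite /= hL /valid /= hw eqxx ax /= andbT.
  by apply: ccon_trans hcon _; rewrite -hb wx.
- by move: hA; rewrite /switching /=; case: (L) => //= z L'; rewrite /word /= wx.
- by move: hC; rewrite /= /src /tgt /= eqxx wx.
Qed.

Definition ref f (x : crossing) : seq crossing :=
  [seq (rcons x.1.1 y.1.1, y.1.2, y.2) | y <- ref1 (gst f x.1.1) x.1.2 x.2].

Definition refine f L : seq crossing := flatten (map (ref f) L).

Lemma refine_cons f x L : refine f (x :: L) = ref f x ++ refine f L.
Proof. by []. Qed.

Lemma refine_cat f L L' : refine f (L ++ L') = refine f L ++ refine f L'.
Proof. by rewrite /refine map_cat flatten_cat. Qed.

Lemma thirdP (a b : 'I_3) : a != b ->
  [/\ third a b != a, third a b != b, a != third a b & b != third a b].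
Proof. by case: (I3P a) => ->; case: (I3P b) => ->. Qed.

Lemma vt_sym i j : vt i j = vt j i.
Proof. by case: (I3P i) => ->; case: (I3P j) => ->. Qed.

Lemma psi_mid i j : psi i (uu j) = psi j (uu i).
Proof. by rewrite -!ptE vt_sym. Qed.

Section Refine.
Variables (n : nat) (f : rel Point).
Hypothesis hf : Defs.isSub n.+1 f.

Lemma ref_spec x : valid n (Tr n f) x ->
  [/\ all (valid n.+1 f) (ref f x), switching (ref f x) &
      chain (src x) (ref f x) (tgt x)].
Proof.
case/and3P => /eqP hw ab; rewrite st_Tr // => /(trG_refine ab) ho.
have hv i a b : valid n.+1 f (rcons x.1.1 i, a, b) =
    (a != b) && ccon (gi (gst f x.1.1) i) a b.
  by rewrite /valid /= size_rcons hw eqxx gi_gst.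
have [t1 t2 t3 t4] := thirdP ab.
have rn i j : i != j -> rcons x.1.1 i != rcons x.1.1 j.
  by apply: contra_neq => /rcons_inj [].
rewrite /ref /ref1; case: ifP ho => [/andP[h1 h2] _|_ /= /and3P[h1 h2 h3]] /=.
  split; first by rewrite !hv ab h1 h2.
    by rewrite /switching /= /word /= rn.
  rewrite /src /tgt /= !psiw_rcons !psi_uu !eqxx /= andbT.
  by rewrite [psi x.2 _]psi_mid eqxx.
split; first by rewrite !hv ab t2 t3 h1 h2 h3.
  by rewrite /switching /= /word /= !rn.
rewrite /src /tgt /= !psiw_rcons !psi_uu !eqxx /= andbT.
by rewrite [psi _ (uu x.1.2)]psi_mid [psi x.2 _]psi_mid !eqxx.
Qed.

Lemma size_ref x : (2 <= size (ref f x) <= 3)%N.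
Proof. by rewrite /ref size_map /ref1; case: ifP. Qed.

Lemma word_ref x y : y \in ref f x -> exists i, word y = rcons (word x) i.
Proof. by case/mapP => z _ ->; exists z.1.1. Qed.

Lemma refine_valid L : all (valid n (Tr n f)) L -> all (valid n.+1 f) (refine f L).
Proof.
elim: L => [//|x L IH] /= /andP[/ref_spec [h _ _] /IH]; by rewrite all_cat h.
Qed.

Lemma refine_chain L p q : all (valid n (Tr n f)) L -> chain p L q ->
  chain p (refine f L) q.
Proof.
elim: L p => [//|x L IH] p /= /andP[/ref_spec [_ _ h] hL] /andP[/eqP <- /(IH _ hL)].
exact: chain_cat.
Qed.

Lemma refine_switching L : all (valid n (Tr n f)) L -> switching L ->
  switching (refine f L).
Proof.
elim: L => [//|x L IH] /= /andP[/ref_spec [_ h _] hL] hs.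
have := IH hL (path_sorted hs); rewrite refine_cons.
case E : (ref f x) (size_ref x) h => [//|y s] _ h {}IH.
rewrite /switching /= cat_path; apply/andP; split=> //.
case: L hs hL IH => [//|x' L] /= /andP[xx' _] _; rewrite refine_cons.
case E' : (ref f x') (size_ref x') => [//|y' s'] _; rewrite /switching /= => ->.
rewrite andbT; have [i ->] : exists i, word (last y s) = rcons (word x) i.
  by apply: word_ref; rewrite E mem_last.
have [j ->] : exists j, word y' = rcons (word x') j.
  by apply: word_ref; rewrite E' inE eqxx.
by apply: contra_neq xx' => /rcons_inj [].
Qed.

(** The cells refining one crossing are distinct, and those of different crossings extend different
    words. That a path crosses each cell at most once is what separates the cells in
    [cross_zero]. *)
Lemma refine_uniq L : all (valid n (Tr n f)) L -> uniq (map word L) ->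
  uniq (map word (refine f L)).
Proof.
elim: L => [//|x L IH] /= /andP[hx hL] /andP[hn /(IH hL) hu].
rewrite refine_cons map_cat cat_uniq hu andbT; apply/andP; split.
  case/and3P: hx => _ ab _; have [t1 t2 t3 t4] := thirdP ab.
  have rn i j : (rcons x.1.1 i == rcons x.1.1 j) = (i == j).
    by apply/eqP/eqP => [/rcons_inj []|->].
  rewrite /ref /ref1; case: ifP => _ /=; rewrite !inE /word /= !rn ?negb_or //.
    by rewrite ab.
  by rewrite t3 ab t2.
apply/hasPn => w /mapP [y hy ->]; apply: contra hn => /mapP [z hz e].
have [i ei] := word_ref hz; case/flattenP: hy => s /mapP [x' hx' ->] hy.
have [j ej] := word_ref hy; move: e; rewrite ei ej => /rcons_inj [<- _].
exact: map_f.
Qed.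

End Refine.

(* The crossings of level [j + n] traversed by the path of [f] that joins the
   two ends of the crossing [x] of level [n]. *)
Fixpoint lin (n : nat) (x : crossing) (j : nat) (f : rel Point) : seq crossing :=
  if j is j'.+1 then refine f (lin n x j' (Tr (j' + n) f))
  else if valid n f x then [:: x] else [::].

Lemma lin_spec n x j f : Defs.isSub (j + n) f ->
  [/\ all (valid (j + n) f) (lin n x j f), switching (lin n x j f) &
      uniq (map word (lin n x j f))].
Proof.
elim: j f => [|j IH] f hf; first by rewrite /=; case: ifP => //= ->.
have [h1 h2 h3] := IH _ (isSub_Tr hf).
split; [exact: (refine_valid hf h1)|exact: (refine_switching hf h1 h2)|].
exact: (refine_uniq h1 h3).
Qed.

Lemma size_refine f L : (2 * size L <= size (refine f L))%N.
Proof.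
elim: L => [//|x L IH]; rewrite refine_cons size_cat /=.
have := size_ref f x; lia.
Qed.

Lemma size_lin n x j f : lin n x j f = [::] \/ (2 ^ j <= size (lin n x j f))%N.
Proof.
elim: j f => [|j IH] f /=; first by case: ifP; [right|left].
case: (IH (Tr (j + n) f)) => [->|h]; first by left.
right; rewrite expnS; apply: leq_trans (size_refine _ _).
by rewrite leq_mul2l h orbT.
Qed.

Definition linL n L j f : seq crossing := flatten (map (fun x => lin n x j f) L).

Lemma linL_S n L j f : linL n L j.+1 f = refine f (linL n L j (Tr (j + n) f)).
Proof.
by elim: L => [//|x L IH]; rewrite /linL /= refine_cat -/(linL _ _ _ _) -IH.
Qed.

Section Consistent.
Variable t : nat -> rel Point.
Hypothesis tST : forall m, isST m (t m).
Hypothesis tTr : forall m, Tr m (t m.+1) = t m.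

Lemma linL_spec n L p q : all (valid n (t n)) L -> switching L -> chain p L q ->
  forall j, let L' := linL n L j (t (j + n)) in
  [/\ all (valid (j + n) (t (j + n))) L', switching L' & chain p L' q].
Proof.
move=> hv ha hc; elim=> [|j IH] /=.
  suff -> : linL n L 0 (t (0 + n)) = L by [].
  elim: L hv {ha hc} => [//|x L IH] /= /andP[hx /IH {}IH].
  by rewrite /linL /= add0n hx /= -[in RHS]IH.
have hs : Defs.isSub (j + n).+1 (t (j.+1 + n)) := (tST (j.+1 + n)).1.
have eT : Tr (j + n) (t (j.+1 + n)) = t (j + n) by rewrite addSn tTr.
case: IH => h1 h2 h3; rewrite linL_S eT; split.
- by apply: (refine_valid hs); rewrite eT.
- by apply: (refine_switching hs) => //; rewrite eT.
- by apply: (refine_chain hs) => //; rewrite eT.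
Qed.

Lemma dist_linL n L p q j : all (valid n (t n)) L -> switching L -> chain p L q ->
  dist (t (j + n)) p q =
  (\sum_(x <- L) \sum_(y <- lin n x j (t (j + n))) xlen (t (j + n)) y)%N.
Proof.
move=> hv ha hc; have [h1 h2 h3] := linL_spec hv ha hc j.
rewrite (dist_chain (tST _) h1 h3 h2) /linL.
by rewrite big_flatten /= big_map.
Qed.

End Consistent.

(** * Moments of the path weights *)

Section Weights.
Variable R : realFieldType.
Implicit Types (h : nat -> R).

Definition xtyp f (x : crossing) : nat := typ (st f x.1.1) x.1.2 x.2.

Definition wsum h f L : R := \sum_(x <- L) h (xtyp f x).

Definition W h n x j f : R := wsum h f (lin n x j f).

(* [h] is a right eigenvector of the mean offspring matrix for [l]. *)
Definition eigenvec h (l : R) : Prop :=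
  [/\ 18 * h 0%N + 9 * h 1%N + 9 * h 2%N = 18 * (l * h 0%N),
      24 * h 0%N + 12 * h 1%N + 18 * h 2%N = 18 * (l * h 1%N) &
      24 * h 0%N + 12 * h 1%N + 30 * h 2%N = 30 * (l * h 2%N)].

Definition devn h l (g : cell1) a b : R :=
  \sum_(k <- rtyps g a b) h k - l * h (typ (trG g) a b).

Lemma typ_lt q a b : (typ q a b < 3)%N.
Proof. by rewrite /typ; case: ifP => //; case: ifP. Qed.

Lemma sum_types h (r : seq nat) : all (fun k => (k < 3)%N) r ->
  \sum_(k <- r) h k = (count_mem 0%N r)%:R * h 0%N +
    (count_mem 1%N r)%:R * h 1%N + (count_mem 2%N r)%:R * h 2%N.
Proof.
elim: r => [|k r IH] /=; first by rewrite big_nil !mul0r !addr0.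
case/andP => hk /IH {}IH; rewrite big_cons IH !natrD.
by case: k hk => [|[|[|]]] //= _; ring.
Qed.

Lemma perm_fibt (F : cell1 -> R) q :
  \sum_(g | trG g == q) F g = \sum_(g <- fibt tab q) F g.
Proof.
rewrite fibtE /fib big_filter; apply: perm_big; apply: uniq_perm.
- exact: index_enum_uniq.
- exact: uniq_all_cell1.
by move=> g; rewrite mem_index_enum mem_all_cell1.
Qed.

(** [check_means] supplies the total offspring over the fibre, and for each type the claim is one of
    the three equations of [eigenvec], which are already multiplied by the fibre sizes 18 and 30. *)
Lemma devn_mean h l q a b : eigenvec h l -> q != (true, true, true) ->
  a != b -> ccon q a b -> \sum_(g | trG g == q) devn h l g a b = 0.
Proof.
move=> [e1 e2 e3] hq ab hc; have := check_means_tab; rewrite /check_means.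
move=> /allP/(_ q (mem_all_cst q)); rewrite hq => /allP/(_ a (mem_L3 a)).
move=> /allP/(_ b (mem_L3 b)); rewrite ab hc /= => /eqP.
rewrite perm_fibt; have hF g : g \in fibt tab q -> trG g = q.
  by rewrite mem_fibt => /eqP.
move: (fibt tab q) hF => F hF; set r := flatten _ => hr.
have -> : \sum_(g <- F) devn h l g a b =
    \sum_(k <- r) h k - (size F)%:R * (l * h (typ q a b)).
  rewrite /r; clear r hr; elim: F hF => [|g F IH] hF.
    by rewrite !big_nil mul0r subr0.
  rewrite big_cons IH => [|g' hg']; last by apply: hF; rewrite inE hg' orbT.
  rewrite map_cons /= big_cat /= /devn hF ?inE ?eqxx //.
  by rewrite -[(size F).+1]addn1 natrD; ring.
have hall : all (fun k => (k < 3)%N) r.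
  by apply/allP => k /flattenP [s /mapP [g _ ->]] /mapP [y _ ->]; exact: typ_lt.
rewrite sum_types //; move: hr (typ_lt q a b).
case: (typ q a b) => [|[|[|]]] //= [-> -> -> ->] _; rewrite ?e1 ?e2 ?e3 subrr //.
Qed.

End Weights.

(** * Finite encoding of subgraphs and resampling of one cell *)

Definition conf n := {ffun n.-tuple 'I_3 -> cstate}.

Definition relc n (c : conf n) : rel Point := fun X Y =>
  [exists v : n.-tuple 'I_3, exists a, exists b,
    [&& X == psiw v (uu a), Y == psiw v (uu b) & cedge (c v) a b]].

Definition confof n (f : rel Point) : conf n := [ffun v : n.-tuple 'I_3 => st f v].

Lemma relcP n (c : conf n) X Y : relc c X Y <-> exists (v : n.-tuple 'I_3) a b,
  [/\ X = psiw v (uu a), Y = psiw v (uu b) & cedge (c v) a b].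
Proof.
split=> [/existsP [v /existsP [a /existsP [b /and3P[/eqP -> /eqP -> h]]]]|].
  by exists v, a, b.
case=> v [a [b [-> -> h]]]; apply/existsP; exists v; apply/existsP; exists a.
by apply/existsP; exists b; rewrite !eqxx.
Qed.

Lemma isSub_relc n (c : conf n) : Defs.isSub n (relc c).
Proof.
split=> [X Y|X Y /relcP [v [a [b [-> -> /andP[ab _]]]]]].
  by apply/idP/idP => /relcP [v [a [b [-> -> h]]]]; apply/relcP; exists v, b, a;
    rewrite cedge_sym.
by apply/adjGP; exists v, a, b; rewrite size_tuple.
Qed.

Lemma st_relc n (c : conf n) (v : n.-tuple 'I_3) : st (relc c) v = c v.
Proof.
have hs := isSub_relc c; apply: cstateP => a b.
rewrite -st_edge; [|exact: hs.1|exact: isSub_irr hs].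
apply/idP/idP => [/relcP [w [a' [b' [ea eb h]]]]|h]; last first.
  by apply/relcP; exists v, a, b.
have ab : a' != b' by case/andP: h.
have e : w = v.
  by apply/val_inj/(psiw_edge _ ab (esym ea) (esym eb)); rewrite !size_tuple.
by subst w; rewrite (uu_inj (psiw_inj ea)) (uu_inj (psiw_inj eb)).
Qed.

Lemma confofK n f : Defs.isSub n f -> relc (confof n f) = f.
Proof.
move=> hf; apply: (@sub_ext n) => // [|v hv]; first exact: isSub_relc.
have ev : v = Tuple (introT eqP hv) by [].
by rewrite ev st_relc ffunE.
Qed.

Lemma relcK n : cancel (@relc n) (confof n).
Proof. by move=> c; apply/ffunP => v; rewrite ffunE st_relc. Qed.

Definition stc n (c : conf n) : bool := `[< isST n (relc c) >].

Section Sums.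
Variable R : realFieldType.

(** Up to normalisation, the expectation under the uniform law on the spanning trees. *)
Definition sumST n (phi : rel Point -> R) : R := \sum_(c : conf n | stc c) phi (relc c).

Lemma sumST_ge0 n phi : (forall f, isST n f -> 0 <= phi f) -> 0 <= sumST n phi.
Proof. by move=> h; apply: sumr_ge0 => c /asboolP; exact: h. Qed.

Lemma le_sumST n phi phi' : (forall f, isST n f -> phi f <= phi' f) ->
  sumST n phi <= sumST n phi'.
Proof. by move=> h; apply: ler_sum => c /asboolP; exact: h. Qed.

Lemma eq_sumST n phi phi' : (forall f, isST n f -> phi f = phi' f) ->
  sumST n phi = sumST n phi'.
Proof. by move=> h; apply: eq_bigr => c /asboolP; exact: h. Qed.

Lemma sumST_sum n (I : Type) (r : seq I) (F : I -> rel Point -> R) :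
  sumST n (fun f => \sum_(i <- r) F i f) = \sum_(i <- r) sumST n (F i).
Proof. by rewrite /sumST exchange_big. Qed.

Lemma sumSTZ n a phi : sumST n (fun f => a * phi f) = a * sumST n phi.
Proof. by rewrite /sumST mulr_sumr. Qed.

(* Resampling one cell: the pairs (f, g) with [g] in the fibre of the cell [v] of
   [f] are permuted by exchanging [g] with that cell. *)
Lemma swap_sum n (v : seq 'I_3) (Psi : rel Point -> R) (e : cell1 -> R) :
  size v = n ->
  (forall f g, isST n.+1 f -> trG g = trG (gst f v) -> trG g != cst0 ->
    Psi (repl f v g) = Psi f) ->
  (forall f, isST n.+1 f -> Psi f != 0 -> trG (gst f v) != cst0 /\
    \sum_(g | trG g == trG (gst f v)) e g = 0) ->
  sumST n.+1 (fun f => Psi f * e (gst f v)) = 0.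
Proof.
move=> hv hinv hPsi.
pose N f : R := #|[pred g | trG g == trG (gst f v)]|%:R.
have N0 f : N f != 0.
  by rewrite pnatr_eq0 -lt0n; apply/card_gt0P; exists (gst f v); rewrite inE.
pose Q (c : conf n.+1) (g : cell1) :=
  (trG g == trG (gst (relc c) v)) && (trG g != cst0).
pose F (c : conf n.+1) (g : cell1) : R := Psi (relc c) / N (relc c) * e (gst (relc c) v).
have E1 : sumST n.+1 (fun f => Psi f * e (gst f v)) =
    \sum_(c | stc c) \sum_(g | Q c g) F c g.
  apply: eq_bigr => c /asboolP hc; set f := relc c in hc *.
  have [hP|hP] := eqVneq (Psi f) 0.
    by rewrite hP mul0r big1 // => g _; rewrite /F -/f hP !mul0r.
  have [h0 _] := hPsi f hc hP.
  rewrite (eq_bigl [pred g | trG g == trG (gst f v)]); last first.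
    by move=> g; rewrite /Q -/f inE; case: eqP => // ->.
  rewrite sumr_const /F -/f -mulr_natl -/(N f).
  by field; exact: N0.
rewrite E1 pair_big_dep /=.
pose sw (p : conf n.+1 * cell1) : conf n.+1 * cell1 :=
  (confof n.+1 (repl (relc p.1) v p.2), gst (relc p.1) v).
pose P (p : conf n.+1 * cell1) := stc p.1 && Q p.1 p.2.
have relsw p : relc (sw p).1 = repl (relc p.1) v p.2.
  by rewrite confofK //; apply: isSub_repl => //; exact: isSub_relc.
have gsw p : gst (relc (sw p).1) v = p.2.
  by rewrite relsw (gst_repl hv (isSub_relc _)) // eqxx.
have swK : involutive sw.
  move=> p; rewrite -[LHS]/(confof n.+1 (repl (relc (sw p).1) v (sw p).2),
    gst (relc (sw p).1) v) gsw relsw.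
  rewrite -[(sw p).2]/(gst (relc p.1) v) (repl_repl _ hv (isSub_relc p.1)).
  by rewrite relcK -surjective_pairing.
have swP p : P p -> P (sw p).
  case/andP => /asboolP hc /andP[/eqP hq h0]; apply/andP; split.
    by apply/asboolP; rewrite relsw; exact: isST_repl.
  by rewrite /Q gsw hq eqxx /= -hq.
(* Each term has been spread evenly over its fibre, of size [N]. After the exchange [Psi] and [N]
   are unchanged while [e] is evaluated at the replacement, over which it sums to 0. *)
rewrite (reindex_onto sw sw) /=; last by move=> p _; exact: swK.
rewrite (eq_bigl P); last first.
  move=> p; rewrite swK eqxx andbT -[LHS]/(P (sw p)).
  by apply/idP/idP => [h|]; [rewrite -(swK p); exact: (swP (sw p) h)|exact: (swP p)].
rewrite /P -(pair_big_dep (@stc n.+1) Q (fun c g => F (sw (c, g)).1 (sw (c, g)).2)) /=.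
apply: big1 => c /asboolP hc; set f := relc c in hc *.
have [hP|hP] := eqVneq (Psi f) 0.
  apply: big1 => g /andP[/eqP hq h0]; rewrite /F -[confof _ _]/((sw (c, g)).1) relsw.
  by rewrite hinv // hP !mul0r.
have [h0 h1] := hPsi f hc hP.
rewrite (eq_bigr (fun g => Psi f / N f * e g)) => [|g /andP[/eqP hq hg]].
  rewrite -mulr_sumr (eq_bigl [pred g | trG g == trG (gst f v)]) ?h1 ?mulr0 //.
  by move=> g; rewrite /Q -/f inE; case: eqP => // ->.
rewrite /F -[confof _ _]/((sw (c, g)).1) gsw relsw hinv //; congr (_ / _ * _).
rewrite /N; congr (_%:R); apply: eq_card => g'; rewrite !inE.
by rewrite (gst_repl hv (isSub_relc _)) // eqxx hq.
Qed.

End Sums.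

Definition crossing_of m (x : m.-tuple 'I_3 * 'I_3 * 'I_3) : crossing :=
  (tval x.1.1, x.1.2, x.2).

Lemma crossing_of_inj m : injective (@crossing_of m).
Proof. by move=> [[v a] b] [[v' a'] b'] [/val_inj -> -> ->]. Qed.

Lemma big_crossing (R : realFieldType) m (L : seq crossing) (F : crossing -> R) :
  all (fun x => size x.1.1 == m) L -> uniq L ->
  \sum_(x <- L) F x = \sum_(x : m.-tuple 'I_3 * 'I_3 * 'I_3)
    (crossing_of x \in L)%:R * F (crossing_of x).
Proof.
move=> hs hu.
rewrite (eq_bigr (fun x => if crossing_of x \in L then F (crossing_of x) else 0));
  last by move=> x _; case: ifP => _; rewrite ?mul1r ?mul0r.
rewrite -big_mkcond /=.
transitivity (\sum_(x <- map (@crossing_of m)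
    [seq x <- index_enum _ | crossing_of x \in L]) F x); last by rewrite big_map big_filter.
apply: perm_big; apply: uniq_perm => //.
  rewrite map_inj_uniq; last exact: crossing_of_inj.
  by rewrite filter_uniq // index_enum_uniq.
move=> x; apply/idP/mapP => [hx|[y]]; last by rewrite mem_filter => /andP[h _] ->.
have hv : size x.1.1 == m := allP hs x hx.
exists (Tuple hv, x.1.2, x.2); last by case: x {hx} hv => [[]].
by rewrite mem_filter mem_index_enum andbT; case: x hx hv => [[]].
Qed.

Lemma ccon_cst0 a b : ccon cst0 a b = (a == b).
Proof. by case: (I3P a) => ->; case: (I3P b) => ->. Qed.

Section Moments.
Variables (R : realFieldType) (n : nat) (x0 : crossing) (j : nat).
Variables (h : nat -> R) (l B : R).
Hypothesis hl : eigenvec h l.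
Hypothesis hB : forall k, (k < 3)%N -> `|h k| <= B.
Let m := (j + n)%N.
Let L f := lin n x0 j (Tr m f).
Let Xm := (m.-tuple 'I_3 * 'I_3 * 'I_3)%type.
Let G f (x : Xm) : R :=
  (crossing_of x \in L f)%:R * devn h l (gst f x.1.1) x.1.2 x.2.

Lemma xtyp_ref f w i a b : xtyp f (rcons w i, a, b) = typ (gi (gst f w) i) a b.
Proof. by rewrite /xtyp gi_gst. Qed.

Lemma L_spec f : Defs.isSub m.+1 f ->
  all (fun x => size x.1.1 == m) (L f) /\ uniq (map word (L f)).
Proof.
move=> hf; have [h1 _ h2] := lin_spec x0 (isSub_Tr hf).
by split=> //; apply: sub_all h1 => x /and3P[].
Qed.

Lemma W_increment f : Defs.isSub m.+1 f ->
  W h n x0 j.+1 f - l * W h n x0 j (Tr m f) = \sum_(x : Xm) G f x.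
Proof.
move=> hf; have [h1 h2] := L_spec hf.
rewrite -(big_crossing (fun x => devn h l (gst f x.1.1) x.1.2 x.2) h1 (map_uniq h2)).
rewrite /W /= -/(L f) /wsum /refine big_flatten big_map mulr_sumr -sumrB.
rewrite !big_seq; apply: eq_bigr => x hx; congr (_ - _).
  rewrite /ref big_map /rtyps big_map; apply: eq_bigr => y _; congr h.
  exact: xtyp_ref.
by rewrite /xtyp st_Tr //; apply/eqP; exact: (allP h1).
Qed.

Lemma L_con f (x : Xm) : isST m.+1 f -> crossing_of x \in L f ->
  [/\ x.1.2 != x.2, ccon (trG (gst f x.1.1)) x.1.2 x.2 & trG (gst f x.1.1) != cst0].
Proof.
move=> hT hx; have [h1 _ _] := lin_spec x0 (isSub_Tr hT.1).
have /and3P[hs ab] := allP h1 _ hx; rewrite st_Tr ?size_tuple //; last exact: hT.1.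
move=> hc; split=> //; apply: contraTneq hc => /= ->.
by rewrite ccon_cst0.
Qed.

(** The crossings [L f] depend on [Tr m f] alone and survive every replacement within a fibre; a
    crossed cell has nonempty trace, so [swap_sum] applies. *)
Lemma mean_zero (Psi : rel Point -> R) (x : Xm) :
  (forall f g, isST m.+1 f -> crossing_of x \in L f ->
    trG g = trG (gst f x.1.1) -> Psi (repl f x.1.1 g) = Psi f) ->
  sumST m.+1 (fun f => Psi f * G f x) = 0.
Proof.
move=> hP; rewrite /G (eq_sumST (phi' := fun f =>
  (Psi f * (crossing_of x \in L f)%:R) * devn h l (gst f x.1.1) x.1.2 x.2)); last first.
  by move=> f _; rewrite mulrA.
have hv : size x.1.1 = m by rewrite size_tuple.
apply: (swap_sum (Psi := fun f => Psi f * (crossing_of x \in L f)%:R)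
  (e := fun g => devn h l g x.1.2 x.2) hv) => [f g hf hg h0|f hf].
  rewrite /L Tr_repl //; last exact: hf.1.
  by case: (boolP (crossing_of x \in _)) => hx; rewrite ?mulr0 // hP.
case: (boolP (crossing_of x \in L f)) => hx; last by rewrite mulr0 eqxx.
have [h1 h2 h3] := L_con hf hx; split=> //.
by apply: devn_mean => //; exact: trG_full.
Qed.

Lemma first_moment (phi : rel Point -> R) :
  sumST m.+1 (fun f => phi (Tr m f) *
    (W h n x0 j.+1 f - l * W h n x0 j (Tr m f))) = 0.
Proof.
rewrite (eq_sumST (phi' := fun f => \sum_(x : Xm) phi (Tr m f) * G f x)); last first.
  by move=> f hf; rewrite W_increment ?mulr_sumr //; exact: hf.1.
rewrite sumST_sum big1 // => x _; apply: (mean_zero (Psi := fun f => phi (Tr m f))).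
by move=> f g hf _ hg; rewrite Tr_repl ?size_tuple //; exact: hf.1.
Qed.

(** Two crossings of one path lie in different cells, so the deviation at [y] is untouched when the
    cell of [x] is resampled and can be absorbed into the invariant factor of [mean_zero]. *)
Lemma cross_zero (phi : rel Point -> R) (x y : Xm) : y != x ->
  sumST m.+1 (fun f => phi (Tr m f) * (G f y * G f x)) = 0.
Proof.
move=> xy; rewrite (eq_sumST (phi' := fun f => (phi (Tr m f) * G f y) * G f x)); last first.
  by move=> f _; rewrite mulrA.
apply: (mean_zero (Psi := fun f => phi (Tr m f) * G f y)) => f g hf hx hg.
have hv (z : Xm) : size z.1.1 = m by rewrite size_tuple.
rewrite /G /L Tr_repl ?(hv x) //; last exact: hf.1.
rewrite (gst_repl (hv x) hf.1) //.
case: (boolP (crossing_of y \in _)) => hy; last by rewrite !mul0r.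
case: eqP => // e; case/eqP: xy; apply: (@crossing_of_inj m).
have [_ hu] := L_spec hf.1.
move: hx hy hu; rewrite -/(L f); move: (L f) => s hx hy hu.
have hi : {in s &, injective word}.
  elim: s hu {hx hy} => [//|z s IH] /= /andP[hz hu] a b.
  rewrite !inE => /orP[/eqP ->|ha] /orP[/eqP ->|hb] // he.
  - by case/negP: hz; rewrite he map_f.
  - by case/negP: hz; rewrite -he map_f.
  - exact: IH.
exact: hi.
Qed.

Lemma devn_bound g a b : `|devn h l g a b| <= (3 + `|l|) * B.
Proof.
have hB0 : 0 <= B by apply: le_trans (hB (isT : 0 < 3)%N).
rewrite /devn mulrDl; apply: le_trans (ler_normB _ _) _; apply: lerD.
  apply: le_trans (ler_norm_sum _ _ _) _.
  have : (size (rtyps g a b) <= 3)%N.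
    by rewrite /rtyps size_map /ref1; case: ifP.
  have : all (fun k => (k < 3)%N) (rtyps g a b).
    by apply/allP => k /mapP [y _ ->]; exact: typ_lt.
  move: (rtyps g a b) => r hr hs.
  apply: (@le_trans _ _ ((size r)%:R * B)); last first.
    by rewrite ler_wpM2r // ler_nat.
  elim: r hr {hs} => [|k r IH] /=; first by rewrite big_nil mul0r.
  case/andP => hk /IH {}IH; rewrite big_cons -addn1 natrD mulrDl mul1r addrC.
  by apply: lerD => //; exact: hB.
by rewrite normrM ler_wpM2l //; apply: hB; exact: typ_lt.
Qed.

(** Only the diagonal survives, and each crossing has at most three offspring. The weight [phi] of
    the coarser tree serves both estimates: 1 for absolute increments, a multiple of $W^{-2}$ for
    relative ones. *)
Lemma second_moment (phi : rel Point -> R) : (forall f, 0 <= phi f) ->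
  sumST m.+1 (fun f => phi (Tr m f) *
    (W h n x0 j.+1 f - l * W h n x0 j (Tr m f)) ^+ 2) <=
  ((3 + `|l|) * B) ^+ 2 * sumST m.+1 (fun f => phi (Tr m f) * (size (L f))%:R).
Proof.
move=> hphi; set K := (_ * B) ^+ 2.
rewrite (eq_sumST (phi' := fun f => \sum_(x : Xm) \sum_(y : Xm)
    phi (Tr m f) * (G f y * G f x))); last first.
  move=> f hf; rewrite W_increment; last exact: hf.1.
  rewrite expr2 big_distrlr /= exchange_big /= mulr_sumr; apply: eq_bigr => x _.
  by rewrite mulr_sumr; apply: eq_bigr => y _; congr (_ * _); rewrite mulrC.
rewrite sumST_sum.
rewrite (eq_bigr (fun x => sumST m.+1 (fun f => phi (Tr m f) * (G f x * G f x))));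
  last first.
  move=> x _; rewrite sumST_sum (bigD1 x) //= big1 ?addr0 // => y yx.
  exact: cross_zero.
rewrite -sumST_sum -sumSTZ; apply: le_sumST => f hf.
rewrite -mulr_sumr mulrCA ler_wpM2l //.
have [h1 h2] := L_spec hf.1.
have -> : (size (L f))%:R = \sum_(x <- L f) (1 : R).
  by rewrite big_const_seq count_predT iter_addr addr0.
rewrite (big_crossing (fun=> 1) h1 (map_uniq h2)) mulr_sumr; apply: ler_sum => x _.
rewrite mulr1 /G; case: (_ \in _); rewrite ?mul1r ?mul0r ?mulr0 // mulr1.
rewrite -expr2 -real_normK ?num_real // lerXn2r ?nnegrE ?devn_bound //.
exact: le_trans (devn_bound (gst f x.1.1) i0 i0).
Qed.

End Moments.

Section Constants.
Variable R : realType.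

Definition al : R := @alphabar R.
(* The second root of x^2 - 8/3 x + 13/15, the nonzero part of the characteristic
   polynomial of the mean matrix; the third eigenvalue is 0. *)
Definition be : R := 8 / 3 - al.

(** Written as a function of [l] so that both nonzero eigenvalues are treated at once; for [al] all
    entries are at least 1, hence the weight bounds the number of cells. *)
Definition hv (l : R) (k : nat) : R :=
  match k with 0%N => l / 2 + 1 / 6 | 1%N => l - 1 / 3 | _ => l - 13 / 15 end.

Definition h0 (k : nat) : R := match k with 0%N => 1 | 1%N => -2 | _ => 0 end.

(** The lower bound is tight because [bad1_threshold] needs
    $\frac{16}{25}\bar\alpha^2\ge\frac{10}3$; the upper one keeps $\bar\alpha$ well below 3, the
    growth rate of the number of cells. *)
Lemma al_bounds : 16 / 7 <= al <= 23 / 10.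
Proof.
have h : 0 <= Num.sqrt (205 : R) := sqrtr_ge0 _.
have e : Num.sqrt (205 : R) * Num.sqrt 205 = 205 by rewrite -expr2 sqr_sqrtr.
rewrite /al /alphabar; apply/andP; split; nra.
Qed.

Lemma al_sq : al ^+ 2 = 8 / 3 * al - 13 / 15.
Proof.
have e : Num.sqrt (205 : R) * Num.sqrt 205 = 205 by rewrite -expr2 sqr_sqrtr.
rewrite /al /alphabar; move: (Num.sqrt (205 : R)) e => s e; rewrite expr2.
nra.
Qed.

Lemma be_sq : be ^+ 2 = 8 / 3 * be - 13 / 15.
Proof. by have := al_sq; rewrite /be !expr2; nra. Qed.

Lemma eigenvec_hv l : l ^+ 2 = 8 / 3 * l - 13 / 15 -> eigenvec (hv l) l.
Proof. by rewrite expr2 => e; split; rewrite /hv; nra. Qed.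

Lemma eigenvec_h0 : eigenvec h0 0.
Proof. by split; rewrite /h0; ring. Qed.

Definition eig (k : 'I_3) : (nat -> R) * R :=
  match val k with 0%N => (hv al, al) | 1%N => (hv be, be) | _ => (h0, 0) end.

Lemma eigP k : [/\ eigenvec (eig k).1 (eig k).2, `|(eig k).2| <= 3 &
  forall i, (i < 3)%N -> `|(eig k).1 i| <= 3].
Proof.
have /andP[a1 a2] := al_bounds.
case: (I3P k) => ->; rewrite /eig /=; split.
- by apply: eigenvec_hv; exact: al_sq.
- by rewrite ler_norml; apply/andP; split; lra.
- by case=> [|[|[|]]] // _; rewrite /hv ler_norml; apply/andP; split; lra.
- by apply: eigenvec_hv; exact: be_sq.
- by rewrite /be ler_norml; apply/andP; split; lra.
- by case=> [|[|[|]]] // _; rewrite /hv /be ler_norml; apply/andP; split; lra.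
- exact: eigenvec_h0.
- by rewrite normr0.
- by case=> [|[|[|]]] // _; rewrite /h0 ler_norml; apply/andP; split; lra.
Qed.

Lemma hv_al_ge1 k : 1 <= hv al k.
Proof.
have /andP[a1 a2] := al_bounds.
by case: k => [|[|k]]; rewrite /hv; lra.
Qed.

Lemma size_le_W n x j f : (size (lin n x j f))%:R <= W (hv al) n x j f.
Proof.
rewrite /W /wsum; elim: (lin n x j f) => [|y s IH]; first by rewrite big_nil.
by rewrite big_cons /= -add1n natrD lerD // hv_al_ge1.
Qed.

End Constants.

(** * Almost sure bounds *)

Section Probability.
Context {d : measure_display} {Omega : measurableType d} {R : realType}.
Variables (P : probability Omega R) (T : nat -> Omega -> rel Point).
Hypothesis hST : forall n w, isST n (T n w).
Hypothesis hmeas : forall n t, measurable [set w | T n w = t].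
Hypothesis hunif : forall n t1 t2, isST n t1 -> isST n t2 ->
     P [set w | T n w = t1] = P [set w | T n w = t2].
Hypothesis hcons : forall n w, Tr n (T n.+1 w) = T n w.

Definition pn n : R :=
  if [pick c : conf n | stc c] is Some c then fine (P [set w | T n w = relc c]) else 0.

(** The expectation of $\phi(T_n)$ as a finite sum; [prob_event] ties it to [P]. *)
Definition Ex n (phi : rel Point -> R) : R := pn n * sumST n phi.

Lemma event_cover n (E : rel Point -> Prop) :
  [set w | E (T n w)] = \bigcup_(c in [set c : conf n | E (relc c)]) [set w | T n w = relc c].
Proof.
apply/seteqP; split=> [w /= h|w [c /= hc ->] //].
exists (confof n (T n w)); rewrite /= confofK //; exact: (hST n w).1.
Qed.

Lemma measurable_event n (E : rel Point -> Prop) : measurable [set w | E (T n w)].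
Proof.
rewrite event_cover; apply: fin_bigcup_measurable; first exact: finite_finset.
by move=> c _; exact: hmeas.
Qed.

Lemma P_relc n (c : conf n) :
  P [set w | T n w = relc c] = (if stc c then pn n else 0)%:E.
Proof.
case: ifP => [/asboolP hc|/asboolP hc].
  rewrite /pn; case: pickP => [c' /asboolP hc'|/(_ c) /asboolP //].
  rewrite fineK; last exact: fin_num_measure.
  exact: hunif.
rewrite (_ : [set _ | _] = set0) ?measure0 //.
by apply/seteqP; split=> // w /= e; apply: hc; rewrite -e.
Qed.

Lemma prob_event n (E : rel Point -> Prop) :
  P [set w | E (T n w)] = (Ex n (fun f => (`[< E f >] : nat)%:R))%:E.
Proof.
rewrite event_cover measure_fin_bigcup; last 3 first.
- exact: finite_finset.
- move=> c c' _ _ [w [/= e e']]; apply: (can_inj (@relcK n)).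
  by rewrite -e -e'.
- by move=> c _; exact: hmeas.
pose r : seq (conf n) := index_enum _.
pose A (c : conf n) := `[< E (relc c) >].
have -> : [set c | E (relc c)] = [set` A].
  by apply/seteqP; split=> c /= /asboolP.
rewrite -(@bigfs _ _ _ _ r A); last 2 first.
- exact: index_enum_uniq.
- by move=> c _; rewrite mem_index_enum.
rewrite (eq_bigr (fun c => (if stc c then pn n else 0)%:E)); last first.
  by move=> c _; exact: P_relc.
rewrite sumEFin; congr (_%:E); rewrite /Ex /sumST mulr_sumr.
rewrite -big_mkcondr /= [RHS](bigID A) /= [X in _ + X]big1 ?addr0; last first.
  by move=> c /andP[_ /negbTE h]; rewrite -/(A c) h mulr0.
apply: eq_big => [c|c /andP[h _]]; first by rewrite andbC.
by rewrite -/(A c) h mulr1.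
Qed.

Lemma pn_ge0 n : 0 <= pn n.
Proof. by rewrite /pn; case: pickP => // c _; exact: fine_ge0. Qed.

Lemma le_Ex n phi phi' : (forall f, isST n f -> phi f <= phi' f) ->
  Ex n phi <= Ex n phi'.
Proof. by move=> h; rewrite ler_wpM2l ?pn_ge0 //; exact: le_sumST. Qed.

Lemma eq_Ex n phi phi' : (forall f, isST n f -> phi f = phi' f) ->
  Ex n phi = Ex n phi'.
Proof. by move=> h; rewrite /Ex (eq_sumST h). Qed.

Lemma ExZ n a phi : Ex n (fun f => a * phi f) = a * Ex n phi.
Proof. by rewrite /Ex sumSTZ mulrCA. Qed.

Lemma ExD n phi psi : Ex n (fun f => phi f + psi f) = Ex n phi + Ex n psi.
Proof. by rewrite /Ex /sumST big_split mulrDr. Qed.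

Lemma Ex_sum n (I : Type) (r : seq I) (F : I -> rel Point -> R) :
  Ex n (fun f => \sum_(i <- r) F i f) = \sum_(i <- r) Ex n (F i).
Proof. by rewrite /Ex sumST_sum mulr_sumr. Qed.

Lemma Ex_one n : Ex n (fun=> 1) = 1.
Proof.
have := prob_event n xpredT; rewrite (_ : [set _ | _] = setT); last by apply/seteqP.
rewrite probability_setT => -[e]; rewrite [RHS]e; apply: eq_Ex => f _.
by rewrite asboolT.
Qed.

Lemma Ex_const n a : Ex n (fun=> a) = a.
Proof.
rewrite -[RHS]mulr1 -(Ex_one n) -ExZ; apply: eq_Ex => f _.
by rewrite mulr1.
Qed.

Lemma prob_le_Ex n (E : rel Point -> Prop) phi :
  (forall f, isST n f -> 0 <= phi f) -> (forall f, isST n f -> E f -> 1 <= phi f) ->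
  (P [set w | E (T n w)] <= (Ex n phi)%:E)%E.
Proof.
move=> h0 h1; rewrite prob_event lee_fin; apply: le_Ex => f hf.
by case: asboolP => [/(h1 f hf)|_]; [|exact: h0].
Qed.

(** By consistency $\mathrm{Tr}\,T_{n+1}=T_n$, so the uniform law on trees of $G_{n+1}$ is pushed to
    the uniform law on trees of $G_n$. *)
Lemma Ex_Tr n phi : Ex n.+1 (fun f => phi (Tr n f)) = Ex n phi.
Proof.
rewrite (eq_Ex (phi' := fun f => \sum_(c : conf n)
    phi (relc c) * (`[< Tr n f = relc c >] : nat)%:R)); last first.
  move=> f hf; rewrite (bigD1 (confof n (Tr n f))) //= confofK; last first.
    exact: (isSub_Tr hf.1).
  rewrite asboolT // mulr1 big1 ?addr0 // => c hc.
  case: asboolP => [e|_]; last by rewrite mulr0.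
  by move: hc; rewrite e relcK eqxx.
rewrite Ex_sum [RHS]/Ex /sumST [in RHS]big_mkcond [RHS]mulr_sumr.
apply: eq_bigr => c _; rewrite ExZ.
have := prob_event n.+1 (fun f => Tr n f = relc c).
rewrite (_ : [set w | Tr n (T n.+1 w) = relc c] = [set w | T n w = relc c]); last first.
  by apply/seteqP; split=> w /=; rewrite hcons.
rewrite P_relc => -[<-]; case: ifP => _; by rewrite ?mulr0 // mulrC.
Qed.

Lemma Ex_W k n x j : Ex (j + n) (W (eig R k).1 n x j) = (eig R k).2 ^+ j * Ex n (W (eig R k).1 n x 0).
Proof.
have [hl _ _] := eigP R k; elim: j => [|j IH]; first by rewrite expr0 mul1r.
have e := first_moment n x j hl (fun=> 1).
have {}e : Ex (j + n).+1 (fun f => W (eig R k).1 n x j.+1 f +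
    - (eig R k).2 * W (eig R k).1 n x j (Tr (j + n) f)) = 0.
  rewrite /Ex -[RHS](mulr0 (pn (j + n).+1)) -[in RHS]e; congr (_ * _).
  by apply: eq_sumST => f _; rewrite mul1r mulNr.
move: e; rewrite ExD ExZ (Ex_Tr (j + n) (W (eig R k).1 n x j)) mulNr IH => /subr0_eq ->.
by rewrite exprS mulrA.
Qed.

Lemma Ex_size n x j : Ex (j + n) (fun f => (size (lin n x j f))%:R) <= al R ^+ j * 3.
Proof.
apply: le_trans (le_Ex (fun f _ => size_le_W R n x j f)) _.
have /andP[a1 a2] := al_bounds R.
rewrite (Ex_W i0) /=; apply: ler_wpM2l; first by apply: exprn_ge0; lra.
rewrite -[leRHS](Ex_const n); apply: le_Ex => f _.
rewrite /W /wsum /=; case: ifP => _; last by rewrite big_nil.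
rewrite big_seq1; have [_ _ h] := eigP R i0.
exact: le_trans (ler_norm _) (h _ (typ_lt _ _ _)).
Qed.

(** The constant is $((3+3)\cdot3)^2$, from the bounds by 3 in [eigP]. *)
Lemma Ex_increment k n x j phi : (forall f, 0 <= phi f) ->
  Ex (j + n).+1 (fun f => phi (Tr (j + n) f) *
    (W (eig R k).1 n x j.+1 f - (eig R k).2 * W (eig R k).1 n x j (Tr (j + n) f)) ^+ 2)
  <= 324 * Ex (j + n) (fun f => phi f * (size (lin n x j f))%:R).
Proof.
move=> hphi; have [h1 h2 h3] := eigP R k.
rewrite -(Ex_Tr (j + n)) /Ex mulrCA ler_wpM2l ?pn_ge0 //.
apply: le_trans (second_moment n x j h1 h3 hphi) _.
apply: ler_wpM2r; first by apply: sumST_ge0 => f _; rewrite mulr_ge0.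
have : 0 <= `|(eig R k).2| by [].
move: h2; set a := `|_| => h2 a0; rewrite expr2; nra.
Qed.

End Probability.

Section Events.
Variable R : realType.

Definition incr (k : 'I_3) n x j f : R :=
  W (eig R k).1 n x j.+1 f - (eig R k).2 * W (eig R k).1 n x j (Tr (j + n) f).

(* The rate 4/5 suits Chebyshev's inequality in both cases: there are 9 3^n crossings
   of level n, and 3 < (4/5)^2 alpha^2, while 2 (4/5)^2 > 1 for the relative increments,
   as a path has at least 2^j cells after j refinements. *)
Definition bad1 m (f : rel Point) : Prop := exists n j (x : crossing) k,
  [/\ (j + n)%N = m, size x.1.1 = n &
      al R ^+ m.+1 * (4 / 5) ^+ m < `|incr k n x j f|].

Definition bad2 n j (f : rel Point) : Prop := exists x : crossing,
  size x.1.1 = n /\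
  (4 / 5) ^+ j * W (eig R i0).1 n x j (Tr (j + n) f) < `|incr i0 n x j f|.

(** The margin between 10/3 and 3 is what leaves the summable ratio 9/10 in [prob_bad1]. *)
Lemma bad1_threshold m : (10 / 3) ^+ m <= (al R ^+ m.+1 * (4 / 5) ^+ m) ^+ 2.
Proof.
have /andP[a1 a2] := al_bounds R.
have -> : (al R ^+ m.+1 * (4 / 5) ^+ m) ^+ 2 = al R ^+ 2 * (al R ^+ 2 * (16 / 25)) ^+ m.
  have e x : (x ^+ m) ^+ 2 = (x ^+ 2) ^+ m :> R by rewrite -!exprM mulnC.
  have h X Y : (al R * X * Y) ^+ 2 = al R ^+ 2 * (X ^+ 2 * Y ^+ 2) by ring.
  rewrite [al R ^+ m.+1]exprS h !e -[(_ ^+ 2) ^+ m * _]exprMn; congr (_ * (_ * _) ^+ m).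
  by rewrite expr2; lra.
apply: (@le_trans _ _ (1 * (al R ^+ 2 * (16 / 25)) ^+ m)).
  rewrite mul1r lerXn2r ?nnegrE; rewrite ?expr2; nra.
apply: ler_wpM2r; first by apply: exprn_ge0; rewrite expr2; nra.
by rewrite expr2; nra.
Qed.

Lemma incr_empty k n x j f : lin n x j (Tr (j + n) f) = [::] -> incr k n x j f = 0.
Proof. by move=> e; rewrite /incr /W /= e /wsum !big_nil mulr0 subr0. Qed.

End Events.

Lemma eq_le_num (R : numDomainType) (x y : R) : x = y -> x <= y.
Proof. by move=> ->. Qed.

Lemma sum_crossings (R : realFieldType) n (c : R) :
  \sum_(x : n.-tuple 'I_3 * 'I_3 * 'I_3) c = 9 * 3 ^+ n * c.
Proof.
rewrite big_const iter_addr addr0 !card_prod card_tuple !card_ord.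
by rewrite -[LHS]mulr_natl !natrM natrX; ring.
Qed.

Section BorelCantelli.
Context {d : measure_display} {Omega : measurableType d} {R : realType}.
Variable P : probability Omega R.

Lemma lim_sup_geometric (F : (set Omega)^nat) (C q : R) : 0 <= C -> 0 < q < 1 ->
  (forall m, measurable (F m)) -> (forall m, (P (F m) <= (C * q ^+ m)%:E)%E) ->
  P (lim_sup_set F) = 0%E.
Proof.
move=> C0 /andP[q0 q1] mF hF; apply: lim_sup_set_cvg0 => //.
apply: (@le_lt_trans _ _ (C * (1 - q)^-1)%:E); last exact: ltry.
apply: lime_le; first exact: is_cvg_nneseries.
apply: nearW => n /=.
apply: (@le_trans _ _ (\sum_(0 <= k < n) (C * q ^+ k)%:E)%E).
  by apply: lee_sum => k _; exact: hF.
rewrite sumEFin lee_fin; have := @geometric_le_lim R n C q C0 q0.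
by rewrite ger0_norm ?(ltW q0) // => /(_ q1).
Qed.

Variable T : nat -> Omega -> rel Point.
Hypothesis hST : forall n w, isST n (T n w).
Hypothesis hmeas : forall n t, measurable [set w | T n w = t].
Hypothesis hunif : forall n t1 t2, isST n t1 -> isST n t2 ->
     P [set w | T n w = t1] = P [set w | T n w = t2].
Hypothesis hcons : forall n w, Tr n (T n.+1 w) = T n w.


Lemma prob_bad1 m : (P [set w | bad1 R m (T m.+1 w)] <= ((27 * (324 * 3) * 5) * (9 / 10) ^+ m)%:E)%E.
Proof.
(* Chebyshev and the union bound in one function: on the bad event one of the terms is at least 1 by
   [bad1_threshold]. *)
pose phi f : R := \sum_(n < m.+1) \sum_(x : n.-tuple 'I_3 * 'I_3 * 'I_3)
  \sum_(k : 'I_3) (3 / 10) ^+ m * (incr R k n (crossing_of x) (m - n) f) ^+ 2.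
have term0 k n x j f : 0 <= (3 / 10) ^+ m * (incr R k n x j f) ^+ 2.
  by apply: mulr_ge0; [apply: exprn_ge0; lra|exact: sqr_ge0].
apply: le_trans (prob_le_Ex hST hmeas hunif (phi := phi) _ _) _.
- by move=> f _; do 3!(apply: sumr_ge0 => ? _); exact: term0.
- move=> f _ [n [j [x [k [e hx hlt]]]]].
  have hn : (n < m.+1)%N by rewrite -e ltnS leq_addl.
  have hj : (m - n)%N = j by rewrite -e addnK.
  pose y : n.-tuple 'I_3 * 'I_3 * 'I_3 := (Tuple (introT eqP hx), x.1.2, x.2).
  have hy : crossing_of y = x by rewrite /crossing_of /= -!surjective_pairing.
  rewrite /phi (bigD1 (Ordinal hn)) //= (bigD1 y) //= (bigD1 k) //= hy hj.
  rewrite -!addrA -[leLHS]addr0; apply: lerD; last first.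
    apply: addr_ge0; first by apply: sumr_ge0 => ? _; exact: term0.
    apply: addr_ge0; first by do 2!(apply: sumr_ge0 => ? _); exact: term0.
    by do 3!(apply: sumr_ge0 => ? _); exact: term0.
  have h2 : (10 / 3) ^+ m <= (incr R k n x j f) ^+ 2.
    apply: le_trans (bad1_threshold R m) _; rewrite -[leRHS]real_normK ?num_real //.
    rewrite lerXn2r ?nnegrE ?(ltW hlt) //; have /andP[a1 a2] := al_bounds R.
    by apply: mulr_ge0; apply: exprn_ge0; lra.
  apply: (@le_trans _ _ ((3 / 10) ^+ m * (10 / 3) ^+ m)).
    by rewrite -exprMn (_ : 3 / 10 * (10 / 3) = 1) ?expr1n //; lra.
  by apply: ler_wpM2l => //; apply: exprn_ge0; lra.
rewrite lee_fin /phi Ex_sum.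
have /andP[a1 a2] := al_bounds R.
pose S := \sum_(n < m.+1) 3 ^+ n * al R ^+ (m - n).
apply: (@le_trans _ _ ((27 * (324 * 3)) * (3 / 10) ^+ m * S)).
  rewrite /S mulr_sumr; apply: ler_sum => n _.
  rewrite Ex_sum; apply: (@le_trans _ _ (\sum_(x : n.-tuple 'I_3 * 'I_3 * 'I_3)
     3 * ((3 / 10) ^+ m * ((324 * 3) * al R ^+ (m - n))))); last first.
    rewrite sum_crossings; move: (al R ^+ (m - n)) ((3 / 10) ^+ m) (3 ^+ n) => z y t.
    by apply: eq_le_num; ring.
  apply: ler_sum => x _; rewrite Ex_sum.
  apply: (@le_trans _ _ (\sum_(k : 'I_3) (3 / 10) ^+ m * ((324 * 3) * al R ^+ (m - n)))); last first.
    by rewrite big_const iter_addr addr0 card_ord -[leLHS]mulr_natl.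
  apply: ler_sum => k _; rewrite ExZ; apply: ler_wpM2l; first by apply: exprn_ge0; lra.
  have hn : (m - n + n)%N = m by rewrite subnK // -ltnS.
  have := Ex_increment hST hmeas hunif hcons k n (crossing_of x) (m - n) (phi := fun=> 1) (fun=> ler01).
  rewrite hn => h; apply: (@le_trans _ _ (324 * (al R ^+ (m - n) * 3))); last first.
    by move: (al R ^+ (m - n)) => z; lra.
  have e1 : Ex P T m.+1 (fun f => incr R k n (crossing_of x) (m - n) f ^+ 2) <=
      324 * Ex P T m (fun f => (size (lin n (crossing_of x) (m - n) f))%:R).
    rewrite (@eq_Ex _ _ _ P T m _ (fun f => 1 * (size (lin n (crossing_of x) (m - n) f))%:R));
      last by move=> f _; rewrite mul1r.
    apply: le_trans h; apply: le_Ex => f _; rewrite /incr hn mul1r; exact: lexx.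
  apply: (le_trans e1); apply: ler_wpM2l; first by lra.
  by have := Ex_size hST hmeas hunif hcons n (crossing_of x) (m - n); rewrite hn.
(* Since $\bar\alpha\le\frac{23}{10}<3$ the last terms dominate; the induction closes because
   $5\cdot\frac{23}{10}+3\le15$. *)
have hS : S <= 5 * 3 ^+ m.
  rewrite /S; elim: m {phi term0 S} => [|m IH].
    by rewrite big_ord1 !expr0; lra.
  rewrite big_ord_recr /= subnn expr0 mulr1.
  rewrite (eq_bigr (fun n : 'I_m.+1 => al R * (3 ^+ n * al R ^+ (m - n)))); last first.
    by move=> n _; rewrite subSn -1?ltnS // exprS mulrCA.
  rewrite -mulr_sumr; set s := \sum_(i < _) _ in IH *.
  have : 0 <= 3 ^+ m :> R by apply: exprn_ge0.
  have : 0 <= s by apply: sumr_ge0 => i _; apply: mulr_ge0; apply: exprn_ge0; lra.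
  rewrite exprS; set t := 3 ^+ m in IH *; nra.
have h3 : 0 <= (3 / 10) ^+ m :> R by apply: exprn_ge0; lra.
apply: le_trans (ler_wpM2l _ hS) _; first by apply: mulr_ge0 h3; lra.
apply: eq_le_num; have -> : (9 / 10) ^+ m = (3 / 10) ^+ m * 3 ^+ m :> R.
  by rewrite -exprMn; congr (_ ^+ m); lra.
ring.
Qed.

Lemma prob_bad2 n j : (P [set w | bad2 R n j (T (j + n).+1 w)] <=
  ((9 * 324) * 3 ^+ n * (25 / 32) ^+ j)%:E)%E.
Proof.
(* If the crossing is not traversed, the weight is 0 and so is its inverse, so the crossing
   contributes nothing. *)
pose ph x g : R := (25 / 16) ^+ j * ((W (eig R i0).1 n x j g) ^+ 2)^-1.
have ph0 x g : 0 <= ph x g.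
  by apply: mulr_ge0; [apply: exprn_ge0; lra|rewrite invr_ge0 sqr_ge0].
pose phi f : R := \sum_(x : n.-tuple 'I_3 * 'I_3 * 'I_3)
  ph (crossing_of x) (Tr (j + n) f) * (incr R i0 n (crossing_of x) j f) ^+ 2.
have term0 x f : 0 <= ph x (Tr (j + n) f) * (incr R i0 n x j f) ^+ 2.
  by apply: mulr_ge0; rewrite ?sqr_ge0.
apply: le_trans (prob_le_Ex hST hmeas hunif (phi := phi) _ _) _.
- by move=> f _; apply: sumr_ge0 => ? _; exact: term0.
- move=> f _ [x [hx hlt]].
  pose y : n.-tuple 'I_3 * 'I_3 * 'I_3 := (Tuple (introT eqP hx), x.1.2, x.2).
  have hy : crossing_of y = x by rewrite /crossing_of /= -!surjective_pairing.
  rewrite /phi (bigD1 y) //= hy -[leLHS]addr0; apply: lerD; last first.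
    by apply: sumr_ge0 => ? _; exact: term0.
  have hw := size_le_W R n x j (Tr (j + n) f).
  case: (size_lin n x j (Tr (j + n) f)) => [e|hs].
    by move: hlt; rewrite incr_empty // /W /= e /wsum big_nil mulr0 normr0 ltxx.
  have w0 : 0 < W (eig R i0).1 n x j (Tr (j + n) f).
    apply: lt_le_trans hw; rewrite ltr0n; apply: leq_trans hs; by rewrite expn_gt0.
  move: w0 hlt; rewrite /ph; set w := W _ _ _ _ _ => w0 hlt.
  rewrite mulrAC ler_pdivlMr ?mul1r ?exprn_gt0 //.
  have -> : w ^+ 2 = (25 / 16) ^+ j * ((4 / 5) ^+ j * w) ^+ 2.
    have e : ((4 / 5) ^+ j) ^+ 2 = ((4 / 5) ^+ 2) ^+ j :> R by rewrite -!exprM mulnC.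
    rewrite [((4 / 5) ^+ j * w) ^+ 2]exprMn e mulrA -exprMn.
    by rewrite (_ : 25 / 16 * (4 / 5) ^+ 2 = 1) ?expr1n ?mul1r // expr2; lra.
  apply: ler_wpM2l; first by apply: exprn_ge0; lra.
  rewrite -[leRHS]real_normK ?num_real // lerXn2r ?nnegrE ?(ltW hlt) //.
  by apply: mulr_ge0 (ltW w0); apply: exprn_ge0; lra.
rewrite lee_fin /phi Ex_sum.
apply: (@le_trans _ _ (\sum_(x : n.-tuple 'I_3 * 'I_3 * 'I_3) 324 * (25 / 32) ^+ j)).
  apply: ler_sum => x _; set y := crossing_of x.
  apply: le_trans (Ex_increment hST hmeas hunif hcons i0 n y j (ph0 y)) _.
  apply: ler_wpM2l; first by lra.
  rewrite -[leRHS](Ex_const hST hmeas hunif (j + n)).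
  apply: le_Ex => f _; have hw := size_le_W R n y j f; rewrite /ph.
  case: (size_lin n y j f) => [->|hs].
    by rewrite mulr0; apply: exprn_ge0; lra.
  have s0 : 2 ^+ j <= (size (lin n y j f))%:R :> R by rewrite -natrX ler_nat.
  have p0 : 0 < 2 ^+ j :> R by apply: exprn_gt0.
  move: s0 hw; set s := _%:R => s0 hw; rewrite [(eig R i0).1]/=.
  set w := W _ _ _ _ _ in hw *; have w0 : 0 < w by lra.
  (* As the number of cells is at most [w] and [w] is at least $2^j$, its quotient by $w^2$ is at
     most $2^{-j}$. *)
  have -> : (25 / 32) ^+ j = (25 / 16) ^+ j * (2 ^+ j)^-1 :> R.
    by rewrite -exprVn -exprMn; congr (_ ^+ j); lra.
  rewrite -mulrA; apply: ler_wpM2l; first by apply: exprn_ge0; lra.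
  rewrite mulrC ler_pdivrMr ?exprn_gt0 // mulrC ler_pdivlMr // expr2; nra.
rewrite sum_crossings; apply: eq_le_num; ring.
Qed.

(** The threshold for [bad1] is common to all levels, since its events already contain them all. For
    [bad2] it depends on [n], whose factor $3^n$ is not compensated; positivity needs no uniformity
    in [n]. *)
Lemma good_event : exists G : set Omega, [/\ measurable G, P (~` G) = 0%E &
  forall w, G w -> (exists M, forall m, (M <= m)%N -> ~ bad1 R m (T m.+1 w)) /\
    forall n, exists M, forall j, (M <= j)%N -> ~ bad2 R n j (T (j + n).+1 w)].
Proof.
pose F1 m := [set w | bad1 R m (T m.+1 w)].
pose F2 n j := [set w | bad2 R n j (T (j + n).+1 w)].
have m1 m : measurable (F1 m) by exact: measurable_event.
have m2 n j : measurable (F2 n j) by exact: measurable_event.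
have mls (F : (set Omega)^nat) : (forall m, measurable (F m)) -> measurable (lim_sup_set F).
  move=> mF; apply: bigcap_measurable => // k _.
  by apply: bigcup_measurable => i _; exact: mF.
have n1 : P (lim_sup_set F1) = 0%E.
  apply: (@lim_sup_geometric _ (27 * (324 * 3) * 5) (9 / 10));
    [by lra|by apply/andP; split; lra|exact: m1|exact: prob_bad1].
have n2 n : P (lim_sup_set (F2 n)) = 0%E.
  apply: (@lim_sup_geometric _ ((9 * 324) * 3 ^+ n) (25 / 32));
    [|by apply/andP; split; lra|exact: m2|exact: prob_bad2].
  by apply: mulr_ge0; [lra|exact: exprn_ge0].
have mB : measurable (lim_sup_set F1 `|` \bigcup_n lim_sup_set (F2 n)).
  by apply: measurableU; [exact: mls|apply: bigcup_measurable => n _; exact: mls].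
exists (~` (lim_sup_set F1 `|` \bigcup_n lim_sup_set (F2 n))); split.
- exact: measurableC.
- rewrite setCK; apply: measure_negligible => //; apply: negligibleU.
    by apply/negligibleP => //; exact: mls.
  by apply: negligible_bigcup => n; apply/negligibleP; [exact: mls|exact: n2].
have hls (F : (set Omega)^nat) w : ~ lim_sup_set F w ->
    exists M, forall m, (M <= m)%N -> ~ F m w.
  move=> h; apply: contrapT => /forallNP h'; apply: h => M _.
  have /existsNP [m /not_implyP [hm /contrapT hF]] := h' M.
  by exists m.
move=> w /not_orP [/hls h1 h2]; split=> // n; apply: (hls (F2 n)) => h.
by apply: h2; exists n.
Qed.

End BorelCantelli.

(** * Limits of the rescaled distances *)

Section RealSequences.
Variable R : realType.
Implicit Types u : nat -> R.

Lemma cvg_pow45 : (fun j : nat => (4 / 5 : R) ^+ j) @ \oo --> (0 : R).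
Proof. by apply: cvg_expr; rewrite ger0_norm; lra. Qed.

Lemma pow45_gt0 j : 0 < (4 / 5 : R) ^+ j.
Proof. by apply: exprn_gt0; lra. Qed.

Lemma pow54_45 j : (5 / 4 : R) ^+ j * (4 / 5) ^+ j = 1.
Proof. by rewrite -exprMn (_ : 5 / 4 * (4 / 5) = 1) ?expr1n //; lra. Qed.

(** The factor 5 is $1/(1-\frac45)$: subtracting or adding the geometric remainder makes the
    sequence increasing or decreasing. *)
Lemma geo_increments_cvg u (C : R) J : (forall j, (J <= j)%N -> `|u j.+1 - u j| <= C * (4 / 5) ^+ j) ->
  exists l, u @ \oo --> l /\ `|l - u J| <= 5 * C * (4 / 5) ^+ J.
Proof.
move=> hu.
have hC j : (J <= j)%N -> [/\ u j.+1 - u j <= C * (4 / 5) ^+ j & - (C * (4 / 5) ^+ j) <= u j.+1 - u j].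
  by move=> /hu; rewrite ler_norml => /andP[].
pose a j := u (j + J)%N - 5 * C * (4 / 5) ^+ (j + J).
pose b j := u (j + J)%N + 5 * C * (4 / 5) ^+ (j + J).
have C0 : 0 <= C.
  have := le_trans (normr_ge0 _) (hu J (leqnn J)); have := pow45_gt0 J; nra.
have ab j : a j <= b j.
  by rewrite /a /b; have := pow45_gt0 (j + J); set p := _ ^+ _ => hp; nra.
have ha : {homo a : i j / (i <= j)%N >-> i <= j}.
  apply/nondecreasing_seqP => j; have [_] := hC _ (leq_addl j J).
  by rewrite /a addSn exprS; set p := _ ^+ _ => h; lra.
have hb : {homo b : i j / (i <= j)%N >-> j <= i}.
  apply/nonincreasing_seqP => j; have [h _] := hC _ (leq_addl j J).
  by move: h; rewrite /b addSn exprS; set p := _ ^+ _ => h; lra.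
have ca : cvgn a.
  apply: nondecreasing_is_cvgn => //; exists (b 0%N) => _ [j _ <-].
  exact: le_trans (ab j) (hb _ _ (leq0n j)).
have c0 : (fun j => 5 * C * (4 / 5) ^+ (j + J)) @ \oo --> (0 : R).
  rewrite -[X in _ --> X](mulr0 (5 * C)); apply: cvgMr.
  by rewrite (cvg_shiftn J (fun j => (4 / 5 : R) ^+ j)); exact: cvg_pow45.
have cu : (fun j => u (j + J)%N) @ \oo --> limn a.
  rewrite -[X in _ --> X]addr0 (_ : (fun j => u (j + J)%N) =
    (fun j => a j + 5 * C * (4 / 5) ^+ (j + J))); last first.
    by apply/funext => j; rewrite /a subrK.
  exact: cvgD ca c0.
exists (limn a); split; first by move: cu; rewrite (cvg_shiftn J u).
have h1 : a 0%N <= limn a by apply: nondecreasing_cvgn_le.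
have h2 : limn a <= b 0%N.
  apply: limr_le => //; apply: nearW => j; exact: le_trans (ab j) (hb _ _ (leq0n j)).
by move: h1 h2; rewrite /a /b add0n ler_norml => h1 h2; apply/andP; split; lra.
Qed.

Lemma contract_cvg0 u (rho C : R) J : `|rho| <= 1 / 2 ->
  (forall j, (J <= j)%N -> `|u j.+1 - rho * u j| <= C * (4 / 5) ^+ j) ->
  u @ \oo --> (0 : R).
Proof.
move=> hr hu.
have C0 : 0 <= C.
  have := le_trans (normr_ge0 _) (hu J (leqnn J)); have := pow45_gt0 J; nra.
(* The second summand covers the start at [J], the first the induction: an error $K/4$ plus a
   contracted $K/2$ stays below $\frac45K$. *)
pose K := 4 * C + `|u J| * (5 / 4) ^+ J.
have K0 : 4 * C <= K.
  by rewrite /K lerDl mulr_ge0 // exprn_ge0 //; lra.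
have hK j : `|u (j + J)%N| <= K * (4 / 5) ^+ (j + J).
  elim: j => [|j IH].
    by rewrite add0n /K mulrDl -[_ * _ ^+ J * _]mulrA pow54_45 mulr1 lerDr mulr_ge0 ?(ltW (pow45_gt0 J)) //; lra.
  have h := hu _ (leq_addl j J).
  have -> : u (j.+1 + J)%N = (u (j + J).+1 - rho * u (j + J)%N) + rho * u (j + J)%N.
    by rewrite subrK.
  apply: le_trans (ler_normD _ _) _; rewrite normrM addSn exprS.
  have hp := pow45_gt0 (j + J); move: h IH hp.
  set p := _ ^+ _; set x := `|u _ - _|; set y := `|u _|; set r := `|rho| in hr *.
  move=> h IH hp; have r0 : 0 <= r by exact: normr_ge0.
  have : r * y <= 1 / 2 * (K * p).
    by apply: ler_pM => //; exact: normr_ge0.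
  nra.
rewrite -(cvg_shiftn J u); apply/norm_cvg0P.
apply: (@squeeze_cvgr _ _ _ _ (fun=> 0) (fun j => K * (4 / 5) ^+ (j + J))).
- by apply: nearW => j /=; rewrite normr_ge0 hK.
- exact: cvg_cst.
rewrite -[X in _ --> X](mulr0 K); apply: cvgMr.
by rewrite (cvg_shiftn J (fun j => (4 / 5 : R) ^+ j)); exact: cvg_pow45.
Qed.

Lemma positive_bound u (a : R) J : 2 <= a -> (8 <= J)%N -> (forall j, 0 <= u j) ->
  (forall j, (J <= j)%N -> (1 - (4 / 5) ^+ j / a) * u j <= u j.+1) ->
  forall j, (J <= j)%N -> u J / 2 <= u j.
Proof.
move=> ha hJ h0 hu j hj.
(* The factor $\frac12+k(\frac45)^{i+J}$ equals 1 at [i = 0] and decreases to 1/2. It absorbs the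
   losses as soon as $k\ge\frac52$, and $(\frac54)^8\ge5$ explains the bound 8. *)
pose k := (5 / 4) ^+ J / 2 : R.
have k5 : 5 / 2 <= k.
  rewrite /k ler_pM2r; last by lra.
  rewrite -(subnK hJ) exprD; apply: (@le_trans _ _ (1 * (5 / 4) ^+ 8)).
    by rewrite mul1r !exprS expr0; lra.
  apply: ler_wpM2r; first by apply: exprn_ge0; lra.
  by apply: exprn_ege1; lra.
have key i : u J * (1 / 2 + k * (4 / 5) ^+ (i + J)) <= u (i + J)%N.
  elim: i => [|i IH].
    by rewrite add0n /k mulrAC pow54_45; apply: eq_le_num; lra.
  apply: le_trans (hu _ (leq_addl i J)).
  have pJ : k * (4 / 5) ^+ (i + J) <= 1 / 2.
    rewrite /k mulrAC [(i + J)%N]addnC exprD mulrA pow54_45.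
    have : (4 / 5 : R) ^+ i <= 1 by apply: exprn_ile1; lra.
    by lra.
  have hp := pow45_gt0 (i + J); rewrite addSn exprS.
  set p := _ ^+ _ in IH pJ hp *.
  have hpa : 0 <= p / a <= p / 2.
    apply/andP; split; first by apply: divr_ge0; lra.
    by apply: ler_wpM2l; [lra|rewrite lef_pV2 ?posrE; lra].
  have p1 : p <= 1 by apply: exprn_ile1; lra.
  have [uJ q0] := (h0 J, h0 (i + J)%N).
  move: hpa IH uJ q0; move: (p / a) (u J) (u (i + J)%N) => q x v.
  move=> /andP[q1 q2] IH uJ q0.
  apply: (@le_trans _ _ ((1 - q) * (x * (1 / 2 + k * p)))); last first.
    by apply: ler_wpM2l => //; lra.
  have : 0 <= x * (k * p / 5 - q).
    by apply: mulr_ge0 => //; nra.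
  have : 0 <= x * q * (1 / 2 - k * p).
    by apply: mulr_ge0; [exact: mulr_ge0|lra].
  lra.
have := key (j - J)%N; rewrite subnK //; apply: le_trans.
rewrite -[leLHS]addr0 mulrDr; apply: lerD; first by apply: eq_le_num; lra.
apply: mulr_ge0 => //; apply: mulr_ge0; last exact: ltW (pow45_gt0 _); lra.
Qed.

End RealSequences.

Section CrossingLimits.
Variable R : realType.
Variable t : nat -> rel Point.
Hypothesis tST : forall m, isST m (t m).
Hypothesis tTr : forall m, Tr m (t m.+1) = t m.
Hypothesis tb1 : exists M, forall m, (M <= m)%N -> ~ bad1 R m (t m.+1).
Hypothesis tb2 : forall n, exists M, forall j, (M <= j)%N -> ~ bad2 R n j (t (j + n).+1).

Definition wt (k : 'I_3) n x j : R := W (eig R k).1 n x j (t (j + n)).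

Definition nwt k n x j : R := wt k n x j / al R ^+ (j + n).

Definition clen n x j : nat := \sum_(y <- lin n x j (t (j + n))) xlen (t (j + n)) y.

Lemma al_gt0 : 0 < al R.
Proof. by have /andP[] := al_bounds R; lra. Qed.

Lemma alX_gt0 m : 0 < al R ^+ m.
Proof. by apply: exprn_gt0; exact: al_gt0. Qed.

Lemma incr_t k n x j :
  incr R k n x j (t (j + n).+1) = wt k n x j.+1 - (eig R k).2 * wt k n x j.
Proof. by rewrite /incr tTr. Qed.

Lemma normalize_step (a p w' w l : R) : 0 < a -> 0 < p ->
  w' / (a * p) - l / a * (w / p) = (w' - l * w) / (a * p).
Proof. by move=> ha hp; field; lra. Qed.

Lemma normalize_lower (a p w' w e : R) : 0 < a -> 0 < p ->
  - (e * w) <= w' - a * w -> (1 - e / a) * (w / p) <= w' / (a * p).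
Proof.
move=> ha hp h; rewrite ler_pdivlMr; last exact: mulr_gt0.
have -> : (1 - e / a) * (w / p) * (a * p) = a * w - e * w by field; lra.
lra.
Qed.

Lemma nwt_step k n x j : size x.1.1 = n -> ~ bad1 R (j + n) (t (j + n).+1) ->
  `|nwt k n x j.+1 - (eig R k).2 / al R * nwt k n x j| <= (4 / 5) ^+ n * (4 / 5) ^+ j.
Proof.
move=> hx hb; have h : `|incr R k n x j (t (j + n).+1)| <= al R ^+ (j + n).+1 * (4 / 5) ^+ (j + n).
  by rewrite leNgt; apply/negP => h; apply: hb; exists n, j, x, k.
have -> : nwt k n x j.+1 - (eig R k).2 / al R * nwt k n x j =
    incr R k n x j (t (j + n).+1) / al R ^+ (j + n).+1.
  by rewrite incr_t /nwt addSn exprS normalize_step ?al_gt0 ?alX_gt0.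
rewrite normrM [X in _ * X]ger0_norm; last by rewrite invr_ge0; exact: ltW (alX_gt0 _).
rewrite ler_pdivrMr ?alX_gt0 //; apply: le_trans h _.
by rewrite -exprD [(n + j)%N]addnC mulrC.
Qed.

(* Coordinates of the vector of lengths (1, 2, 1) in the basis of eigenvectors; the
   one at [h0] is -5/26. *)
Definition cA : R := (2 - be R * (15 / 13)) / (al R - be R).
Definition cB : R := 15 / 13 - cA.

Lemma be_bounds : 1 / 3 <= be R <= 1 / 2.
Proof. by have /andP[a1 a2] := al_bounds R; apply/andP; rewrite /be; split; lra. Qed.

Lemma cA_gt0 : 0 < cA.
Proof.
have /andP[a1 a2] := al_bounds R; have /andP[b1 b2] := be_bounds.
by rewrite /cA; apply: divr_gt0; lra.
Qed.

Lemma cAB : cA * al R + cB * be R = 2.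
Proof.
have /andP[a1 a2] := al_bounds R; have /andP[b1 b2] := be_bounds.
have h : cA * (al R - be R) = 2 - be R * (15 / 13).
  by rewrite /cA -mulrA mulVf ?mulr1 // gt_eqF //; lra.
rewrite /cB; lra.
Qed.

Lemma elen_typ q a b : (elen q a b)%:R =
  cA * hv (al R) (typ q a b) + cB * hv (be R) (typ q a b) - 5 / 26 * h0 R (typ q a b).
Proof.
have h := cAB; have h' : cA + cB = 15 / 13 by rewrite /cB; lra.
move: cA cB h h' => x y h h'; rewrite /elen /typ /hv /h0.
by case: ifP => _; [case: ifP => _|] => /=; lra.
Qed.

Lemma clen_wt n x j : (clen n x j)%:R =
  cA * wt i0 n x j + cB * wt i1 n x j - 5 / 26 * wt i2 n x j.
Proof.
rewrite /clen natr_sum /wt /W /wsum !mulr_sumr -big_split -sumrB /=.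
by apply: eq_bigr => y _; rewrite /xlen elen_typ.
Qed.

Lemma lin_size n x j : valid n (t n) x -> (2 ^ j <= size (lin n x j (t (j + n))))%N.
Proof.
move=> hx; elim: j => [|j IH]; first by rewrite /= add0n hx.
rewrite expnS; apply: leq_trans (size_refine _ _).
by rewrite leq_mul2l /= -[t (j + n)]tTr in IH *.
Qed.

(** The same [M] serves all crossings; for levels [n] beyond it the error is counted from the very
    first refinement, which makes it of order $(\frac45)^n$. *)
Lemma nwt_cvg n x M : size x.1.1 = n ->
  (forall m, (M <= m)%N -> ~ bad1 R m (t m.+1)) ->
  exists l : R, nwt i0 n x @ \oo --> l /\
    `|l - nwt i0 n x (M - n)| <= 5 * (4 / 5) ^+ n * (4 / 5) ^+ (M - n).
Proof.
move=> hx hM; pose C : R := (4 / 5) ^+ n.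
have hs j : (M - n <= j)%N -> `|nwt i0 n x j.+1 - nwt i0 n x j| <= C * (4 / 5) ^+ j.
  move=> hj; have hM' : (M <= j + n)%N by lia.
  have := @nwt_step i0 n x j hx (hM _ hM').
  by rewrite /= divff ?mul1r ?gt_eqF ?al_gt0.
have [l [h1 h2]] := geo_increments_cvg hs.
by exists l; split; [exact: h1|exact: h2].
Qed.

(** Relative to $\bar\alpha$ the other two eigenvalues are at most 1/2, so these components die out
    and only the leading one contributes to the length. *)
Lemma clen_cvg n x l : size x.1.1 = n -> nwt i0 n x @ \oo --> l ->
  (fun j => (clen n x j)%:R / al R ^+ (j + n)) @ \oo --> cA * l.
Proof.
move=> hx hl; have [M hM] := tb1.
have /andP[a1 a2] := al_bounds R; have /andP[b1 b2] := be_bounds.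
have step k j : (M <= j)%N -> `|nwt k n x j.+1 - (eig R k).2 / al R * nwt k n x j|
    <= (4 / 5) ^+ n * (4 / 5) ^+ j.
  by move=> hj; apply: nwt_step => //; apply: hM; exact: leq_trans (leq_addr _ _).
have c1 : nwt i1 n x @ \oo --> (0 : R).
  apply: contract_cvg0 (step i1); rewrite /= ger0_norm; last by apply: divr_ge0; lra.
  by rewrite ler_pdivrMr; lra.
have c2 : nwt i2 n x @ \oo --> (0 : R).
  by apply: contract_cvg0 (step i2); rewrite /= mul0r normr0; lra.
rewrite (_ : (fun j => _) = (fun j => cA * nwt i0 n x j + cB * nwt i1 n x j
    - 5 / 26 * nwt i2 n x j)); last first.
  apply/funext => j; by rewrite clen_wt /nwt mulrBl mulrDl -!mulrA.
rewrite (_ : cA * l = cA * l + cB * 0 - 5 / 26 * 0); last by lra.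
by apply: cvgB; [apply: cvgD|]; apply: cvgMr.
Qed.

(** Additive errors could swallow a small weight; the relative ones from [bad2] only multiply it by
    factors $1-(\frac45)^j/\bar\alpha$, whose product stays away from 0. *)
Lemma nwt_lim_gt0 n x l : valid n (t n) x -> nwt i0 n x @ \oo --> l -> 0 < l.
Proof.
move=> hv hl; have /and3P[/eqP hx _ _] := hv; have [M hM] := tb2 n.
have /andP[a1 a2] := al_bounds R.
have w_ge j : (size (lin n x j (t (j + n))))%:R <= wt i0 n x j by exact: size_le_W.
have u0 j : 0 <= nwt i0 n x j.
  by apply: divr_ge0; [exact: le_trans (w_ge j)|exact: ltW (alX_gt0 _)].
pose J := maxn 8 M.
have hJ j : (J <= j)%N -> (1 - (4 / 5) ^+ j / al R) * nwt i0 n x j <= nwt i0 n x j.+1.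
  move=> hj; have hMj : (M <= j)%N by apply: leq_trans hj; exact: leq_maxr.
  have : `|incr R i0 n x j (t (j + n).+1)| <= (4 / 5) ^+ j * wt i0 n x j.
    rewrite leNgt; apply/negP => h; apply: (hM j hMj); exists x; split=> //.
    by rewrite tTr.
  rewrite incr_t ler_norml => /andP[h _].
  rewrite /nwt addSn exprS; have hp := alX_gt0 (j + n); have ha := al_gt0.
  move: h; rewrite [(eig R i0).2]/= => h.
  exact: normalize_lower.
have hb := positive_bound (u := nwt i0 n x) (a := al R) _ (leq_maxl 8 M) u0 hJ.
have p0 : 0 < nwt i0 n x J.
  apply: divr_gt0; last exact: alX_gt0.
  apply: lt_le_trans (w_ge J); rewrite ltr0n; apply: leq_trans (lin_size J hv).
  by rewrite expn_gt0.
apply: (@lt_le_trans _ _ (nwt i0 n x J / 2)); first by lra.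
rewrite -(cvg_lim (@Rhausdorff R) hl); apply: limr_ge; first by apply/cvg_ex; exists l.
by exists J => // j /= hj; apply: hb => //; lra.
Qed.

Lemma nwt0_le n x : nwt i0 n x 0 <= 3 * (4 / 5) ^+ n.
Proof.
have /andP[a1 a2] := al_bounds R; rewrite /nwt add0n ler_pdivrMr ?alX_gt0 //.
apply: (@le_trans _ _ 3).
  rewrite /wt /W /wsum /=; case: ifP => _; last by rewrite big_nil.
  rewrite big_seq1; have [_ _ h] := eigP R i0.
  by apply: le_trans (h (xtyp _ x) (typ_lt _ _ _)); exact: ler_norm.
have : 1 <= (4 / 5 * al R) ^+ n by apply: exprn_ege1; lra.
rewrite exprMn -mulrA; set z := _ * _ => hz; lra.
Qed.

Theorem crossing_limit : exists c : nat -> crossing -> R, [/\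
  forall n x, size x.1.1 = n ->
    (fun j => (clen n x j)%:R / al R ^+ (j + n)) @ \oo --> c n x,
  forall n x, valid n (t n) x -> 0 < c n x &
  exists N K, 0 < K /\ forall n x, (N <= n)%N -> size x.1.1 = n -> c n x <= K * (4 / 5) ^+ n].
Proof.
have [M hM] := tb1; exists (fun n x => cA * limn (nwt i0 n x)).
have hc n x : size x.1.1 = n -> nwt i0 n x @ \oo --> limn (nwt i0 n x).
  by move=> hx; have [l [hl _]] := nwt_cvg hx hM; apply/cvg_ex; exists l.
split.
- by move=> n x hx; apply: clen_cvg => //; exact: hc.
- move=> n x hv; apply: mulr_gt0; first exact: cA_gt0.
  by apply: (nwt_lim_gt0 hv); apply: hc; case/and3P: hv => /eqP.
(* Here 8 = 3 + 5: the initial weight from [nwt0_le] plus the geometric tail. *)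
exists M, (cA * 8); split; first by apply: mulr_gt0; [exact: cA_gt0|].
move=> n x hn hx; rewrite -(mulrA cA); apply: ler_wpM2l; first exact: ltW cA_gt0.
have [l [hl hle]] := nwt_cvg hx hM.
rewrite (cvg_lim (@Rhausdorff R) hl); move: hle.
rewrite (eqP (hn : (M - n == 0)%N)) expr0 mulr1 ler_norml => /andP[_ h].
have := nwt0_le n x; lra.
Qed.

Lemma dist_limit (c : nat -> crossing -> R) n L p q :
  (forall n x, size x.1.1 = n ->
    (fun j => (clen n x j)%:R / al R ^+ (j + n)) @ \oo --> c n x) ->
  all (valid n (t n)) L -> switching L -> chain p L q ->
  (fun m => al R ^- m * (dist (t m) p q)%:R) @ \oo --> \sum_(x <- L) c n x.
Proof.
move=> hc hL hs hch; rewrite -(cvg_shiftn n).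
rewrite (_ : (fun j => _) = (fun j => \sum_(x <- L) (clen n x j)%:R / al R ^+ (j + n))); last first.
  apply/funext => j; rewrite (dist_linL tST tTr j hL hs hch) natr_sum mulr_sumr.
  by apply: eq_bigr => x _; rewrite mulrC.
move: hL {hs hch}; elim: L => [|x L IH] /=.
  move=> _; rewrite big_nil (_ : (fun j => _) = (fun=> 0)); first exact: cvg_cst.
  by apply/funext => j; rewrite big_nil.
case/andP => /and3P[/eqP hx _ _] /IH {}IH; rewrite big_cons.
rewrite (_ : (fun j => _) = (fun j => (clen n x j)%:R / al R ^+ (j + n) +
    \sum_(x <- L) (clen n x j)%:R / al R ^+ (j + n))); last first.
  by apply/funext => j; rewrite big_cons.
by apply: cvgD => //; exact: hc.
Qed.

End CrossingLimits.

Lemma chain_split p q L1 L2 : chain p (L1 ++ L2) q ->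
  exists z, chain p L1 z /\ chain z L2 q.
Proof.
elim: L1 p => [|x L1 IH] p /=; first by exists p.
case/andP => -> /IH [z [h1 h2]]; by exists z.
Qed.

Lemma chain_end n f p q L : all (valid n f) L -> p \in VG n -> chain p L q -> q \in VG n.
Proof.
elim: L p => [|x L IH] p /=; first by move=> _ hp /eqP <-.
case/andP => /and3P[/eqP hx _ _] hL _ /andP[_]; apply: IH => //.
by apply/VGP; exists x.1.1, x.2.
Qed.

Lemma cvg_add (R : realType) (a b : nat -> R) (la lb : R) :
  a @ \oo --> la -> b @ \oo --> lb -> (fun m => a m + b m) @ \oo --> la + lb.
Proof. exact: cvgD. Qed.

Lemma limit_le_max (R : realType) (a b e : nat -> R) (la lb le : R) :
  a @ \oo --> la -> b @ \oo --> lb -> e @ \oo --> le ->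
  (\forall m \near \oo, a m <= Num.max (b m) (e m)) -> la <= Num.max lb le.
Proof.
move=> ha hb he h; rewrite maxr_absE.
apply: (ler_cvg_to ha (g := fun m => (b m + e m + `|b m - e m|) / 2)).
  by apply: cvgMl; apply: cvgD; [exact: cvgD|apply: cvg_norm; exact: cvgB].
by apply: filterS h => m; rewrite maxr_absE.
Qed.

(** * The limit metric *)

Section LimitMetric.
Variable R : realType.
Variable t : nat -> rel Point.
Hypothesis tST : forall m, isST m (t m).
Hypothesis tTr : forall m, Tr m (t m.+1) = t m.
Variable c : nat -> crossing -> R.
Hypothesis hc : forall n x, size x.1.1 = n ->
    (fun j => (clen t n x j)%:R / al R ^+ (j + n)) @ \oo --> c n x.
Hypothesis c_gt0 : forall n x, valid n (t n) x -> 0 < c n x.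
Variables (N : nat) (K : R).
Hypothesis K0 : 0 < K.
Hypothesis c_le : forall n x, (N <= n)%N -> size x.1.1 = n -> c n x <= K * (4 / 5) ^+ n.
Variable dd : Point -> Point -> R.
Hypothesis hdd : forall u v, Vstar u -> Vstar v ->
  (exists l : R, (fun m => al R ^- m * (dist (t m) u v)%:R) @ \oo --> l) ->
  (fun m => al R ^- m * (dist (t m) u v)%:R) @ \oo --> dd u v.

Lemma tsym m x y : t m x y = t m y x. Proof. exact: isSub_sym (tST m).1 x y. Qed.
Lemma tirr m x : t m x x = false. Proof. exact: isSub_irr (tST m).1 x. Qed.
Lemma tac m : acyclic (t m). Proof. exact: (tST m).2.1. Qed.

Lemma dd_chain n u v L : u \in VG n -> v \in VG n -> all (valid n (t n)) L ->
  switching L -> chain u L v -> dd u v = \sum_(x <- L) c n x.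
Proof.
move=> hu hv hL hs hch; have h := dist_limit tST tTr hc hL hs hch.
have h' : (fun m => al R ^- m * (dist (t m) u v)%:R) @ \oo --> dd u v.
  by apply: hdd; [exists n|exists n|exists (\sum_(x <- L) c n x)].
exact: (cvg_unique _ h' h).
Qed.

Lemma chains n u v : u \in VG n -> v \in VG n ->
  exists L, [/\ all (valid n (t n)) L, switching L & chain u L v].
Proof.
move=> hu hv; apply: chain_exists; first exact: (tST n).1.
exact: (tST n).2.2.
Qed.

Lemma common2 u v : Vstar u -> Vstar v -> exists n, u \in VG n /\ v \in VG n.
Proof.
case=> n hn [m hm]; exists (maxn n m).
by split; [apply: VG_le hn; exact: leq_maxl|apply: VG_le hm; exact: leq_maxr].
Qed.

Lemma dd_cvg u v : Vstar u -> Vstar v ->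
  (fun m => al R ^- m * (dist (t m) u v)%:R) @ \oo --> dd u v.
Proof.
move=> hu hv; have [n [un vn]] := common2 hu hv.
have [L [h1 h2 h3]] := chains un vn; apply: hdd => //.
by exists (\sum_(x <- L) c n x); exact: (dist_limit tST tTr hc h1 h2 h3).
Qed.

Lemma conn_t n m u v : (n <= m)%N -> u \in VG n -> v \in VG n -> conn (t m) u v.
Proof. by move=> nm hu hv; apply: (tST m).2.2; exact: VG_le nm _. Qed.

Lemma common4 u v x y : Vstar u -> Vstar v -> Vstar x -> Vstar y ->
  exists n, [/\ u \in VG n, v \in VG n, x \in VG n & y \in VG n].
Proof.
move=> hu hv hx hy; have [n [un vn]] := common2 hu hv.
have [m [xm ym]] := common2 hx hy; exists (maxn n m).
by split; (apply: VG_le un || apply: VG_le vn || apply: VG_le xm || apply: VG_le ym);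
  rewrite ?leq_maxl ?leq_maxr.
Qed.

Lemma dd_metric : is_metric_on Vstar dd.
Proof.
move=> x y z hx hy hz; have [n [xn yn zn _]] := common4 hx hy hz hz.
have cst m u v := conn_t (n := n) (m := m) (u := u) (v := v).
split.
- split=> [|<-]; last first.
    have h := dd_cvg hx hx; move: h; set f := (fun m : nat => _) => h.
    suff ef : f = (fun=> 0) by move: h; rewrite ef => /(cvg_unique (@Rhausdorff R)); apply; exact: cvg_cst.
    by apply/funext => m; rewrite /f dist_refl ?mulr0 //;
      do ?[exact: tsym | exact: tirr | exact: tac].
  (* Different points are joined by a nonempty chain, each crossing of which has a positive
     limit. *)
  have [L [h1 h2 h3]] := chains xn yn.
  rewrite (dd_chain xn yn h1 h2 h3); case: L h1 h3 {h2} => [_ /eqP //|a L] h1 _.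
  rewrite big_cons => h; have /andP[/c_gt0 ha hL] := h1.
  have : 0 <= \sum_(b <- L) c n b.
    by rewrite big_seq; apply: sumr_ge0 => b /(allP hL)/c_gt0/ltW.
  by move=> hs; exfalso; lra.
- have h : (fun m => al R ^- m * (dist (t m) x y)%:R) @ \oo --> dd y x.
    apply: cvg_trans (dd_cvg hy hx); apply: near_eq_cvg; exists n => // m /= nm.
    by rewrite dist_sym //; do ?[exact: tsym | exact: tirr | exact: tac | exact: cst].
  exact: (cvg_unique _ (dd_cvg hx hy) h).
apply: (ler_cvg_to (dd_cvg hx hz) (cvg_add (dd_cvg hx hy) (dd_cvg hy hz))).
exists n => // m /= nm; rewrite -mulrDr -natrD; apply: ler_wpM2l.
  by rewrite invr_ge0 ltW // alX_gt0.
rewrite ler_nat; apply: dist_triangle;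
  by do ?[exact: tsym | exact: tirr | exact: tac | exact: cst].
Qed.

Lemma dd_hyperbolic : zero_hyperbolic_on Vstar dd.
Proof.
move=> u v x y hu hv hx hy; have [n [un vn xn yn]] := common4 hu hv hx hy.
apply: (limit_le_max (cvg_add (dd_cvg hu hv) (dd_cvg hx hy))
  (cvg_add (dd_cvg hu hx) (dd_cvg hv hy)) (cvg_add (dd_cvg hu hy) (dd_cvg hv hx))).
exists n => // m /= nm; have cst w w' := @conn_t n m w w' nm.
rewrite /= -!mulrDr -!natrD -maxr_pMr; last by rewrite invr_ge0 ltW // alX_gt0.
apply: ler_wpM2l; first by rewrite invr_ge0 ltW // alX_gt0.
rewrite -natr_max ler_nat; apply: dist_4point;
  by do ?[exact: tsym | exact: tirr | exact: tac | exact: cst].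
Qed.

Lemma dd_tri x y z : Vstar x -> Vstar y -> Vstar z -> dd x z <= dd x y + dd y z.
Proof. by move=> hx hy hz; case: (dd_metric hx hy hz). Qed.

Lemma dd_refl x : Vstar x -> dd x x = 0.
Proof. by move=> hx; case: (dd_metric hx hx hx) => h _ _; apply/h. Qed.

Lemma dd_edge n X Y : (N <= n)%N -> t n X Y -> dd X Y <= K * (4 / 5) ^+ n.
Proof.
move=> hn h; have hf := (tST n).1; have /adjGP [w [a [b [hw ab eX eY]]]] := hf.2 _ _ h.
subst X Y; rewrite st_edge in h; [|exact: isSub_sym hf|exact: isSub_irr hf].
have hw' e : psiw w (uu e) \in VG n by apply/VGP; exists w, e.
rewrite (dd_chain (L := [:: (w, a, b)]) (hw' a) (hw' b)) //=.
- by rewrite big_seq1; exact: c_le.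
- by rewrite /valid /= hw eqxx ab /ccon h orbT.
- by rewrite !eqxx.
Qed.

Lemma dd_path n X p : (N <= n)%N -> X \in VG n -> path (t n) X p ->
  dd X (last X p) <= (size p)%:R * (K * (4 / 5) ^+ n).
Proof.
move=> hn; elim: p X => [|Y p IH] X hX /=.
  by move=> _; rewrite mul0r dd_refl //; exists n.
case/andP => h hp; have /adjG_VG [_ hY] := (tST n).1.2 _ _ h.
have hl : Vstar (last Y p).
  exists n; elim: p Y hp hY {IH h} => [//|Z p IH] Y /= /andP[h hp] _.
  by apply: IH => //; have /adjG_VG [] := (tST n).1.2 _ _ h.
apply: le_trans (dd_tri (y := Y) _ _ hl) _; [by exists n|by exists n|].
rewrite -add1n natrD mulrDl mul1r; apply: lerD; [exact: dd_edge|exact: IH].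
Qed.

(** Inside its cell of level n the vertex is joined to a corner by edges of the tree. A simple path
    among the six vertices of the cell has at most five edges, each of limit length at most
    $K(\frac45)^{n+1}$. *)
Lemma dd_level_step n v : (N <= n)%N -> v \in VG n.+1 ->
  exists p, p \in VG n /\ dd v p <= 5 * (K * (4 / 5) ^+ n.+1).
Proof.
move=> hn /VGP [wi [a [hwi ->]]]; case: (lastP wi) hwi => // w i.
rewrite size_rcons => -[hw]; have hf := (tST n.+1).1.
rewrite -psiw_pt; set x := vt i a; have hx : (x < 6)%N by exact: vt_lt.
have hv0 : psiw w (uu i0) \in VG n by apply/VGP; exists w, i0.
have hvx : psiw w (pt x) \in VG n.+1.
  by rewrite psiw_pt; apply/VGP; exists (rcons w i), a; rewrite size_rcons hw.
have [p0 [hp0 hl0]] := (tST n.+1).2.2 _ _ hvx (VG_S hv0).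
rewrite -(glue_outside w hf) in hp0.
have [e he] : exists e, conn (emb w (gst (t n.+1) w)) (psiw w (pt x)) (corner w e).
  by apply: (glue_attached hw (off_outside w hf) hx hp0); exists i0.
have [p [hp hl hu]] := conn_upath he.
exists (psiw w (uu e)); split; first by apply/VGP; exists w, e.
have hp' : path (t n.+1) (psiw w (pt x)) p.
  apply: sub_path hp => X Y h; rewrite -(glue_outside w hf) /repl /cglue.
  by rewrite h orbT.
have -> : psiw w (uu e) = last (psiw w (pt x)) p by rewrite hl.
apply: le_trans (dd_path (leqW hn) hvx hp') _.
apply: ler_wpM2r; first by rewrite mulr_ge0 ?(ltW K0) ?(ltW (pow45_gt0 _ _)).
rewrite ler_nat -ltnS -[(size p).+1]/(size (psiw w (pt x) :: p)).
rewrite -[6%N]/(size [seq psiw w (pt y) | y <- iota 0 6]); apply: uniq_leq_size => // Z.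
have hmem y : (y < 6)%N -> psiw w (pt y) \in [seq psiw w (pt y) | y <- iota 0 6].
  by move=> hy; apply/mapP; exists y; rewrite ?mem_iota.
rewrite inE => /orP[/eqP ->|]; first exact: hmem.
elim: p (psiw w (pt x)) hp {hl hu hp'} => [//|Y p IH] X /= /andP[h hp].
rewrite inE => /orP[/eqP ->|]; last exact: (IH Y hp).
rewrite emb_sym in h; have [y [hy ->]] := emb_inside h; exact: hmem.
Qed.

(** The steps telescope: $5K(\frac45)^{i+1}=20K((\frac45)^i-(\frac45)^{i+1})$. *)
Lemma dd_level n k v : (N <= n)%N -> v \in VG (n + k) ->
  exists p, p \in VG n /\ dd v p <= 20 * K * ((4 / 5) ^+ n - (4 / 5) ^+ (n + k)).
Proof.
move=> hn; elim: k v => [|k IH] v.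
  rewrite addn0 subrr mulr0 => hv; exists v; split=> //.
  by rewrite dd_refl //; exists n.
rewrite addnS => hv.
have [p [hp1 hp2]] := dd_level_step (leq_trans hn (leq_addr k n)) hv.
have [q [hq1 hq2]] := IH p hp1; exists q; split=> //.
apply: le_trans (dd_tri (y := p) _ _ _) _; [by exists (n + k).+1|by exists (n + k)%N|by exists n|].
move: hp2 hq2; rewrite exprS; move: ((4 / 5) ^+ (n + k)) ((4 / 5) ^+ n) => a b.
lra.
Qed.

Lemma level_small (e : R) : 0 < e -> exists n, (N <= n)%N /\ 21 * K * (4 / 5) ^+ n < e.
Proof.
move=> e0; have h : (fun n => 21 * K * (4 / 5) ^+ n) @ \oo --> (0 : R).
  by rewrite -[X in _ --> X](mulr0 (21 * K)); apply: cvgMr; exact: cvg_pow45.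
have /cvgrPdist_lt/(_ e e0) [M _ hM] := h.
exists (maxn N M); split; first exact: leq_maxl.
have := hM (maxn N M) (leq_maxr _ _); rewrite /= sub0r normrN.
exact: le_lt_trans (ler_norm _).
Qed.

Lemma dd_totally_bounded : totally_bounded_on Vstar dd.
Proof.
move=> e e0; have [n [hn hne]] := level_small e0.
exists (VG n); have hIn p : p \in VG n <-> List.In p (VG n).
  elim: (VG n) => [//|q s IH] /=; rewrite inE; split.
    by case/orP => [/eqP ->|/IH]; [left|right].
  by case=> [->|/IH ->]; rewrite ?eqxx ?orbT.
split=> [p /hIn hp|v [m hm]]; first by exists n.
have hm' : v \in VG (n + m) by apply: VG_le hm; exact: leq_addl.
have [p [hp1 hp2]] := dd_level hn hm'; exists p; split; first exact/hIn.
apply: le_lt_trans hp2 _; apply: le_lt_trans hne.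
move: K0 (pow45_gt0 R n) (pow45_gt0 R (n + m)).
move: K ((4 / 5) ^+ n) ((4 / 5) ^+ (n + m)) => k a b k0 a0 b0.
by have := mulr_gt0 k0 a0; have := mulr_gt0 k0 b0; lra.
Qed.

(** The limit distance is additive along a chain, so cutting a chain of a fine level at one of its
    vertices splits the distance exactly; all its pieces are shorter than [e], hence a cut close to
    [s] exists. *)
Lemma dd_approx_geodesic u v (s e : R) : Vstar u -> Vstar v -> 0 < e ->
  0 <= s <= dd u v -> exists z, [/\ Vstar z, dd u z + dd z v = dd u v & `|dd u z - s| <= e].
Proof.
move=> hu hv e0 hs; have [m [um vm]] := common2 hu hv.
have [n0 [hn0 hne0]] := level_small e0.
pose n := maxn n0 m; have un : u \in VG n by apply: VG_le um; exact: leq_maxr.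
have vn : v \in VG n by apply: VG_le vm; exact: leq_maxr.
have hN : (N <= n)%N by apply: leq_trans hn0 _; exact: leq_maxl.
have hKe : K * (4 / 5) ^+ n <= e.
  apply: le_trans (ltW hne0); rewrite -mulrA; apply: (@le_trans _ _ (K * (4 / 5) ^+ n0)).
    apply: ler_wpM2l; first exact: ltW.
    by apply: ler_wiXn2l; [lra|lra|exact: leq_maxl].
  by move: (mulr_gt0 K0 (pow45_gt0 R n0)); lra.
have [L [h1 h2 h3]] := chains un vn.
have hsum := dd_chain un vn h1 h2 h3.
have [L1 [L2 [eL hL1]]] : exists L1 L2, L = L1 ++ L2 /\
    `|\sum_(x <- L1) c n x - s| <= e.
  move: hs; rewrite hsum; elim: L s h1 {h2 h3 hsum} => [|x L IH] s.
    rewrite big_nil => _ hs; exists [::], [::]; split=> //.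
    have -> : s = 0 by move: hs; lra.
    by rewrite big_nil subrr normr0 ltW.
  case/andP => hx hL; rewrite big_cons => hs.
  have cx : c n x <= e by apply: le_trans hKe; apply: c_le => //; case/and3P: hx => /eqP.
  have [hsx|hsx] := leP s (c n x).
    exists [::], (x :: L); split=> //; rewrite big_nil sub0r normrN ger0_norm; move: hs hsx cx; lra.
  have [|L1 [L2 [-> h]]] := IH (s - c n x) hL; first by move: hs hsx; lra.
  exists (x :: L1), L2; split=> //; rewrite big_cons.
  by rewrite (_ : _ + _ - s = \sum_(j <- L1) c n j - (s - c n x)) //; lra.
move: h1 h2 h3; rewrite eL all_cat => /andP[v1 v2] h2 /chain_split [z [c1 c2]].
have zn := chain_end v1 un c1.
have [s1 s2] : switching L1 /\ switching L2.
  by move: h2; rewrite /switching; case/cat_sorted2.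
exists z; split; first by exists n.
- by rewrite hsum eL big_cat /= (dd_chain un zn v1 s1 c1) (dd_chain zn vn v2 s2 c2).
- by rewrite (dd_chain un zn v1 s1 c1).
Qed.

End LimitMetric.

(** * Geodesic 0-hyperbolic spaces *)

Section RTree.
Variables (R : realType) (X : Type) (dX : X -> X -> R).
Hypothesis dm : is_metric dX.
Hypothesis hyp : zero_hyperbolic_on setT dX.
Hypothesis between : forall x y (s : R), 0 <= s <= dX x y ->
  exists z, dX x z = s /\ dX z y = dX x y - s.

Lemma dX_eq0 x y : dX x y = 0 -> x = y.
Proof. by move=> h; case: (dm (z := y) (I : setT x) (I : setT y) I) => [[h' _] _ _]; exact: h'. Qed.

Lemma dX_refl x : dX x x = 0.
Proof. by case: (dm (z := x) (I : setT x) (I : setT x) I) => [[_ h] _ _]; exact: h. Qed.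

Lemma dX_sym x y : dX x y = dX y x.
Proof. by case: (dm (z := y) (I : setT x) (I : setT y) I). Qed.

Lemma dX_tri x y z : dX x z <= dX x y + dX y z.
Proof. by case: (dm (I : setT x) (I : setT y) (I : setT z)). Qed.

Lemma dX_ge0 x y : 0 <= dX x y.
Proof. by have := dX_tri x y x; rewrite dX_refl (dX_sym y x); lra. Qed.

Lemma dX_4pt u v x y :
  dX u v + dX x y <= dX u x + dX v y \/ dX u v + dX x y <= dX u y + dX v x.
Proof.
have := hyp (I : setT u) (I : setT v) (I : setT x) (I : setT y).
by rewrite le_max => /orP.
Qed.

Section Segment.
Variables x y : X.
Let D := dX x y.

Definition seg (s : R) : X :=
  match pselect (0 <= s <= dX x y) with
  | left h => projT1 (cid (between h))
  | right _ => x
  end.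

Lemma segP s : 0 <= s <= D -> dX x (seg s) = s /\ dX (seg s) y = D - s.
Proof.
move=> hs; rewrite /seg; case: pselect => // h; exact: projT2 (cid (between h)).
Qed.

(** The four-point condition for the two points together with [x] and [y] gives the upper bound. In
    particular a point between [x] and [y] is determined by its distance to [x], so arbitrary
    choices form a geodesic. *)
Lemma seg_isometry s s' : 0 <= s <= D -> 0 <= s' <= D ->
  dX (seg s) (seg s') = `|s - s'|.
Proof.
move=> hs hs'; have [h1 h2] := segP hs; have [h3 h4] := segP hs'.
have t1 := dX_tri x (seg s) (seg s'); have t2 := dX_tri x (seg s') (seg s).
rewrite (dX_sym (seg s') (seg s)) h3 h1 in t2; rewrite h1 h3 in t1.
have := dX_4pt (seg s) (seg s') x y; rewrite ![dX (seg _) x]dX_sym h1 h2 h3 h4 -/D.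
move=> h; apply/eqP; rewrite eq_le; apply/andP; split.
  by rewrite ler_normr; apply/orP; case: h => h; [left|right]; lra.
by rewrite ler_norml; apply/andP; split; lra.
Qed.

Lemma seg0 : seg 0 = x.
Proof.
have [|h _] := @segP 0; first by rewrite lexx dX_ge0.
exact/esym/dX_eq0.
Qed.

Lemma segD : seg D = y.
Proof.
have [|_ h] := @segP D; first by rewrite lexx dX_ge0.
by apply: dX_eq0; rewrite h subrr.
Qed.

(** Gromov products: [proj z] is $(y|z)_x$, the parameter of the point of the segment nearest to
    [z], and [height z] is $(x|y)_z$, the distance of [z] to the segment. *)
Definition proj z : R := (D + dX x z - dX z y) / 2.
Definition height z : R := (dX x z + dX z y - D) / 2.

Lemma height_ge0 z : 0 <= height z.
Proof. by have := dX_tri x z y; rewrite /height -/D; lra. Qed.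

Lemma proj_bounds z : 0 <= proj z <= D.
Proof.
have h1 := dX_tri z x y; have h2 := dX_tri x y z.
rewrite (dX_sym z x) -/D in h1; rewrite (dX_sym y z) -/D in h2.
by rewrite /proj; apply/andP; split; lra.
Qed.

Lemma proj_lipschitz z z' : `|proj z - proj z'| <= dX z z'.
Proof.
have h1 := dX_tri x z z'; have h2 := dX_tri x z' z; have h3 := dX_tri z z' y.
have h4 := dX_tri z' z y; rewrite (dX_sym z' z) in h2 h4.
by rewrite /proj ler_norml; apply/andP; split; lra.
Qed.

Lemma height_lipschitz z z' : `|height z - height z'| <= dX z z'.
Proof.
have h1 := dX_tri x z z'; have h2 := dX_tri x z' z; have h3 := dX_tri z z' y.
have h4 := dX_tri z' z y; rewrite (dX_sym z' z) in h2 h4.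
by rewrite /height ler_norml; apply/andP; split; lra.
Qed.

Lemma dist_seg_proj z : dX z (seg (proj z)) <= height z.
Proof.
have [h1 h2] := segP (proj_bounds z).
have := dX_4pt z (seg (proj z)) x y.
rewrite (dX_sym z x) (dX_sym (seg _) x) h1 h2 -/D /proj /height.
by case; lra.
Qed.

Lemma height0_seg z : height z = 0 -> z = seg (proj z).
Proof.
move=> h; apply: dX_eq0; apply/eqP; rewrite eq_le dX_ge0 andbT -h.
exact: dist_seg_proj.
Qed.

(** Points with different projections are connected through the segment only, so their distance
    exceeds the sum of their heights. *)
Lemma proj_locally_constant z z' : dX z z' < height z -> proj z = proj z'.
Proof.
have key u v : dX u v < height u \/ dX u v < height v -> proj u <= proj v.
  move=> h; have h1 := height_ge0 u; have h2 := height_ge0 v.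
  rewrite leNgt; apply/negP => hlt.
  have := dX_4pt x u y v; move: h h1 h2 hlt; rewrite /height /proj (dX_sym y v) -/D.
  by move=> h h1 h2 hlt; case=> ?; case: h => ?; lra.
move=> h; apply/eqP; rewrite eq_le; apply/andP; split; first by apply: key; left.
by apply: key; right; rewrite dX_sym.
Qed.

Lemma return_to_seg g tau : mcont01 dX g -> height (g 1) = 0 -> 0 <= tau <= 1 ->
  0 < height (g tau) -> exists sigma, [/\ tau < sigma, sigma <= 1 &
    g sigma = seg (proj (g tau))].
Proof.
move=> hg h1 /andP[t0 t1] ht; set P0 := proj (g tau).
pose E := [set r : R | tau <= r <= 1 /\ (height (g r) = 0 \/ proj (g r) <> P0)].
have E1 : E 1 by split; [rewrite t1 lexx|left].
have lbE : lbound E tau by move=> r [/andP[]].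
have hasE : has_inf E by split; [exists 1|exists tau].
pose s := inf E.
have ts : tau <= s by apply: lb_le_inf => //; exists 1.
have s1 : s <= 1 by apply: ge_inf => //; exists tau.
have s01 : 0 <= s <= 1 by apply/andP; split; lra.
have below r : tau <= r -> r < s -> height (g r) <> 0 /\ proj (g r) = P0.
  move=> h2 h3; have hn : ~ E r.
    move=> hE; have hsr : s <= r by apply: ge_inf => //; exists tau.
    lra.
  split=> [h|]; first by apply: hn; split; [apply/andP; split; lra|left].
  by apply: contrapT => h; apply: hn; split; [apply/andP; split; lra|right].
(* If [g s] were off the segment, [proj] would be constant near [s]: equal to [P0] because of the
   times up to [s], yet different from it because of a time of [E] at or just after [s]. *)
have hs0 : height (g s) = 0.
  apply: contrapT => hn; have hpos : 0 < height (g s).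
    by rewrite lt_neqAle height_ge0 andbT; apply/eqP => e; apply: hn.
  have [del [d0 hdel]] := hg s s01 _ hpos.
  have [r [hrE hr]] : exists r, E r /\ r < s + del.
    have [r hE hr] := inf_adherent d0 hasE; by exists r.
  have sr : s <= r by apply: ge_inf => //; exists tau.
  have r01 : 0 <= r <= 1 by case: hrE => /andP[? ?] _; apply/andP; split; lra.
  have dr : dX (g s) (g r) < height (g s).
    rewrite dX_sym; apply: hdel => //; rewrite ger0_norm; lra.
  have pr := proj_locally_constant dr.
  have hr0 : proj (g s) <> P0.
    case: hrE => _ [h0|]; last by rewrite pr.
    have := height_lipschitz (g s) (g r); rewrite h0 subr0 ger0_norm ?height_ge0 //.
    by move=> h; lra.
  have [ets|ets] := eqVneq tau s; first by apply: hr0; rewrite -ets.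
  have lts : tau < s by rewrite lt_neqAle ets ts.
  pose q := Num.max tau (s - del / 2).
  have [q1 q2 q3] : [/\ tau <= q, q < s & s - del < q].
    rewrite /q; case: (leP tau (s - del / 2)) => h; split; lra.
  have [_ hq] := below q q1 q2.
  apply: hr0; rewrite -hq; apply: proj_locally_constant; rewrite dX_sym; apply: hdel.
    by apply/andP; split; lra.
  by rewrite ltr0_norm; lra.
have lts : tau < s.
  rewrite lt_neqAle ts andbT; apply/eqP => e; rewrite -e in hs0; lra.
have ps : proj (g s) = P0.
  apply: contrapT => hn; have e0 : 0 < `|proj (g s) - P0|.
    by rewrite normr_gt0 subr_eq0; apply/eqP.
  have [del [d0 hdel]] := hg s s01 _ e0.
  pose q := Num.max tau (s - del / 2).
  have [q1 q2 q3] : [/\ tau <= q, q < s & s - del < q].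
    rewrite /q; case: (leP tau (s - del / 2)) => h; split; lra.
  have [_ hq] := below q q1 q2.
  have : dX (g q) (g s) < `|proj (g s) - P0|.
    apply: hdel; first by apply/andP; split; lra.
    by rewrite ltr0_norm; lra.
  have := proj_lipschitz (g s) (g q); rewrite hq dX_sym; lra.
exists s; split=> //; rewrite -ps; exact: height0_seg.
Qed.

(** An excursion from the segment returns exactly where it left: applied to the arc and to its
    reversal, [return_to_seg] finds the same point at a time before and a time after [tau], against
    injectivity. *)
Lemma arc_height0 g : x <> y -> mcont01 dX g ->
  (forall s t, 0 <= s <= 1 -> 0 <= t <= 1 -> g s = g t -> s = t) ->
  g 0 = x -> g 1 = y -> forall tau, 0 <= tau <= 1 -> height (g tau) = 0.
Proof.
move=> xy hg hinj g0 g1 tau htau; apply: contrapT => hn.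
have hpos : 0 < height (g tau).
  by rewrite lt_neqAle height_ge0 andbT; apply/eqP => e; apply: hn.
have h1 : height (g 1) = 0 by rewrite g1 /height dX_refl -/D; lra.
have [s [ts s1 es]] := return_to_seg hg h1 htau hpos.
pose g' r := g (1 - r).
have hg' : mcont01 dX g'.
  move=> r hr e e0; have hr' : 0 <= 1 - r <= 1 by apply/andP; split; lra.
  have [del [d0 hdel]] := hg _ hr' e e0; exists del; split=> // q hq hqr.
  apply: hdel; first by apply/andP; split; lra.
  by rewrite (_ : _ - _ = - (q - r)) ?normrN //; lra.
have h1' : height (g' 1) = 0 by rewrite /g' subrr g0 /height dX_refl -/D; lra.
have htau' : 0 <= 1 - tau <= 1 by apply/andP; split; lra.
have et : g' (1 - tau) = g tau by rewrite /g'; congr g; lra.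
have hpos' : 0 < height (g' (1 - tau)) by rewrite et.
have [s' [ts' s1' es']] := return_to_seg hg' h1' htau' hpos'.
rewrite et -es in es'.
have : 1 - s' = s by apply: hinj => //; apply/andP; split; lra.
lra.
Qed.

End Segment.

Lemma Rtree_of_geodesic : is_Rtree dX.
Proof.
move=> x y; pose D := dX x y; pose A := seg x y @` [set s | 0 <= s <= D].
have D0 : 0 <= D by exact: dX_ge0.
exists A; split.
- have [xy|xy] := pselect (x = y).
    left; split=> //; have D00 : D = 0 by rewrite /D xy dX_refl.
    apply/seteqP; split=> [z [s /= hs <-]|z /= ->].
      by rewrite (_ : s = 0) ?seg0 //; lra.
    by exists 0; rewrite ?seg0 //= D00 lexx.
  right; split=> //; exists (fun r => seg x y (r * D)).
  have Dpos : 0 < D.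
    by rewrite lt_neqAle D0 andbT; apply/eqP => e; apply: xy; exact: dX_eq0.
  have hr r : 0 <= r <= 1 -> 0 <= r * D <= D by move=> hr; apply/andP; split; nra.
  split.
  + move=> r r01 e e0; exists (e / D); split; first exact: divr_gt0.
    move=> q q01 hq; rewrite seg_isometry ?hr // -mulrBl normrM (gtr0_norm Dpos).
    by rewrite -ltr_pdivlMr.
  + move=> r q r01 q01 e; have := seg_isometry (hr r r01) (hr q q01).
    rewrite e dX_refl => /esym/eqP; rewrite normr_eq0 subr_eq0 => /eqP.
    by apply: mulIf; rewrite gt_eqF.
  + by rewrite mul0r seg0.
  + by rewrite mul1r segD.
  apply/seteqP; split=> [z [s /= hs <-]|z [r /= r01 <-]]; last first.
    by exists (r * D) => //; exact: hr.
  exists (s / D); last by rewrite divfK ?gt_eqF.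
  apply/andP; split; first by apply: divr_ge0; lra.
  by rewrite ler_pdivrMr //; lra.
- move=> B [[xy ->]|[xy [g [hg hinj g0 g1 ->]]]].
    have D00 : D = 0 by rewrite /D xy dX_refl.
    apply/seteqP; split=> [z /= ->|z [s /= hs <-]].
      by exists 0; rewrite ?seg0 //= D00 lexx.
    by rewrite (_ : s = 0) ?seg0 //; lra.
  have hh := arc_height0 xy hg hinj g0 g1.
  have gA r : 0 <= r <= 1 -> g r = seg x y (proj x y (g r)).
    by move=> /hh; exact: height0_seg.
  apply/seteqP; split=> [z [r /= r01 <-]|z [s /= hs <-]].
    by exists (proj x y (g r)); [exact: proj_bounds|rewrite -gA].
  (* Clamping to [0, 1] extends the projected arc continuously to the line; the intermediate value
     theorem then shows that it covers the whole segment. *)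
  pose cl (r : R) : R := Num.max 0 (Num.min 1 r).
  have cl01 r : 0 <= cl r <= 1.
    by rewrite /cl le_max lexx /= ge_max ler01 /= ge_min lexx.
  have cl_lip r q : `|cl r - cl q| <= `|r - q|.
    have n1 := ler_norm (r - q); have n2 := ler_norm (- (r - q)).
    rewrite normrN in n2; rewrite /cl !minEle !maxEle ler_norml.
    by case: (lerP 1 r) => h1 /=; case: (lerP 1 q) => h2 /=; rewrite ?ler01;
      case: (lerP 0 r) => h3 /=; case: (lerP 0 q) => h4 /=; apply/andP; split; lra.
  pose f r := proj x y (g (cl r)).
  have fc : continuous f.
    move=> r; apply/cvgrPdist_lt => e e0.
    have [del [d0 hdel]] := hg (cl r) (cl01 r) e e0.
    near=> q; apply: le_lt_trans (proj_lipschitz x y _ _) _; rewrite dX_sym.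
    apply: hdel; first exact: cl01.
    apply: le_lt_trans (cl_lip _ _) _; rewrite distrC.
    near: q; by exists del.
  have e0 : f 0 = 0.
    rewrite /f (_ : cl 0 = 0); last by rewrite /cl (min_r ler01) maxxx.
    by rewrite g0 /proj dX_refl; lra.
  have e1 : f 1 = D.
    rewrite /f (_ : cl 1 = 1); last by rewrite /cl minEle lexx maxEle ler01.
    by rewrite g1 /proj dX_refl -/D; lra.
  have [r _ hr] : exists2 r, r \in `[0, 1] & f r = s.
    apply: IVT => //; first exact: continuous_subspaceT.
    by rewrite e0 e1 minEle maxEle D0.
  exists (cl r) => /=; first exact: cl01.
  by rewrite gA // -hr.
exists 0, D, (seg x y); split=> // s r hs hr; exact: seg_isometry.
Unshelve. all: by end_near.
Qed.

End RTree.

(** * The completion *)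

Section Completion.
Variables (R : realType) (Y : Type) (S : set Y) (d : Y -> Y -> R).
Hypothesis dm : is_metric_on S d.
Variable u0 : Y.
Hypothesis Su0 : S u0.

Lemma don_eq0 x : S x -> d x x = 0.
Proof. by move=> hx; case: (dm hx hx hx) => [[_ h] _ _]; exact: h. Qed.

Lemma don_sym x y : S x -> S y -> d x y = d y x.
Proof. by move=> hx hy; case: (dm hx hy hy). Qed.

Lemma don_tri x y z : S x -> S y -> S z -> d x z <= d x y + d y z.
Proof. by move=> hx hy hz; case: (dm hx hy hz). Qed.

(* The completion is the closure of the Kuratowski embedding [u |-> d u _]. *)
Definition in_closure (phi : Y -> R) : Prop :=
  (forall e, 0 < e -> exists u, S u /\ forall v, S v -> `|phi v - d u v| <= e) /\
  forall v, ~ S v -> phi v = 0.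

Definition cpl := {phi : Y -> R | in_closure phi}.

Definition ev (x : cpl) (v : Y) : R := proj1_sig x v.

Lemma cpl_eq (x y : cpl) : (forall v, S v -> ev x v = ev y v) -> x = y.
Proof.
case: x y => [f hf] [g hg] h.
have e : f = g.
  apply/funext => v; have [hv|hv] := pselect (S v); first exact: h.
  by rewrite hf.2 // hg.2.
by subst g; congr exist; exact: Prop_irrelevance.
Qed.

Definition diffs (x y : cpl) : set R := [set r | exists2 v, S v & r = `|ev x v - ev y v|].

Definition dX (x y : cpl) : R := sup (diffs x y).

Lemma diffs_has_sup x y : has_sup (diffs x y).
Proof.
split; first by exists `|ev x u0 - ev y u0|; exists u0.
have [u [hu h1]] := (proj2_sig x).1 1 ltr01.
have [w [hw h2]] := (proj2_sig y).1 1 ltr01.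
exists (2 + d u w) => _ [v hv ->].
have := h1 v hv; have := h2 v hv; rewrite -/(ev x v) -/(ev y v) !ler_norml.
move=> /andP[a1 a2] /andP[a3 a4].
have := don_tri hu hw hv; have := don_tri hw hu hv; rewrite (don_sym hw hu).
by move=> b1 b2; apply/andP; split; lra.
Qed.

Lemma le_dX x y v : S v -> `|ev x v - ev y v| <= dX x y.
Proof.
by move=> hv; apply: ub_le_sup; [exact: (diffs_has_sup x y).2|exists v].
Qed.

Lemma dX_le x y e : (forall v, S v -> `|ev x v - ev y v| <= e) -> dX x y <= e.
Proof.
move=> h; apply: ge_sup; first exact: (diffs_has_sup x y).1.
by move=> _ [v hv ->]; exact: h.
Qed.

Lemma dX_metric : is_metric dX.
Proof.
move=> x y z _ _ _; split.
- split=> [h|->].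
    apply: cpl_eq => v hv; apply/eqP; rewrite -subr_eq0 -normr_le0 -h.
    exact: le_dX.
  apply/eqP; rewrite eq_le; apply/andP; split.
    by apply: dX_le => v _; rewrite subrr normr0.
  by apply: le_trans (le_dX y y Su0); exact: normr_ge0.
- by apply/eqP; rewrite eq_le; apply/andP; split; apply: dX_le => v hv;
    rewrite distrC; exact: le_dX.
apply: dX_le => v hv; apply: le_trans (lerD (le_dX x y hv) (le_dX y z hv)).
by rewrite (_ : _ - _ = (ev x v - ev y v) + (ev y v - ev z v)) ?ler_normD //; lra.
Qed.

Definition kura (u v : Y) : R := if `[< S v >] then d u v else 0.

Lemma kura_in u : S u -> in_closure (kura u).
Proof.
move=> hu; split=> [e e0|v hv]; last by rewrite /kura asboolF.
by exists u; split=> // v hv; rewrite /kura asboolT // subrr normr0 ltW.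
Qed.

(** The embedding has to be total, so points outside [S] are sent to the image of the base point. *)
Definition kuratowski (u : Y) : cpl :=
  match pselect (S u) with
  | left h => exist _ _ (kura_in h)
  | right _ => exist _ _ (kura_in Su0)
  end.

Lemma ev_iota u v : S u -> S v -> ev (kuratowski u) v = d u v.
Proof.
by move=> hu hv; rewrite /kuratowski; case: pselect => // h; rewrite /ev /= /kura asboolT.
Qed.

Lemma kuratowski_isometry u v : S u -> S v -> dX (kuratowski u) (kuratowski v) = d u v.
Proof.
move=> hu hv; apply/eqP; rewrite eq_le; apply/andP; split.
  apply: dX_le => w hw; rewrite !ev_iota // ler_norml.
  have := don_tri hu hv hw; have := don_tri hv hu hw; rewrite (don_sym hv hu).
  by move=> b1 b2; apply/andP; split; lra.
apply: le_trans (le_dX _ _ hv); rewrite !ev_iota // don_eq0 // subr0.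
exact: ler_norm.
Qed.

Lemma kuratowski_dense x e : 0 < e -> exists v, S v /\ dX x (kuratowski v) < e.
Proof.
move=> e0; have e2 : 0 < e / 2 by lra.
have [u [hu h]] := (proj2_sig x).1 _ e2; exists u; split=> //.
apply: (@le_lt_trans _ _ (e / 2)); last by lra.
by apply: dX_le => v hv; rewrite ev_iota //; exact: h.
Qed.

Lemma dX_complete : mcomplete dX.
Proof.
move=> x hx.
have hc v : S v -> exists l : R, (fun n => ev (x n) v) @ \oo --> l.
  move=> hv; apply/cvg_ex; apply/cauchy_cvgP/cauchy_exP => e e0.
  have [N hN] := hx e e0; exists (ev (x N) v); exists N => // n /= hn.
  by apply: le_lt_trans (hN N n _ hn) => //; exact: le_dX.
pose phi v : R := match pselect (S v) with
  | left h => projT1 (cid (hc v h)) | right _ => 0 end.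
have hphi v : S v -> (fun n => ev (x n) v) @ \oo --> phi v.
  by move=> hv; rewrite /phi; case: pselect => // h; exact: projT2 (cid (hc v h)).
have hunif e : 0 < e -> exists N, forall n, (N <= n)%N -> forall v, S v ->
    `|ev (x n) v - phi v| <= e.
  move=> e0; have [N hN] := hx e e0; exists N => n hn v hv.
  have hl : (fun m => `|ev (x n) v - ev (x m) v|) @ \oo --> `|ev (x n) v - phi v|.
    by apply: cvg_norm; apply: cvgB; [exact: cvg_cst|exact: hphi].
  apply: (ler_cvg_to hl (cvg_cst e)); exists N => // m /= hm.
  by apply: le_trans (le_dX _ _ hv) _; apply: ltW; exact: hN.
have hin : in_closure phi.
  split=> [e e0|v hv]; last by rewrite /phi; case: pselect.
  have e2 : 0 < e / 2 by lra.
  have [N hN] := hunif _ e2; have [u [hu h]] := (proj2_sig (x N)).1 _ e2.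
  exists u; split=> // v hv; have := hN N (leqnn N) v hv; have := h v hv.
  rewrite -/(ev (x N) v) !ler_norml => /andP[a1 a2] /andP[a3 a4].
  by apply/andP; split; lra.
exists (exist _ phi hin) => e e0; have e2 : 0 < e / 2 by lra.
have [N hN] := hunif _ e2; exists N => n hn.
apply: (@le_lt_trans _ _ (e / 2)); last by lra.
by apply: dX_le => v hv; exact: hN.
Qed.

Lemma cpl_completion : is_completion S d dX kuratowski.
Proof.
split; [exact: dX_metric|exact: dX_complete|exact: kuratowski_isometry|exact: kuratowski_dense].
Qed.

Let tri := dX_tri dX_metric.
Let sym := dX_sym dX_metric.

Lemma cpl_totally_bounded : totally_bounded_on S d -> totally_bounded_on setT dX.
Proof.
move=> htb e e0; have e2 : 0 < e / 2 by lra.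
have [s [hs1 hs2]] := htb _ e2; exists [seq kuratowski u | u <- s]; split=> // x _.
have [u [hu h]] := kuratowski_dense x e2; have [p [hp hup]] := hs2 u hu.
exists (kuratowski p); split; first exact: List.in_map.
apply: le_lt_trans (tri x (kuratowski u) (kuratowski p)) _.
by rewrite (kuratowski_isometry hu (hs1 p hp)); lra.
Qed.

Lemma cpl_hyperbolic : zero_hyperbolic_on S d -> zero_hyperbolic_on setT dX.
Proof.
move=> hh u v x y _ _ _ _; rewrite leNgt; apply/negP => hlt.
(* With approximation within [e], each of the six distances changes by at most [2 * e], so the two
   sides together by at most [8 * e], less than the gap [16 * e]. *)
set M := Num.max _ _ in hlt; pose e := (dX u v + dX x y - M) / 16.
have e0 : 0 < e by rewrite /e; lra.
have [a [ha h1]] := kuratowski_dense u e0; have [b [hb h2]] := kuratowski_dense v e0.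
have [p [hp h3]] := kuratowski_dense x e0; have [q [hq h4]] := kuratowski_dense y e0.
have near z w s r : S s -> S r -> dX z (kuratowski s) < e -> dX w (kuratowski r) < e ->
    `|dX z w - d s r| <= 2 * e.
  move=> hs hr g1 g2; rewrite -(kuratowski_isometry hs hr) ler_norml.
  have t1 := tri z (kuratowski s) w; have t2 := tri (kuratowski s) (kuratowski r) w.
  have t3 := tri (kuratowski s) z (kuratowski r); have t4 := tri z w (kuratowski r).
  rewrite (sym (kuratowski r) w) in t2; rewrite (sym (kuratowski s) z) in t3.
  by apply/andP; split; lra.
have := hh a b p q ha hb hp hq; rewrite le_max.
have := near u v a b ha hb h1 h2; have := near x y p q hp hq h3 h4.
have := near u x a p ha hp h1 h3; have := near v y b q hb hq h2 h4.
have := near u y a q ha hq h1 h4; have := near v x b p hb hp h2 h3.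
rewrite !ler_norml => /andP[? ?] /andP[? ?] /andP[? ?] /andP[? ?] /andP[? ?] /andP[? ?].
have m1 : dX u x + dX v y <= M by rewrite /M le_max lexx.
have m2 : dX u y + dX v x <= M by rewrite /M le_max lexx orbT.
have eM : 16 * e = dX u v + dX x y - M by rewrite /e; lra.
by case/orP => h; lra.
Qed.

(** Approximate dividing points are Cauchy: by the four-point condition, points with nearly equal
    distances to [x] and nearly equal distances to [y], almost on a geodesic, are close.
    Completeness supplies the exact point. *)
Lemma cpl_between : zero_hyperbolic_on S d ->
  (forall u v (s e : R), S u -> S v -> 0 < e -> 0 <= s <= d u v ->
    exists z, [/\ S z, d u z + d z v = d u v & `|d u z - s| <= e]) ->
  forall x y (s : R), 0 <= s <= dX x y ->
    exists z, dX x z = s /\ dX z y = dX x y - s.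
Proof.
move=> hh hgeo x y s hs; have hyp := cpl_hyperbolic hh.
have approx e : 0 < e -> exists z, `|dX x z - s| <= e /\ `|dX z y - (dX x y - s)| <= e.
  move=> e0; have f0 : 0 < e / 6 by lra.
  have [u [hu h1]] := kuratowski_dense x f0; have [v [hv h2]] := kuratowski_dense y f0.
  have := kuratowski_isometry hu hv; set D' := d u v => hD.
  have t1 := tri x (kuratowski u) y; have t2 := tri (kuratowski u) (kuratowski v) y.
  have t3 := tri (kuratowski u) x (kuratowski v); have t4 := tri x y (kuratowski v).
  rewrite (sym (kuratowski v) y) in t2; rewrite (sym (kuratowski u) x) in t3.
  have D0 : 0 <= D' by rewrite -hD; exact: (dX_ge0 dX_metric).
  (* [s] is at most [dX x y] but may slightly exceed the distance of the approximating points. *)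
  pose s' := Num.min s D'.
  have hs' : 0 <= s' <= D' by rewrite /s'; case: (leP s D') => h; apply/andP; split; lra.
  have ds : `|s' - s| <= 2 * (e / 6).
    by rewrite ler_norml /s'; case: (leP s D') => h; apply/andP; split; lra.
  have [z [hz g1 g2]] := hgeo u v s' (e / 6) hu hv f0 hs'.
  exists (kuratowski z); have gD : D' = d u v by [].
  have i1 := kuratowski_isometry hu hz; have i2 := kuratowski_isometry hz hv.
  have t5 := tri x (kuratowski u) (kuratowski z); have t6 := tri (kuratowski u) x (kuratowski z).
  have t7 := tri (kuratowski z) (kuratowski v) y; have t8 := tri (kuratowski z) y (kuratowski v).
  rewrite (sym (kuratowski v) y) in t7; rewrite (sym (kuratowski u) x) in t6.
  move: ds g2; rewrite !ler_norml => /andP[? ?] /andP[? ?].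
  by split; apply/andP; split; lra.
have [r [p0 small]] : exists r : nat -> R, (forall k, 0 < r k) /\
    forall e, 0 < e -> exists N, forall k, (N <= k)%N -> r k < e.
  exists (fun k => (k.+1%:R)^-1); split=> [k|e e0]; first by rewrite invr_gt0 ltr0n.
  have /cvgrPdist_lt/(_ e e0) [N _ hN] := @cvg_harmonic R.
  by exists N => k hk; have := hN k hk; rewrite /= sub0r normrN ger0_norm.
pose z k := projT1 (cid (approx _ (p0 k))).
have hz k : `|dX x (z k) - s| <= r k /\ `|dX (z k) y - (dX x y - s)| <= r k :=
  projT2 (cid (approx _ (p0 k))).
have hcau : mcauchy dX z.
  move=> e e0; have e2 : 0 < e / 2 by lra.
  have [N hN] := small _ e2; exists N => m n hm hn.
  have := hN m hm; have := hN n hn; have [a1 a2] := hz m; have [b1 b2] := hz n.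
  move: a1 a2 b1 b2; rewrite !ler_norml => /andP[? ?] /andP[? ?] /andP[? ?] /andP[? ?].
  have := dX_4pt hyp (z m) (z n) x y; rewrite (sym (z m) x) (sym (z n) x).
  by case=> ?; lra.
have [l hl] := dX_complete hcau; exists l.
have key e : 0 < e -> `|dX x l - s| <= e /\ `|dX l y - (dX x y - s)| <= e.
  move=> e0; have e2 : 0 < e / 2 by lra.
  have [N hN] := small _ e2; have [M hM] := hl _ e2.
  pose k := maxn N M; have := hN k (leq_maxl _ _); have := hM k (leq_maxr _ _).
  have [] := hz k; rewrite !ler_norml => /andP[? ?] /andP[? ?] ? ?.
  have t1 := tri x (z k) l; have t2 := tri x l (z k).
  have t3 := tri (z k) l y; have t4 := tri l (z k) y.
  rewrite (sym l (z k)) in t2 t4.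
  by split; apply/andP; split; lra.
split; apply/eqP; rewrite -subr_eq0 -normr_le0; apply/ler_addgt0Pr => e e0;
  by rewrite add0r; have [] := key e e0.
Qed.

End Completion.

(** Otherwise intersecting with balls of radius $2^{-k}$ gives nested sets without finite subcover.
    Points chosen in them converge, and one open set around the limit contains a whole set of the
    sequence. *)
Lemma complete_totally_bounded_compact (R : realType) (X : Type) (dX : X -> X -> R) :
  is_metric dX -> mcomplete dX -> totally_bounded_on setT dX -> mcompact dX.
Proof.
move=> dm hc htb I U hU hcov; apply: contrapT => hno.
have tri := dX_tri dm; have sym := dX_sym dm.
pose fincov (A : set X) := exists s : seq I, forall x, A x ->
  exists i, List.In i s /\ U i x.
have hT : ~ fincov setT.
  by move=> [s hs]; apply: hno; exists s => x; exact: hs.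
pose r k : R := (2 ^+ k)^-1.
have r0 k : 0 < r k by rewrite /r invr_gt0 exprn_gt0.
have step k (A : set X) : ~ fincov A -> exists p, ~ fincov (A `&` [set x | dX x p < r k]).
  move=> hA; apply: contrapT => /forallNP h; apply: hA.
  have {}h p : fincov (A `&` [set x | dX x p < r k]) by apply: contrapT; exact: h.
  have [s [_ hs]] := htb _ (r0 k).
  have [cover hcover] : exists c : seq I, forall x, A x ->
      (exists p, List.In p s /\ dX x p < r k) -> exists i, List.In i c /\ U i x.
    elim: s {hs} => [|p s [c hc']]; first by exists [::] => x _ [p [[] _]].
    have [c' h'] := h p; exists (c' ++ c) => x hx [q [[<-|hq] hxq]].
      by have [i [hi hUi]] := h' x (conj hx hxq); exists i; split=> //;
        apply/List.in_app_iff; left.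
    have [i [hi hUi]] := hc' x hx (ex_intro _ q (conj hq hxq)).
    by exists i; split=> //; apply/List.in_app_iff; right.
  by exists cover => x hx; apply: hcover => //; exact: hs.
pose next k (A : {A : set X | ~ fincov A}) : {A : set X | ~ fincov A} :=
  exist (fun A => ~ fincov A)
    (proj1_sig A `&` [set x | dX x (projT1 (cid (step k (proj1_sig A) (proj2_sig A)))) < r k])
    (projT2 (cid (step k (proj1_sig A) (proj2_sig A)))).
pose A := fix A k := if k is k'.+1 then next k' (A k') else exist (fun A => ~ fincov A) setT hT.
have A_S k : exists p, proj1_sig (A k.+1) = proj1_sig (A k) `&` [set x | dX x p < r k].
  by exists (projT1 (cid (step k (proj1_sig (A k)) (proj2_sig (A k))))).
have A_sub k m x : (k <= m)%N -> proj1_sig (A m) x -> proj1_sig (A k) x.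
  move=> /subnK <-; elim: (m - k)%N => [//|i IH].
  have [p e] := A_S (i + k)%N; rewrite addSn e => -[h _]; exact: IH.
have A_ne k : exists x, proj1_sig (A k) x.
  apply: contrapT => /forallNP h; apply: (proj2_sig (A k)); exists [::] => x hx.
  by case: (h x).
pose y k := projT1 (cid (A_ne k)).
have hy k : proj1_sig (A k) (y k) := projT2 (cid (A_ne k)).
have diam k x x' : proj1_sig (A k.+1) x -> proj1_sig (A k.+1) x' -> dX x x' < 2 * r k.
  have [p e] := A_S k; rewrite e => -[_ /= h1] [_ /= h2].
  by apply: le_lt_trans (tri x p x') _; rewrite (sym p x'); lra.
have small e : 0 < e -> exists k, 2 * r k < e.
  move=> e0; have h : (fun k => (1 / 2 : R) ^+ k) @ \oo --> (0 : R).
    by apply: cvg_expr; rewrite ger0_norm; lra.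
  have e2 : 0 < e / 2 by lra.
  have /cvgrPdist_lt/(_ _ e2) [N _ hN] := h; exists N.
  have := hN N (leqnn N); rewrite /= sub0r normrN ger0_norm; last by apply: exprn_ge0; lra.
  by rewrite expr_div_n expr1n div1r /r; lra.
have [l hl] : exists l, mconverges dX y l.
  apply: hc => e e0; have [k hk] := small e e0; exists k.+1 => m n hm hn.
  by apply: lt_trans hk; apply: diam; [exact: A_sub hm (hy m)|exact: A_sub hn (hy n)].
have [i hi] := hcov l; have [e [e0 he]] := hU i l hi.
have e2 : 0 < e / 2 by lra.
have [k hk] := small _ e2; have [N hN] := hl _ e2.
apply: (proj2_sig (A k.+1)); exists [:: i] => x hx; exists i; split; first by left.
apply: he; pose m := maxn N k.+1.
apply: le_lt_trans (tri l (y m) x) _; rewrite (sym l).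
have h1 := hN m (leq_maxl _ _).
have h2 : dX (y m) x < 2 * r k.
  by apply: diam => //; apply: A_sub (hy m); exact: leq_maxr.
lra.
Qed.

(** * Measurability of the limit metric and conclusion *)

Section Final.
Context (d : measure_display) (Omega : measurableType d) (R : realType)
  (P : probability Omega R) (T : nat -> Omega -> rel Point).
Hypothesis hST : forall n w, isST n (T n w).
Hypothesis hmeas : forall n t, measurable [set w | T n w = t].
Hypothesis hcons : forall n w, Tr n (T n.+1 w) = T n w.

Variable G : set Omega.
Hypothesis mG : measurable G.
Hypothesis hG : forall w, G w -> (exists M, forall m, (M <= m)%N -> ~ bad1 R m (T m.+1 w)) /\
    forall n, exists M, forall j, (M <= j)%N -> ~ bad2 R n j (T (j + n).+1 w).

Definition scaled_dist w u v (m : nat) : R := alphabar ^- m * (dist (T m w) u v)%:R.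

(** The value 0 off the measurable event [G] makes this a limit of measurable functions at every
    point, not only almost everywhere. *)
Definition dstar w u v : R := if `[< G w >] then limn (scaled_dist w u v) else 0.

Lemma dstar_spec w : G w ->
  [/\ forall u v, Vstar u -> Vstar v -> scaled_dist w u v @ \oo --> dstar w u v,
      is_metric_on Vstar (dstar w), zero_hyperbolic_on Vstar (dstar w),
      totally_bounded_on Vstar (dstar w) &
      forall u v (s e : R), Vstar u -> Vstar v -> 0 < e -> 0 <= s <= dstar w u v ->
        exists z, [/\ Vstar z, dstar w u z + dstar w z v = dstar w u v &
          `|dstar w u z - s| <= e]].
Proof.
move=> hw; have [hb1 hb2] := hG hw; pose t m := T m w.
have tST m : isST m (t m) by exact: hST.
have tTr m : Tr m (t m.+1) = t m by exact: hcons.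
have [c [c1 c2 [N [K [K0 c3]]]]] := crossing_limit tTr hb1 hb2.
have hdd u v : Vstar u -> Vstar v ->
    (exists l : R, (fun m => al R ^- m * (dist (t m) u v)%:R) @ \oo --> l) ->
    (fun m => al R ^- m * (dist (t m) u v)%:R) @ \oo --> dstar w u v.
  by move=> _ _ [l hl]; rewrite /dstar asboolT //; apply/cvg_ex; exists l.
split.
- by move=> u v hu hv; exact: (dd_cvg tST tTr c1 hdd hu hv).
- exact: (dd_metric tST tTr c1 c2 hdd).
- exact: (dd_hyperbolic tST tTr c1 hdd).
- exact: (dd_totally_bounded tST tTr c1 c2 K0 c3 hdd).
- by move=> u v s e; exact: (dd_approx_geodesic tST tTr c1 K0 c3 hdd).
Qed.

(** At each stage the scaled distance is a function of $T_m$, which has finitely many values with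
    measurable level sets; multiplication by the indicator of [G] forces convergence everywhere. *)
Lemma measurable_dstar u v : Vstar u -> Vstar v ->
  measurable_fun setT (fun w => dstar w u v).
Proof.
move=> hu hv.
pose h (m : nat) w : R := \1_G w * scaled_dist w u v m.
apply: (@measurable_fun_cvg _ _ _ setT h) => [m|w _].
  apply: measurable_funM; first exact: measurable_indic.
  move=> _ B mB; rewrite setTI.
  exact: (measurable_event hST hmeas m (fun f => B (alphabar ^- m * (dist f u v)%:R))).
have [hw|hw] := pselect (G w).
  have [hc _ _ _ _] := dstar_spec hw.
  rewrite (_ : h ^~ w = scaled_dist w u v); first exact: hc.
  by apply/funext => m; rewrite /h indicE mem_set // mul1r.
rewrite /dstar asboolF // (_ : h ^~ w = fun=> 0); first exact: cvg_cst.
by apply/funext => m; rewrite /h indicE memNset // mul0r.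
Qed.

Lemma measurable_evalSigma A : evalSigma A -> measurable (dstar @^-1` A).
Proof.
move: A; apply: smallest_sub.
  split=> [|A /= hA|F /= hF].
  - by rewrite /= preimage_set0.
  - by rewrite /= setTD preimage_setC; exact: measurableC.
  - by rewrite /= preimage_bigcup; apply: bigcup_measurable => k _; exact: hF.
move=> _ [u [v [B [hu hv mB ->]]]] /=.
have := measurable_dstar hu hv measurableT mB; rewrite setTI; exact.
Qed.

End Final.

Theorem mainTheorem15 (d : measure_display) (Omega : measurableType d)
  (R : realType) (P : probability Omega R)
  (T : nat -> Omega -> rel Point)
  (hST : forall n w, isST n (T n w))
  (hmeas : forall n t, measurable [set w | T n w = t])
  (hunif : forall n t1 t2, isST n t1 -> isST n t2 ->
     P [set w | T n w = t1] = P [set w | T n w = t2])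
  (hcons : forall n w, Tr n (T n.+1 w) = T n w) :
  exists dstar : Omega -> Point -> Point -> R,
    (forall A, evalSigma A -> measurable (dstar @^-1` A)) /\
    {ae P, forall w,
      [/\ forall u v, Vstar u -> Vstar v ->
            ((fun m : nat => (@alphabar R ^- m) * (dist (T m w) u v)%:R : R) @ \oo
              --> (dstar w u v : R)),
          is_metric_on Vstar (dstar w),
          zero_hyperbolic_on Vstar (dstar w),
          totally_bounded_on Vstar (dstar w) &
          exists (X : Type) (dX : X -> X -> R) (iota : Point -> X),
            [/\ is_completion Vstar (dstar w) dX iota, mcompact dX &
                is_Rtree dX]]}.
Proof.
have [G [mG PG hG]] := good_event hST hmeas hunif hcons.
exists (dstar R T G); split; first exact: measurable_evalSigma.
exists (~` G); split; [exact: measurableC|exact: PG|].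
move=> w /= hn hw; apply: hn.
have [h1 h2 h3 h4 h5] := dstar_spec hST hcons hG hw.
have hu0 : Vstar (uu i0) by exists 0%N; apply/VGP; exists [::], i0.
split=> //.
exists (cpl Vstar (dstar R T G w)), (@dX _ _ Vstar (dstar R T G w)), (kuratowski (dstar R T G w) hu0).
have dXm := dX_metric h2 hu0.
split; first exact: (cpl_completion h2 hu0).
  apply: (complete_totally_bounded_compact dXm (dX_complete h2 hu0)).
  exact: (cpl_totally_bounded h2 hu0 h4).
apply: (Rtree_of_geodesic dXm (cpl_hyperbolic h2 hu0 h3)).
exact: (cpl_between h2 hu0 h3 h5).
Qed.
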